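(* Let $N,m,n\ge 1$ be integers and assign positive integer weights $w_k$ to the coordinates $x_k$ of $\mathbb{C}^N$, $k=1,\ldots,N$; write $\underline{w}=(w_1,\ldots,w_N)$. Suppose that for $1\le i\le m$, $1\le j\le n$, $f_{ij}(x_1,\ldots,x_N)$ is weighted homogeneous of degree $d_{ij}$ with respect to the weights $\underline{w}$, and put $\mathcal{D}=(d_{ij})$. Suppose that $F=(f_{ij}):(\mathbb{C}^N,0)\to M_{mn}$ is finitely $\mathcal{G}$-determined and weighted homogeneous of type $(\mathcal{D};\underline{w})$. Let $G=(g_{ij}):(\mathbb{C}^N,0)\to M_{mn}$ be a polynomial mapping such that, for all $i,j$, the degree of $g_{ij}$ (with respect to the weights $\underline{w}$) is less than $d_{ij}$. Then $F+G:(\mathbb{C}^N,0)\to M_{mn}$ is finitely $\mathcal{G}$-determined. Moreover, $$d_e(F,\mathcal{G})\ge d_e(F+G,\mathcal{G}).$$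
   Context: $M_{mn}\cong\mathbb{C}^{mn}$ is the space of complex $m\times n$ matrices. $\mathcal{O}_N$ is the ring of germs at $0$ of analytic functions on $\mathbb{C}^N$. $M_{mn}(\mathcal{O}_N)\cong\mathcal{O}_N^{mn}$ is the set of holomorphic map germs $F:(\mathbb{C}^N,0)\to M_{mn}$ (the value $F(0)$ is not required to be $0$). Weights: for a monomial $x^\alpha=x_1^{\alpha_1}\cdots x_N^{\alpha_N}$ put $fil(x^\alpha)=\sum_{i=1}^N w_i\alpha_i$; for $f\in\mathcal{O}_N$, $fil(f)$ is the infimum of $fil(x^\alpha)$ over all $\alpha$ with $\frac{\partial^{|\alpha|}f}{\partial x^\alpha}(0)\ne 0$. A polynomial is weighted homogeneous of degree $d$ with respect to $\underline{w}$ if all its monomials $x^\alpha$ satisfy $fil(x^\alpha)=d$; the degree of a polynomial with respect to $\underline{w}$ is the maximum of $fil(x^\alpha)$ over its monomials. A matrix $F=(f_{ij})$ is weighted homogeneous of type $(\mathcal{D};\underline{w})\in M_{mn}(\mathbb{N})\times\mathbb{N}^N$ if $fil(f_{ij})=d_{ij}$ with respect to $\underline{w}$ and $d_{ij}-d_{ik}=d_{lj}-d_{lk}$ for all $1\le i,l\le m$, $1\le j,k\le n$. The group $\mathcal{G}$: let $\mathcal{R}$ be the group of germs of analytic diffeomorphisms of $(\mathbb{C}^N,0)$, $\mathcal{H}=GL_n(\mathcal{O}_N)\times GL_m(\mathcal{O}_N)$ and $\mathcal{G}=\mathcal{R}\ltimes\mathcal{H}$. Two germs $F_1,F_2\in M_{mn}(\mathcal{O}_N)$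 are $\mathcal{G}$-equivalent if there exist $h\in\mathcal{R}$, $R\in GL_n(\mathcal{O}_N)$, $L\in GL_m(\mathcal{O}_N)$ with $F_1=L^{-1}(h^*F_2)R$, where $h^*F_2=F_2\circ h$. A germ $F\in M_{mn}(\mathcal{O}_N)$ is $r$-$\mathcal{G}$-determined if every $G\in M_{mn}(\mathcal{O}_N)$ with $j^rG(0)=j^rF(0)$ ($r$-jets at $0$) is $\mathcal{G}$-equivalent to $F$; $F$ is finitely $\mathcal{G}$-determined if such an $r$ exists. Extended codimension: let $C_{pq}(F)$ (respectively $R_{lk}(F)$) be the $m\times n$ matrix whose $p$-th column (respectively $l$-th row) equals the $q$-th column (respectively $k$-th row) of $F$, with zeros elsewhere. Let $J(F)$ be the $\mathcal{O}_N$-submodule of $M_{mn}(\mathcal{O}_N)$ generated by $\frac{\partial F}{\partial x_\lambda}$, $\lambda=1,\ldots,N$. Put $$T\mathcal{G}_eF=J(F)+\mathcal{O}_N\{R_{lk}(F),C_{pq}(F)\},\quad 1\le l,k\le m,\ 1\le p,q\le n,$$ and $d_e(F,\mathcal{G})=\dim_{\mathbb{C}}\frac{M_{mn}(\mathcal{O}_N)}{T\mathcal{G}_eF}$. *)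

(* Defs.v *)
From HB Require Import structures.
From mathcomp Require Import all_boot all_order all_algebra.
From mathcomp Require Import complex.
From mathcomp Require Import all_classical all_reals all_analysis.
From mathcomp Require Import summability.
(* The notations of mpoly clash with those of MathComp-Analysis. *)
From mathcomp Require Import -(notations) mpoly.

Set Implicit Arguments.
Unset Strict Implicit.
Unset Printing Implicit Defensive.

Import Order.TTheory GRing.Theory Num.Theory.
Import numFieldNormedType.Exports.

Local Open Scope classical_set_scope.
Local Open Scope ring_scope.

(* The field of complex numbers; declaring it as a numClosedFieldType gives it
   the topology of its norm. *)
Definition Cplx (R : realType) : numClosedFieldType := R[i]%C.

(* A germ at 0 is represented by a function defined on all of C^N, two functions
   representing the same germ when they agree on a neighbourhood of 0. All the
   notions below only depend on germs in this sense. *)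

Section Germs.
Variables (R : realType) (N : nat).
Local Notation C := (Cplx R).
Local Notation CN := 'rV[C]_N.

Definition near0 (P : CN -> Prop) : Prop := \forall x \near (0 : CN), P x.

Definition monomial (a : multinom N) (x : CN) : C := \prod_(i < N) x 0 i ^+ a i.

(* The power series is summed unconditionally, i.e. along the finite sets of
   multi-indices ordered by inclusion; over C this is absolute convergence. *)
Definition analytic_germ (f : CN -> C) : Prop :=
  exists c : multinom N -> C, near0 (fun x =>
    partial_sum (fun a => c a * monomial a x) @ totally --> f x).

Definition analytic_germ_mx (m n : nat) (F : CN -> 'M[C]_(m, n)) : Prop :=
  forall i j, analytic_germ (fun x => F x i j).

Definition partial (i : 'I_N) (f : CN -> C) : CN -> C :=
  fun x => 'D_(delta_mx 0 i) f x.

Definition partial_mx (m n : nat) (i : 'I_N) (F : CN -> 'M[C]_(m, n)) :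
    CN -> 'M[C]_(m, n) :=
  fun x => \matrix_(k, l) partial i (fun y => F y k l) x.

Definition mpartial (a : multinom N) (f : CN -> C) : CN -> C :=
  foldr (fun i g => iter (a i) (partial i) g) f (enum 'I_N).

Definition same_jet (m n r : nat) (F G : CN -> 'M[C]_(m, n)) : Prop :=
  forall a : multinom N, (mdeg a <= r)%N -> forall i j,
    mpartial a (fun x => F x i j) 0 = mpartial a (fun x => G x i j) 0.

End Germs.

Section Weights.
Variables (R : realType) (N : nat) (w : 'I_N -> nat).
Local Notation C := (Cplx R).
Local Notation CN := 'rV[C]_N.

Definition fil_mon (a : multinom N) : nat := (\sum_(i < N) w i * a i)%N.

(* fil f = +oo when all the derivatives of f vanish at 0. *)
Definition fil (f : CN -> C) : \bar R :=
  ereal_inf [set (fil_mon a)%:R%:E | a in [set a | mpartial a f 0 != 0]].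

Definition germ_of_poly (p : mpoly N C) (f : CN -> C) : Prop :=
  near0 (fun x => f x = meval (fun i => x 0 i) p).

Definition weighted_homogeneous (d : nat) (f : CN -> C) : Prop :=
  exists2 p : mpoly N C, germ_of_poly p f &
    forall a, a \in msupp p -> fil_mon a = d.

(* The zero polynomial has degree -oo. *)
Definition wdegree (p : mpoly N C) : \bar R :=
  \big[Order.max/-oo%E]_(a <- msupp p) (fil_mon a)%:R%:E.

Definition weighted_homogeneous_type (m n : nat) (D : 'M[nat]_(m, n))
    (F : CN -> 'M[C]_(m, n)) : Prop :=
  (forall i j, fil (fun x => F x i j) = (D i j)%:R%:E) /\
  (forall i l j k,
     (D i j)%:Z - (D i k)%:Z = (D l j)%:Z - (D l k)%:Z :> int).

End Weights.

Section GEquivalence.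
Variables (R : realType) (N : nat).
Local Notation C := (Cplx R).
Local Notation CN := 'rV[C]_N.

Definition diffeo_germ (h : CN -> CN) : Prop :=
  [/\ analytic_germ_mx h, h 0 = 0 &
    exists k : CN -> CN, [/\ analytic_germ_mx k, k 0 = 0,
      near0 (fun x => k (h x) = x) & near0 (fun x => h (k x) = x)]].

Definition GL_germ (p : nat) (A : CN -> 'M[C]_p) : Prop :=
  analytic_germ_mx A /\
  exists B : CN -> 'M[C]_p, [/\ analytic_germ_mx B,
    near0 (fun x => A x *m B x = 1%:M) & near0 (fun x => B x *m A x = 1%:M)].

Definition G_equivalent (m n : nat) (F1 F2 : CN -> 'M[C]_(m, n)) : Prop :=
  exists (h : CN -> CN) (S : CN -> 'M[C]_n) (L : CN -> 'M[C]_m),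
    [/\ diffeo_germ h, GL_germ S, GL_germ L &
      near0 (fun x => F1 x = invmx (L x) *m F2 (h x) *m S x)].

Definition G_determined (m n r : nat) (F : CN -> 'M[C]_(m, n)) : Prop :=
  forall G : CN -> 'M[C]_(m, n),
    analytic_germ_mx G -> same_jet r G F -> G_equivalent G F.

Definition finitely_G_determined (m n : nat) (F : CN -> 'M[C]_(m, n)) : Prop :=
  exists r : nat, G_determined r F.

Definition Rmx (m n : nat) (l k : 'I_m) (F : CN -> 'M[C]_(m, n)) :
    CN -> 'M[C]_(m, n) :=
  fun x => \matrix_(i, j) if i == l then F x k j else 0.

Definition Cmx (m n : nat) (p q : 'I_n) (F : CN -> 'M[C]_(m, n)) :
    CN -> 'M[C]_(m, n) :=
  fun x => \matrix_(i, j) if j == p then F x i q else 0.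

Definition TGe (m n : nat) (F : CN -> 'M[C]_(m, n)) :
    set (CN -> 'M[C]_(m, n)) :=
  [set H | exists (u : 'I_N -> CN -> C) (b : 'I_m -> 'I_m -> CN -> C)
                  (c : 'I_n -> 'I_n -> CN -> C),
    [/\ forall i, analytic_germ (u i),
        forall l k, analytic_germ (b l k),
        forall p q, analytic_germ (c p q) &
        near0 (fun x => H x = \sum_(i < N) u i x *: partial_mx i F x
          + \sum_(l < m) \sum_(k < m) b l k x *: Rmx l k F x
          + \sum_(p < n) \sum_(q < n) c p q x *: Cmx p q F x)]].

(* The complex dimension of a quotient of the space of analytic matrix germs by
   a subspace T, as the largest size of a family of germs that is linearly
   independent modulo T (+oo if there is no largest size). *)
Definition codim (m n : nat) (T : set (CN -> 'M[C]_(m, n))) : \bar R :=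
  ereal_sup [set k%:R%:E | k in [set k : nat |
    exists v : 'I_k -> CN -> 'M[C]_(m, n),
      (forall i, analytic_germ_mx (v i)) /\
      forall z : 'I_k -> C,
        T (fun x => \sum_(i < k) z i *: v i x) -> forall i, z i = 0]].

Definition de (m n : nat) (F : CN -> 'M[C]_(m, n)) : \bar R := codim (TGe F).

End GEquivalence.

(* Main.v *)
From HB Require Import structures.
From mathcomp Require Import all_boot all_order all_algebra.
From mathcomp Require Import finmap complex.
From mathcomp Require Import all_classical all_reals all_analysis.
From mathcomp Require Import summability.
From mathcomp Require Import -(notations) mpoly.
From mathcomp Require Import ring lra zify.
Require Import Defs.

Set Implicit Arguments.
Unset Strict Implicit.
Unset Printing Implicit Defensive.
Import Order.TTheory GRing.Theory Num.Theory.
Import numFieldNormedType.Exports.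
Local Open Scope classical_set_scope.
Local Open Scope ring_scope.

(** Let [T(E)] be the polynomial tangent module of a polynomial matrix [E], i.e.
    the set of the matrices [sum_l u_l d_l E + b E + E c] with polynomial [u],
    [b] and [c]. Everything is decided by this module, in three steps.

    Determinacy makes [T(F)] large. If [F] is [r]-determined then every form of
    degree [r+1] lies in [T(F)] up to higher order (determined_tangent). Let
    [E_t] be the monomial matrices of degree [r+1] and [c_t] complex numbers
    algebraically independent over the coefficients of [F]. Since
    [F + sum_t c_t E_t] is equivalent to [F], there is an identity of jets
    [F + sum_t c_t E_t = B (F o h) S]. Apply to all coefficients a derivation of
    the field of complex numbers that kills the coefficients of [F], maps one
    [c_t] to 1 and the others to 0: the left-hand side becomes [E_t] and, by the
    chain rule, the right-hand side a tangent vector at [B (F o h) S]; undoing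
    [B], [h] and [S] brings it back to [F]. Such derivations come from Zorn's
    lemma (generic_derivations). The equivalences chosen for varying [c_t] need
    not depend analytically on [c_t]; derivations of the coefficients do not
    require it.

    The weights make [T(F + G)] as large as [T(F)]. Give [x^a e_ij] the degree
    [wt a - d_ij]: then [F] has degree 0 and, by the condition on the [d_ij],
    [T(F)] is graded. As the weights are positive, membership up to high order
    is membership (Tp_complete), so the polynomial matrices modulo [T(F)] have a
    finite basis [S] of monomial matrices. A tangent vector of [F + G] differs
    from the tangent vector of [F] with the same coefficients by terms of lower
    degree, hence, by induction on the degree, [S] still spans the polynomial
    matrices modulo [T(F + G)] (spanned_perturb).

    Back to germs. As the quotient by [T(F + G)] is finite-dimensional, there
    are a polynomial [U] with [U(0) = 1] and an integer [k] such that
    [U x^a e_ij] is in [T(F + G)] for [|a| >= k] (local_annihilator). Since [U]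
    is a unit of the local ring, [S] spans the germs modulo the extended tangent
    space of [F + G], while it stays independent modulo that of [F]: this is the
    inequality of codimensions. Finite determinacy of [E = F + G] is also a
    consequence. A germ with the jet of order [2K] of [E], for [K >= k], differs
    from [E] by [sum x^(a+b) H_abij e_ij] with [|a| = |b| = K] and
    [H_abij(0) = 0]. Moving [E] along the vectors [x^b (U x^a e_ij)] with
    unknown coefficients [y_abij] changes it by [sum x^(a+b) (U y + Q) e_ij],
    where [Q] is quadratic in [y] (move_along_tangent): the factor [x^b] is
    there to make the quadratic terms divisible by the same products. It remains
    to solve [U y + Q(x, y) = H] by the implicit function theorem
    (absorb_perturbation).

    Analytic germs are treated as limits of polynomials that are bounded on a
    polydisc and stabilize degree by degree (approx). Sums, products,
    substitutions, derivatives, divisions by monomials and the solution of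
    implicit equations are computed on the polynomials, with norm estimates, and
    jets of germs are read off these polynomials. *)

(** * Complex numbers *)

Section ComplexLimits.
Variable R : realType.
Local Notation C := (Cplx R).
Local Notation hf := ((2 : C)^-1).

Lemma nonneg_real (z : C) : 0 <= z -> exists2 r : R, 0 <= r & z = (r%:C)%C.
Proof.
move=> z0; have := z0; rewrite lecE /= => /andP[/eqP Imz Rez].
by exists (complex.Re z); rewrite // {1}(complexE z) Imz mulr0 addr0.
Qed.

Lemma le_pow2 (z : C) : 0 <= z -> exists t : nat, z <= 2 ^+ t.
Proof.
move=> /nonneg_real[r r0 ->]; exists (Num.bound r).
have : r <= 2 ^+ Num.bound r.
  apply: le_trans (ltW (archi_boundP r0)) _.
  by rewrite -natrX ler_nat ltnW // ltn_expl.
by rewrite -lecR rmorphXn /= rmorph_nat.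
Qed.

Lemma hf_gt0 d : 0 < hf ^+ d. Proof. by rewrite exprn_gt0 // invr_gt0. Qed.
Lemma hf_ge0 d : 0 <= hf ^+ d. Proof. exact/ltW/hf_gt0. Qed.
Lemma hf_le1 d : hf ^+ d <= 1.
Proof. by rewrite exprn_ile1 // ?invr_ge0 // invf_le1 // ler1n. Qed.
Lemma half_gt0 : 0 < hf. Proof. by rewrite invr_gt0. Qed.
Lemma half_le1 : hf <= 1. Proof. by rewrite invf_le1 // ler1n. Qed.
Lemma hfS2 d : 2 * hf ^+ d.+1 = hf ^+ d.
Proof. by rewrite exprS mulrA divff ?mul1r // pnatr_eq0. Qed.
Lemma hf_anti d e : (d <= e)%N -> hf ^+ e <= hf ^+ d.
Proof.
by move=> /subnKC <-; rewrite exprD ler_piMr ?hf_le1 ?hf_ge0.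
Qed.

Lemma hf_small (M e : C) : 0 <= M -> 0 < e -> exists d, M * hf ^+ d <= e.
Proof.
move=> M0 e0; have [|t] := @le_pow2 (M / e); first by rewrite divr_ge0 // ltW.
rewrite ler_pdivrMr // => le; exists t.
by rewrite exprVn ler_pdivrMr ?exprn_gt0 // mulrC.
Qed.

Lemma eq0_hf (z M : C) : (forall d, `|z| <= M * hf ^+ d) -> z = 0.
Proof.
move=> H; apply/eqP; rewrite -normr_eq0 eq_le normr_ge0 andbT.
apply/ler_addgt0Pr => e e0; rewrite add0r.
have M0 : 0 <= M by have := le_trans (normr_ge0 z) (H 0%N); rewrite mulr1.
by have [d] := hf_small M0 e0; apply: le_trans.
Qed.

Lemma cauchy_hf_real (s : nat -> R) (M : R) :
  (forall d, `|s d.+1 - s d| <= M * 2^-1 ^+ d) ->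
  exists l, forall d, `|l - s d| <= 2 * M * 2^-1 ^+ d.
Proof.
move=> H; pose a d := s d - 2 * M * 2^-1 ^+ d.
pose b d := s d + 2 * M * 2^-1 ^+ d.
have h2 d : 2 * (2^-1 : R) ^+ d.+1 = 2^-1 ^+ d.
  by rewrite exprS mulrA divff ?mul1r // pnatr_eq0.
have ha d : a d <= a d.+1.
  have := H d; rewrite ler_norml => /andP[H1 _]; rewrite /a -(h2 d).
  by rewrite -(h2 d) in H1; lra.
have hb d : b d.+1 <= b d.
  have := H d; rewrite ler_norml => /andP[_ H1]; rewrite /b -(h2 d).
  by rewrite -(h2 d) in H1; lra.
have M0 : 0 <= M by have := le_trans (normr_ge0 _) (H 0%N); rewrite expr0 mulr1.
have am d e : (d <= e)%N -> a d <= a e.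
  by move=> /subnKC <-; elim: (e - d)%N => [|k IH]; rewrite ?addn0 // addnS (le_trans IH).
have bm d e : (d <= e)%N -> b e <= b d.
  move=> /subnKC <-; elim: (e - d)%N => [|k IH]; rewrite ?addn0 // addnS.
  exact: le_trans (hb _) IH.
have h0 d : 0 <= (2^-1 : R) ^+ d by rewrite exprn_ge0 // invr_ge0.
have ab0 d : a d <= b d by rewrite /a /b; have := mulr_ge0 M0 (h0 d); lra.
have ab d e : a d <= b e.
  apply: (le_trans (am _ _ (leq_maxl d e))); apply: le_trans (ab0 _) _.
  exact/bm/leq_maxr.
exists (sup [set a d | d in setT]) => d.
have up : sup [set a d | d in setT] <= b d.
  by apply: ge_sup; [exists (a 0%N), 0%N|move=> _ [e _ <-]; apply: ab].
have lo : a d <= sup [set a d | d in setT].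
  apply: sup_upper_bound; last by exists d.
  by split; [exists (a 0%N), 0%N|exists (b 0%N) => _ [e _ <-]; apply: ab].
by rewrite ler_norml; move: up lo; rewrite /a /b; lra.
Qed.

Lemma normc_ge_Im (z : C) : ((`|complex.Im z|)%:C)%C <= `|z|.
Proof.
have := normc_ge_Re (z * 'i)%C.
rewrite ReiNIm normrN normrM (normc_def 'i%C) /=.
by rewrite expr0n /= add0r expr1n sqrtr1 mulr1.
Qed.

(** Completeness is that of the reals, applied to real and imaginary parts. *)
Lemma cauchy_hf (s : nat -> C) (M : C) :
  (forall d, `|s d.+1 - s d| <= M * hf ^+ d) ->
  exists l, forall d, `|l - s d| <= 4 * M * hf ^+ d.
Proof.
move=> H.
have M0 : 0 <= M by have := le_trans (normr_ge0 _) (H 0%N); rewrite mulr1.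
have [m m0 EM] := nonneg_real M0.
have hfE d : hf ^+ d = (((2^-1 : R) ^+ d)%:C)%C.
  by rewrite rmorphXn /= fmorphV /= rmorph_nat.
have [l1 H1] : exists l, forall d, `|l - complex.Re (s d)| <= 2 * m * 2^-1 ^+ d.
  apply: cauchy_hf_real => d; rewrite -lecR.
  rewrite -raddfB; apply: le_trans (normc_ge_Re _) _.
  by apply: le_trans (H d) _; rewrite EM hfE -rmorphM.
have [l2 H2] : exists l, forall d, `|l - complex.Im (s d)| <= 2 * m * 2^-1 ^+ d.
  apply: cauchy_hf_real => d; rewrite -lecR.
  rewrite -raddfB; apply: le_trans (normc_ge_Im _) _.
  by apply: le_trans (H d) _; rewrite EM hfE -rmorphM.
exists ((l1%:C)%C + 'i%C * (l2%:C)%C) => d.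
rewrite {1}(complexE (s d)) opprD addrACA -rmorphB -mulrBr -rmorphB.
apply: le_trans (ler_normD _ _) _.
have Ei : `|('i%C : C)| = 1.
  by rewrite normc_def /= expr0n /= add0r expr1n sqrtr1.
have nr (r : R) : `|(r%:C)%C : C| = ((`|r|)%:C)%C.
  by rewrite normc_def /= expr0n /= addr0 sqrtr_sqr.
rewrite normrM Ei mul1r !nr -rmorphD EM hfE.
have -> : 4 * (m%:C)%C * (((2^-1 : R) ^+ d)%:C)%C = ((4 * m * 2^-1 ^+ d)%:C)%C :> C.
  by rewrite !rmorphM /= rmorph_nat.
by rewrite lecR; have := H1 d; have := H2 d; lra.
Qed.

End ComplexLimits.

(** * Order and norm of polynomials *)

Section Order.
Variables (K : comNzRingType) (n : nat).
Implicit Types (p q : mpoly n K).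

Definition ordge d p := forall a, (mdeg a < d)%N -> mcoeff a p = 0.

Lemma ordgeW d e p : (d <= e)%N -> ordge e p -> ordge d p.
Proof. by move=> de H a /leq_trans/(_ de); apply: H. Qed.
Lemma ordge_0 d : ordge d 0. Proof. by move=> a _; rewrite mcoeff0. Qed.
Lemma ordgeD d p q : ordge d p -> ordge d q -> ordge d (p + q).
Proof. by move=> P Q a ad; rewrite mcoeffD P // Q // addr0. Qed.
Lemma ordgeN d p : ordge d p -> ordge d (- p).
Proof. by move=> P a ad; rewrite mcoeffN P // oppr0. Qed.
Lemma ordgeB d p q : ordge d p -> ordge d q -> ordge d (p - q).
Proof. by move=> P Q; apply/ordgeD/ordgeN. Qed.
Lemma ordge_sum d (I : Type) (r : seq I) (P : pred I) (F : I -> mpoly n K) :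
  (forall i, P i -> ordge d (F i)) -> ordge d (\sum_(i <- r | P i) F i).
Proof.
by move=> H; apply: big_ind => //; [apply: ordge_0|apply: ordgeD].
Qed.
Lemma ordgeZ d c p : ordge d p -> ordge d (c *: p).
Proof. by move=> P a ad; rewrite mcoeffZ P // mulr0. Qed.

Lemma ordge_supp d p a : ordge d p -> a \in msupp p -> (d <= mdeg a)%N.
Proof. by move=> P; rewrite mcoeff_msupp leqNgt; apply: contraNN => /P ->. Qed.

Lemma ordgeX a : ordge (mdeg a) (mpolyX K a).
Proof. by move=> b ba; rewrite mcoeffX; case: eqP => // E; rewrite E ltnn in ba. Qed.

Lemma ordgeM d e p q : ordge d p -> ordge e q -> ordge (d + e) (p * q).
Proof.
move=> P Q; rewrite mpolyME big_seq; apply: ordge_sum => /= -[a b].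
move=> /allpairsP[[a' b'] [/= /(ordge_supp P) da /(ordge_supp Q) eb [-> ->]]].
apply: ordgeZ; apply: ordgeW (@ordgeX _).
by rewrite mdegD leq_add.
Qed.
Lemma ordgeMl d p q : ordge d q -> ordge d (p * q).
Proof. by move=> Q; apply: (@ordgeM 0 d). Qed.
Lemma ordgeMr d p q : ordge d p -> ordge d (p * q).
Proof. by move=> Q; rewrite -[d]addn0; apply: ordgeM. Qed.

Lemma ordge_exp d k p : ordge d p -> ordge (d * k) (p ^+ k).
Proof.
move=> P; elim: k => [|k IH]; first by rewrite muln0.
by rewrite exprS mulnS; apply: ordgeM.
Qed.

Lemma ordge1_coef p : ordge 1 p <-> mcoeff (@mnm0 n) p = 0.
Proof.
split => [P|H a]; first by rewrite P // mdeg0.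
by rewrite ltnS leqn0 mdeg_eq0 => /eqP ->.
Qed.

End Order.

Section Comp.
Variables (K : comNzRingType) (n k : nat).
Implicit Types (q : 'I_n -> mpoly k K) (p : mpoly n K).

Definition pcomp (q : 'I_n -> mpoly k K) (p : mpoly n K) : mpoly k K :=
  mmap (@mpolyC k K) q p.

Lemma pcompE q p :
  pcomp q p = \sum_(a <- msupp p) mcoeff a p *: \prod_i q i ^+ a i.
Proof. by rewrite /pcomp /mmap; apply: eq_bigr => a _; rewrite mul_mpolyC. Qed.

Lemma pcompB q : {morph pcomp q : x y / x - y}. Proof. exact: mmapB. Qed.
Lemma pcompD q : {morph pcomp q : x y / x + y}. Proof. exact: mmapD. Qed.
Lemma pcompM q : {morph pcomp q : x y / x * y}. Proof. exact: (rmorphM (mmap _ q)). Qed.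
Lemma pcomp_sum q I (r : seq I) P (F : I -> mpoly n K) :
  pcomp q (\sum_(i <- r | P i) F i) = \sum_(i <- r | P i) pcomp q (F i).
Proof. exact: (raddf_sum (mmap _ q)). Qed.

Lemma pcompXU q i : pcomp q (mpolyX K (mnm1 i)) = q i.
Proof. by rewrite /pcomp mmapX mmap1U. Qed.

Lemma pcompC q c : pcomp q (mpolyC n c) = mpolyC k c.
Proof. by rewrite /pcomp mmapC. Qed.

Lemma meval_pcomp q p v : meval v (pcomp q p) = meval (fun i => meval v (q i)) p.
Proof.
rewrite pcompE [RHS]mevalE raddf_sum; apply: eq_bigr => a _.
by rewrite /= mevalZ rmorph_prod; congr (_ * _); apply: eq_bigr => i _; rewrite rmorphXn.
Qed.

Lemma ordge_prod1 q a : (forall i, ordge 1 (q i)) ->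
  ordge (mdeg a) (\prod_i q i ^+ a i).
Proof.
move=> Q; rewrite mdegE; apply: (big_ind2 (fun d (p : mpoly k K) => ordge d p)) => //.
  by move=> *; apply: ordgeM.
by move=> i _; have := @ordge_exp _ _ _ (a i) _ (Q i); rewrite mul1n.
Qed.

Lemma ordge_pcomp d q p : (forall i, ordge 1 (q i)) -> ordge d p ->
  ordge d (pcomp q p).
Proof.
move=> Q P; rewrite pcompE big_seq; apply: ordge_sum => a /(ordge_supp P) da.
by apply: ordgeZ; apply: ordgeW da _; apply: ordge_prod1.
Qed.

Lemma pcomp_cong d q q' p : (forall i, ordge d (q i - q' i)) ->
  ordge d (pcomp q p - pcomp q' p).
Proof.
move=> Q; rewrite !pcompE -sumrB; apply: ordge_sum => a _.
rewrite -scalerBr; apply: ordgeZ.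
apply: (big_ind2 (fun x y : mpoly k K => ordge d (x - y))).
- by rewrite subrr; apply: ordge_0.
- move=> x1 x2 y1 y2 H1 H2.
  have -> : x1 * y1 - x2 * y2 = (x1 - x2) * y1 + x2 * (y1 - y2) by ring.
  by apply: ordgeD; [apply: ordgeMr|apply: ordgeMl].
- move=> i _; elim: (a i) => [|m IH]; first by rewrite subrr; apply: ordge_0.
  rewrite !exprS.
  have -> : q i * q i ^+ m - q' i * q' i ^+ m =
    (q i - q' i) * q i ^+ m + q' i * (q i ^+ m - q' i ^+ m) by ring.
  by apply: ordgeD; [apply: ordgeMr|apply: ordgeMl].
Qed.

End Comp.

(** Allows the supports of several polynomials to be replaced by a common list of
    monomials. *)
Lemma sum_msupp (K : nzRingType) n (V : nmodType) (F : multinom n -> V) s (p : mpoly n K) : uniq s ->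
  {subset msupp p <= s} -> (forall a, mcoeff a p = 0 -> F a = 0) ->
  \sum_(a <- msupp p) F a = \sum_(a <- s) F a.
Proof.
move=> us sub F0; rewrite [RHS](bigID (mem (msupp p))) /=.
rewrite [X in _ = _ + X]big1 => [|a]; last by rewrite -mcoeff_eq0 => /eqP/F0.
rewrite addr0 -[RHS]big_filter; apply: perm_big; apply: uniq_perm; rewrite ?msupp_uniq ?filter_uniq //.
by move=> a; rewrite mem_filter andb_idr //; apply: sub.
Qed.

Section Norm.
Variable (K : numFieldType).

(** The norm of absolute convergence on the polydisc of radius [r]. *)
Definition nrm n (r : K) (p : mpoly n K) : K :=
  \sum_(a <- msupp p) `|mcoeff a p| * r ^+ mdeg a.

Section Fixn.
Variable (n : nat).
Implicit Types (p q : mpoly n K) (r c : K) (a : multinom n).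

Lemma nrm_seq r s p : uniq s -> {subset msupp p <= s} ->
  nrm r p = \sum_(a <- s) `|mcoeff a p| * r ^+ mdeg a.
Proof.
by move=> us sub; apply: sum_msupp => // a ->; rewrite normr0 mul0r.
Qed.

Lemma meval_seq s p (v : 'I_n -> K) : uniq s -> {subset msupp p <= s} ->
  meval v p = \sum_(a <- s) mcoeff a p * \prod_i v i ^+ a i.
Proof.
by move=> us sub; rewrite mevalE; apply: sum_msupp => // a ->; rewrite mul0r.
Qed.

Lemma nrm_ge0 r p : 0 <= r -> 0 <= nrm r p.
Proof. by move=> r0; apply: sumr_ge0 => a _; rewrite mulr_ge0 ?exprn_ge0. Qed.

Lemma nrm0 r : nrm r (0 : mpoly n K) = 0.
Proof. by rewrite /nrm msupp0 big_nil. Qed.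

Lemma nrmD r p q : 0 <= r -> nrm r (p + q) <= nrm r p + nrm r q.
Proof.
move=> r0; pose s := undup (msupp p ++ msupp q).
have us : uniq s by apply: undup_uniq.
have sp : {subset msupp p <= s} by move=> a; rewrite mem_undup mem_cat => ->.
have sq : {subset msupp q <= s} by move=> a; rewrite mem_undup mem_cat orbC => ->.
have spq : {subset msupp (p + q) <= s} by move=> a /msuppD_le; rewrite mem_undup.
rewrite !(@nrm_seq r s) //.
rewrite -big_split /=; apply: ler_sum => a _; rewrite -mulrDl mcoeffD.
by rewrite ler_wpM2r ?exprn_ge0 ?ler_normD.
Qed.

Lemma nrm_sum r (I : Type) (s : seq I) (P : pred I) (F : I -> mpoly n K) :
  0 <= r -> nrm r (\sum_(i <- s | P i) F i) <= \sum_(i <- s | P i) nrm r (F i).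
Proof.
move=> r0; apply: (big_ind2 (fun x y => nrm r x <= y)) => //; first by rewrite nrm0.
by move=> x1 x2 y1 y2 H1 H2; apply: (le_trans (nrmD _ _ r0)); apply: lerD.
Qed.

Lemma nrmZX r c a : nrm r (c *: mpolyX K a) = `|c| * r ^+ mdeg a.
Proof.
have [->|c0] := eqVneq c 0; first by rewrite scale0r nrm0 normr0 mul0r.
by rewrite /nrm msuppMCX // big_seq1 mcoeffZ mcoeffX eqxx mulr1.
Qed.

Lemma nrmX r a : nrm r (mpolyX K a) = r ^+ mdeg a.
Proof. by rewrite -[mpolyX K a]scale1r nrmZX normr1 mul1r. Qed.

Lemma nrmC r c : nrm r (mpolyC n c) = `|c|.
Proof.
by rewrite -[mpolyC n c]mulr1 mul_mpolyC -mpolyX0 nrmZX mdeg0 mulr1.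
Qed.

Lemma nrm1 r : nrm r (1 : mpoly n K) = 1.
Proof. by rewrite -mpolyC1 nrmC normr1. Qed.

Lemma nrmN r p : nrm r (- p) = nrm r p.
Proof.
rewrite /nrm (perm_big _ (msuppN p)) /=.
by apply: eq_bigr => a _; rewrite mcoeffN normrN.
Qed.

Lemma nrmB r p q : 0 <= r -> nrm r (p - q) <= nrm r p + nrm r q.
Proof. by move=> r0; apply: le_trans (nrmD _ _ r0) _; rewrite nrmN. Qed.

Lemma nrmM r p q : 0 <= r -> nrm r (p * q) <= nrm r p * nrm r q.
Proof.
move=> r0; rewrite {1}(mpolyE p) {1}(mpolyE q) mulr_suml.
apply: le_trans (nrm_sum _ _ _ r0) _; rewrite mulr_suml; apply: ler_sum => a _.
rewrite mulr_sumr; apply: le_trans (nrm_sum _ _ _ r0) _.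
rewrite mulr_sumr; apply: ler_sum => b _.
rewrite -scalerAl -scalerAr -mpolyXD scalerA nrmZX mdegD normrM exprD.
by rewrite mulrACA.
Qed.

Lemma nrmZ r c p : 0 <= r -> nrm r (c *: p) <= `|c| * nrm r p.
Proof. by move=> r0; rewrite -mul_mpolyC; apply: le_trans (nrmM _ _ r0) _; rewrite nrmC. Qed.

Lemma nrm_exp r p k : 0 <= r -> nrm r (p ^+ k) <= nrm r p ^+ k.
Proof.
move=> r0; elim: k => [|k IH]; first by rewrite !expr0 nrm1.
rewrite !exprS; apply: le_trans (nrmM _ _ r0) _.
by rewrite ler_wpM2l // nrm_ge0.
Qed.

Lemma le_nrm r s p : 0 <= r -> r <= s -> nrm r p <= nrm s p.
Proof.
move=> r0 rs; apply: ler_sum => a _; rewrite ler_wpM2l //.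
by rewrite lerXn2r // nnegrE (le_trans r0).
Qed.

(** Shrinking the polydisc gains a factor [t] for each degree of vanishing; the
    convergence of the approximations below rests on this. *)
Lemma nrm_ord r t d p : 0 <= r -> 0 <= t -> t <= 1 -> ordge d p ->
  nrm (t * r) p <= t ^+ d * nrm r p.
Proof.
move=> r0 t0 t1 P; rewrite /nrm mulr_sumr big_seq [leRHS]big_seq.
apply: ler_sum => a /(ordge_supp P) da.
rewrite mulrCA exprMn ler_wpM2l // ler_wpM2r ?exprn_ge0 //.
by rewrite -(subnKC da) exprD ler_piMr ?exprn_ge0 // exprn_ile1.
Qed.

Lemma prod_le r (v : 'I_n -> K) a : (forall i, `|v i| <= r) ->
  `|\prod_i v i ^+ a i| <= r ^+ mdeg a.
Proof.
move=> vr; rewrite normr_prod mdegE -prodrXr.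
by apply: ler_prod => i _; rewrite normr_ge0 normrX lerXn2r // ?nnegrE // (le_trans _ (vr i)).
Qed.

Lemma meval_le r (v : 'I_n -> K) p : (forall i, `|v i| <= r) ->
  `|meval v p| <= nrm r p.
Proof.
move=> vr; rewrite mevalE; apply: le_trans (ler_norm_sum _ _ _) _.
by apply: ler_sum => a _; rewrite normrM ler_wpM2l // prod_le.
Qed.

Lemma natr_le_pow2 k : (k%:R : K) <= 2 ^+ k.
Proof. by rewrite -natrX ler_nat ltnW // ltn_expl. Qed.

(** Polynomials bounded in norm on the polydisc of radius [2 r] are uniformly
    Lipschitz on that of radius [r]. *)
Lemma meval_lip r e (v v' : 'I_n -> K) p : 0 <= r -> 0 <= e ->
  (forall i, `|v i| <= r) -> (forall i, `|v' i| <= r) ->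
  (forall i, `|v i - v' i| <= e) ->
  r * `|meval v p - meval v' p| <= e * nrm (2 * r) p.
Proof.
move=> r0 e0 vr vr' ve.
have mono a : r * `|\prod_i v i ^+ a i - \prod_i v' i ^+ a i|
    <= (mdeg a)%:R * (e * r ^+ mdeg a).
  pose good (k : nat) (x y : K) := [/\ `|x| <= r ^+ k, `|y| <= r ^+ k &
    r * `|x - y| <= k%:R * (e * r ^+ k)].
  have goodM k l x y x' y' : good k x y -> good l x' y' -> good (k + l)%N (x * x') (y * y').
    move=> [A1 A2 A3] [B1 B2 B3]; split; [by rewrite normrM exprD ler_pM|by rewrite normrM exprD ler_pM|rewrite exprD].
    have -> : x * x' - y * y' = (x - y) * x' + y * (x' - y') by ring.
    apply: le_trans (ler_wpM2l r0 (ler_normD _ _)) _; rewrite !normrM mulrDr.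
    have -> : (k + l)%:R * (e * (r ^+ k * r ^+ l)) =
      (k%:R * (e * r ^+ k)) * r ^+ l + r ^+ k * (l%:R * (e * r ^+ l)).
      by rewrite natrD; ring.
    apply: lerD; first by rewrite mulrA ler_pM // mulr_ge0.
    by rewrite mulrCA ler_pM // mulr_ge0.
  have goodX i k : good k (v i ^+ k) (v' i ^+ k).
    elim: k => [|k IH]; first by split; rewrite ?expr0 ?normr1 // subrr normr0 mulr0 mul0r.
    rewrite !exprS -add1n; apply: goodM => //; split; rewrite ?expr1 //.
    by rewrite mul1r mulrC ler_wpM2r.
  suff : good (mdeg a) (\prod_i v i ^+ a i) (\prod_i v' i ^+ a i) by case.
  rewrite mdegE; apply: (big_rec3 good) => [|i x y z _ H]; last exact: goodM.
  by split; rewrite ?normr1 // subrr normr0 mulr0 mul0r.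
rewrite !mevalE -sumrB; apply: le_trans (ler_wpM2l r0 (ler_norm_sum _ _ _)) _.
rewrite mulr_sumr /nrm mulr_sumr; apply: ler_sum => a _.
rewrite -mulrBr normrM mulrCA [leRHS]mulrCA ler_wpM2l //.
apply: le_trans (mono a) _; rewrite exprMn [leLHS]mulrCA.
by rewrite ler_wpM2l // ler_wpM2r ?exprn_ge0 // natr_le_pow2.
Qed.

Lemma nrm_deriv r i p : 0 <= r -> r * nrm r (mderiv i p) <= nrm (2 * r) p.
Proof.
move=> r0; rewrite {1}(mpolyE p) raddf_sum /=.
apply: le_trans (ler_wpM2l r0 (nrm_sum _ _ _ r0)) _.
rewrite mulr_sumr; apply: ler_sum => a _; rewrite mderivZ mderivX scalerA nrmZX.
rewrite normrM mulrCA -!mulrA ler_wpM2l // normr_nat exprMn.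
have [a0|a0] := posnP (a i).
  by rewrite a0 mul0r mulr_ge0 ?exprn_ge0.
have -> : r ^+ mdeg a = r * r ^+ mdeg (mnm_sub a (mnm1 i)).
  rewrite -exprS; congr (_ ^+ _).
  have le1 : lem (mnm1 i) a by rewrite lep1mP -lt0n.
  by rewrite -{1}(submK le1) mdegD mdeg1 addn1.
rewrite ler_wpM2r ?mulr_ge0 ?exprn_ge0 //.
apply: le_trans (natr_le_pow2 _) _; rewrite ler_eXn2l ?ltr1n //.
by rewrite mdegE (bigD1 i) //= leq_addr.
Qed.

(** The bound [2 ^+ k] absorbs the binomial factor, so that the remainder is
    controlled by the norm on a polydisc of twice the radius. *)
Lemma expr_taylor (x t r : K) k : 0 <= r -> `|x| <= r -> `|t| <= r ->
  r ^+ 2 * `|(x + t) ^+ k - x ^+ k - k%:R * t * x ^+ k.-1|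
    <= `|t| ^+ 2 * (2 * r) ^+ k.
Proof.
move=> r0 xr tr; pose E k := (x + t) ^+ k - x ^+ k - k%:R * t * x ^+ k.-1.
have ES j : E j.+1 = (x + t) * E j + j%:R * t ^+ 2 * x ^+ j.-1.
  rewrite /E; case: j => [|j] /=; first by rewrite !expr0; ring.
  by rewrite -natr1 !exprS; ring.
suff H j : r ^+ 2 * `|E j| + j.+1%:R * (`|t| ^+ 2 * r ^+ j) <= 2 ^+ j * (`|t| ^+ 2 * r ^+ j).
  rewrite exprMn mulrCA; apply: le_trans (H k).
  by rewrite lerDl !mulr_ge0 ?exprn_ge0.
elim: j => [|j IH]; first by rewrite /E !expr0 subrr sub0r mul0r mul0r oppr0 normr0 mulr0 add0r.
rewrite ES; set T := `|t| ^+ 2 in IH *.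
have T0 : 0 <= T by rewrite exprn_ge0.
have rj0 k' : 0 <= r ^+ k' by rewrite exprn_ge0.
have step : r ^+ 2 * `|(x + t) * E j + j%:R * t ^+ 2 * x ^+ j.-1|
   <= 2 * r * (r ^+ 2 * `|E j|) + j%:R * (T * r ^+ j.+1).
  apply: le_trans (ler_wpM2l (rj0 2%N) (ler_normD _ _)) _.
  rewrite mulrDr !normrM !normrX normr_nat; apply: lerD.
    rewrite mulrCA ler_wpM2r ?mulr_ge0 //.
    by apply: le_trans (ler_normD _ _) _; rewrite mulr_natl mulr2n lerD.
  case: (j) => [|l]; first by rewrite !mul0r mulr0.
  rewrite /=; set X := `|x| ^+ l.
  have -> : r ^+ 2 * (l.+1%:R * `|t| ^+ 2 * X) = l.+1%:R * (T * (r ^+ 2 * X)).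
    by rewrite /T; ring.
  have -> : r ^+ l.+2 = r ^+ 2 * r ^+ l by rewrite -exprD.
  do 3!apply: ler_wpM2l => //.
  by rewrite lerXn2r // nnegrE.
have := ler_wpM2l (mulr_ge0 (ler0n K 2) r0) IH.
move=> /(lerD step); rewrite -subr_ge0 => H; rewrite -subr_ge0.
by apply: le_trans H _; rewrite le_eqVlt; apply/orP; left; apply/eqP; rewrite -!natr1 !exprS; ring.
Qed.

(** Second-order Taylor bound in one coordinate direction, uniform over the
    polynomials of bounded norm. *)
Lemma meval_taylor i (v v' : 'I_n -> K) t r p : 0 <= r ->
  (forall j, `|v j| <= r) -> `|t| <= r ->
  v' i = v i + t -> (forall j, j != i -> v' j = v j) ->
  r ^+ 2 * `|meval v' p - meval v p - t * meval v (mderiv i p)|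
    <= `|t| ^+ 2 * nrm (2 * r) p.
Proof.
move=> r0 vr tr v'i v'j.
pose D a := meval v (mderiv i (mpolyX K a)).
have -> : meval v (mderiv i p) = \sum_(a <- msupp p) mcoeff a p * D a.
  rewrite {1}(mpolyE p) (raddf_sum (mderiv i)) raddf_sum /=; apply: eq_bigr => a _.
  by rewrite mderivZ mevalZ.
rewrite !mevalE mulr_sumr -!sumrB.
apply: le_trans (ler_wpM2l (exprn_ge0 2 r0) (ler_norm_sum _ _ _)) _.
rewrite mulr_sumr /nrm mulr_sumr; apply: ler_sum => a _.
rewrite /D mderivX mevalZ mevalX.
rewrite (bigD1 i) //= [\prod_(j < n) v j ^+ a j](bigD1 i) //=.
rewrite [\prod_(j < n) v j ^+ mnm_sub _ _ j](bigD1 i) //=.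
rewrite v'i (eq_bigr (fun j => v j ^+ a j)); last by move=> j /v'j ->.
set P := \prod_(j < n | j != i) v j ^+ a j.
have -> : \prod_(j < n | j != i) v j ^+ mnm_sub a (mnm1 i) j = P.
  by apply: eq_bigr => j ji; rewrite mnmBE mnm1E eq_sym (negPf ji) subn0.
rewrite mnmBE mnm1E eqxx subn1.
have -> : mcoeff a p * ((v i + t) ^+ a i * P) - mcoeff a p * (v i ^+ a i * P) -
   t * (mcoeff a p * ((a i)%:R * (v i ^+ (a i).-1 * P))) =
   mcoeff a p * (((v i + t) ^+ a i - v i ^+ a i - (a i)%:R * t * v i ^+ (a i).-1) * P).
  by ring.
rewrite !normrM mulrCA [leRHS]mulrCA ler_wpM2l //.
have Pr : `|P| <= r ^+ (\sum_(j < n | j != i) a j)%N.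
  rewrite normr_prod -prodrXr; apply: ler_prod => j _.
  by rewrite normr_ge0 normrX lerXn2r // nnegrE.
rewrite mdegE (bigD1 i) //= [(2 * r) ^+ _]exprD mulrA [leRHS]mulrA.
apply: ler_pM => //; first by rewrite mulr_ge0 ?exprn_ge0.
  exact: expr_taylor.
apply: le_trans Pr _; rewrite lerXn2r ?nnegrE ?mulr_ge0 //.
by rewrite ler_peMl // ler1n.
Qed.

End Fixn.
Lemma nrm_pcomp n k (r s : K) (q : 'I_n -> mpoly k K) (p : mpoly n K) :
  0 <= r -> (forall i, nrm r (q i) <= s) -> nrm r (pcomp q p) <= nrm s p.
Proof.
move=> r0 qs; rewrite pcompE; apply: le_trans (nrm_sum _ _ _ r0) _.
apply: ler_sum => a _; apply: le_trans (nrmZ _ _ r0) _.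
rewrite ler_wpM2l // mdegE -prodrXr.
pose ok (x : mpoly k K) (y : K) := nrm r x <= y /\ 0 <= y.
suff [] : ok (\prod_i q i ^+ a i) (\prod_i s ^+ a i) by [].
apply: (big_ind2 ok) => [|x1 x2 y1 y2 [A1 A2] [B1 B2]|i _].
- by rewrite /ok nrm1.
- split; last by rewrite mulr_ge0.
  by apply: le_trans (nrmM _ _ r0) _; apply: ler_pM => //; apply: nrm_ge0.
- have s0 : 0 <= s by apply: le_trans (qs i); apply: nrm_ge0.
  split; last by rewrite exprn_ge0.
  apply: le_trans (nrm_exp _ _ r0) _.
  by apply: lerXn2r; rewrite ?nnegrE ?nrm_ge0.
Qed.

End Norm.

(** * Approximation by polynomials *)

Section Approx.
Variable R : realType.
Local Notation C := (Cplx R).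
Local Notation hf := ((2 : C)^-1).
Local Notation ev x p := (meval (fun i => x 0 i) p).

Lemma near0P N (P : 'rV[C]_N -> Prop) :
  near0 P <-> exists2 r : C, 0 < r & forall x : 'rV[C]_N, (forall i, `|x 0 i| <= r) -> P x.
Proof.
rewrite /near0 -/(nbhs _ _); split.
  move=> /nbhs_ballP[e /= e0 H]; exists (e / 2); first by rewrite divr_gt0.
  move=> x xr; apply: H; split=> // i j; rewrite /ball /= ord1 mxE sub0r normrN.
  by apply: le_lt_trans (xr j) _; rewrite ltr_pdivrMr // ltr_pMr // ltr1n.
move=> [r r0 H]; apply/nbhs_ballP; exists r => //= x [_ xr]; apply: H => i.
by have := xr 0 i; rewrite /ball /= mxE sub0r normrN => /ltW.
Qed.

Lemma near0_and N (P Q : 'rV[C]_N -> Prop) :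
  near0 P -> near0 Q -> near0 (fun x => P x /\ Q x).
Proof. by rewrite /near0; apply: filterI. Qed.

Lemma near0_mono N (P Q : 'rV[C]_N -> Prop) :
  (forall x, P x -> Q x) -> near0 P -> near0 Q.
Proof. by move=> H; rewrite /near0; exact: (@filterS _ _ _ P Q H). Qed.

Lemma near0_all N (I : finType) (P : I -> 'rV[C]_N -> Prop) :
  (forall i, near0 (P i)) -> near0 (fun x => forall i, P i x).
Proof. by rewrite /near0 => H; apply: (@filter_forall _ I P (nbhs (0 : 'rV[C]_N)) _ H). Qed.

Lemma near0_at0 N (P : 'rV[C]_N -> Prop) : near0 P -> P 0.
Proof. by rewrite /near0 => /nbhs_singleton. Qed.

Lemma near0_near N (P : 'rV[C]_N -> Prop) : near0 P -> near0 (fun x => nbhs x P).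
Proof. by rewrite /near0 => /nbhs_interior. Qed.

(** A function approximated on a polydisc by polynomials of bounded norm that
    stabilize degree by degree; every closure property of convergent power
    series is obtained by manipulating the approximating polynomials. *)
Definition approx N (r M : C) (q : nat -> mpoly N C) (f : 'rV[C]_N -> C) : Prop :=
  [/\ 0 < r, forall d, nrm r (q d) <= M, forall d, ordge d.+1 (q d.+1 - q d) &
    forall x : 'rV[C]_N, (forall i, `|x 0 i| <= r) -> forall d, `|f x - ev x (q d)| <= M * hf ^+ d].

Lemma approx_M0 N r M (q : nat -> mpoly N C) f : approx r M q f -> 0 <= M.
Proof. by case=> r0 H _ _; apply: le_trans (H 0%N); apply/nrm_ge0/ltW. Qed.

Lemma approxW N r M r' M' (q : nat -> mpoly N C) f : 0 < r' -> r' <= r -> M <= M' ->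
  approx r M q f -> approx r' M' q f.
Proof.
move=> r'0 r'r MM' [r0 H1 H2 H3]; split => //.
  by move=> d; apply: le_trans (le_trans (H1 d) MM'); apply: le_nrm => //; apply: ltW.
move=> x xr d; apply: le_trans (H3 x _ d) _.
  by move=> i; apply: le_trans (xr i) r'r.
by rewrite ler_wpM2r ?hf_ge0.
Qed.

Lemma approx_ext N r M (q : nat -> mpoly N C) f g :
  (forall x : 'rV[C]_N, (forall i, `|x 0 i| <= r) -> f x = g x) ->
  approx r M q f -> approx r M q g.
Proof. by move=> E [r0 H1 H2 H3]; split => // x xr d; rewrite -E // H3. Qed.

Lemma approx_near N r M (q : nat -> mpoly N C) f g :
  near0 (fun x => f x = g x) -> approx r M q f -> exists r', approx r' M q g.
Proof.
move=> /near0P[e e0 E] A; have [r0 _ _ _] := A.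
have se : 0 < r^-1 + e^-1 by rewrite addr_gt0 ?invr_gt0.
exists (r^-1 + e^-1)^-1; apply: approx_ext (approxW _ _ (lexx M) A).
- move=> x xr; apply: E => i; apply: le_trans (xr i) _.
  by rewrite -[leRHS]invrK lef_pV2 ?posrE ?invr_gt0 // lerDr invr_ge0 ltW.
- by rewrite invr_gt0.
- by rewrite -[leRHS]invrK lef_pV2 ?posrE ?invr_gt0 // lerDl invr_ge0 ltW.
Qed.

Lemma approx_val N r M (q : nat -> mpoly N C) f (x : 'rV[C]_N) : approx r M q f ->
  (forall i, `|x 0 i| <= r) -> `|f x| <= 2 * M.
Proof.
move=> [r0 H1 H2 H3] xr; rewrite -[f x](subrK (ev x (q 0%N))).
apply: le_trans (ler_normD _ _) _; rewrite mulr_natl mulr2n lerD //.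
  by have := H3 x xr 0%N; rewrite expr0 mulr1.
exact: le_trans (meval_le _ xr) (H1 _).
Qed.

Lemma approx_poly N r (p : mpoly N C) : 0 < r ->
  approx r (nrm r p) (fun=> p) (fun x : 'rV[C]_N => ev x p).
Proof.
move=> r0; split => // [d|x xr d]; first by rewrite subrr; apply: ordge_0.
by rewrite subrr normr0 mulr_ge0 ?hf_ge0 ?nrm_ge0 // ltW.
Qed.

Lemma approxD N r M M' (q q' : nat -> mpoly N C) f g :
  approx r M q f -> approx r M' q' g ->
  approx r (M + M') (fun d => q d + q' d) (fun x => f x + g x).
Proof.
move=> [r0 H1 H2 H3] [_ H1' H2' H3']; split => //.
- by move=> d; apply: le_trans (nrmD _ _ (ltW r0)) _; apply: lerD.
- by move=> d; rewrite opprD addrACA; apply: ordgeD.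
- move=> x xr d; rewrite mevalD opprD addrACA mulrDl.
  by apply: le_trans (ler_normD _ _) _; rewrite lerD ?H3 ?H3'.
Qed.

Lemma approxM N r M M' (q q' : nat -> mpoly N C) f g :
  approx r M q f -> approx r M' q' g ->
  approx r (3 * (M * M')) (fun d => q d * q' d) (fun x => f x * g x).
Proof.
move=> A A'; have M0 := approx_M0 A; have M'0 := approx_M0 A'.
have [r0 H1 H2 H3] := A; have [_ H1' H2' H3'] := A'; split => //.
- move=> d; apply: le_trans (nrmM _ _ (ltW r0)) _.
  apply: (@le_trans _ _ (M * M')); first by apply: ler_pM => //; apply/nrm_ge0/ltW.
  by rewrite ler_peMl ?mulr_ge0 // ler1n.
- move=> d.
  have -> : q d.+1 * q' d.+1 - q d * q' d =
    (q d.+1 - q d) * q' d.+1 + q d * (q' d.+1 - q' d) by ring.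
  by apply: ordgeD; [apply: ordgeMr|apply: ordgeMl].
- move=> x xr d; rewrite mevalM.
  have -> : f x * g x - ev x (q d) * ev x (q' d) =
    (f x - ev x (q d)) * g x + ev x (q d) * (g x - ev x (q' d)) by ring.
  apply: le_trans (ler_normD _ _) _; rewrite !normrM.
  have -> : 3 * (M * M') * hf ^+ d = (M * hf ^+ d) * (2 * M') + M * (M' * hf ^+ d) by ring.
  apply: lerD; apply: ler_pM; rewrite ?H3 ?H3' ?(approx_val A') //.
  exact: le_trans (meval_le _ xr) (H1 _).
Qed.

(** The increment [q (d+1) - q d] has order [> d] and bounded norm, so on the
    polydisc of half the radius it is at most a constant times [2^-d], and the
    sequence converges geometrically. *)
Lemma approx_cauchy N r M (q : nat -> mpoly N C) : 0 < r ->
  (forall d, nrm r (q d) <= M) -> (forall d, ordge d.+1 (q d.+1 - q d)) ->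
  exists f, approx (hf * r) (4 * M) q f.
Proof.
move=> r0 H1 H2.
have M0 : 0 <= M by apply: le_trans (H1 0%N); apply/nrm_ge0/ltW.
have hr0 : 0 < hf * r by rewrite mulr_gt0 // half_gt0.
have hrr : hf * r <= r := ler_piMl (ltW r0) (half_le1 R).
have H (x : 'rV[C]_N) : exists l, (forall i, `|x 0 i| <= hf * r) ->
    forall d, `|l - ev x (q d)| <= 4 * M * hf ^+ d.
  have [xr|nxr] := pselect (forall i, `|x 0 i| <= hf * r); last by exists 0.
  suff /cauchy_hf[l Hl] : forall d, `|ev x (q d.+1) - ev x (q d)| <= M * hf ^+ d by exists l.
  move=> d; rewrite -mevalB; apply: le_trans (meval_le _ xr) _.
  apply: le_trans (nrm_ord (ltW r0) (ltW (half_gt0 R)) (half_le1 R) (H2 d)) _.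
  rewrite -(hfS2 _ d) [leRHS]mulrA mulrC ler_wpM2r ?hf_ge0 //.
  apply: le_trans (nrmB _ _ (ltW r0)) _.
  by rewrite mulr_natr mulr2n lerD.
have [f Hf] := choice H; exists f; split => //.
move=> d; apply: le_trans (le_nrm _ (ltW hr0) hrr) _.
by apply: le_trans (H1 d) _; rewrite ler_peMl // ler1n.
Qed.

Lemma common_lower_bound (I : finType) (r : I -> C) : (forall i, 0 < r i) ->
  exists2 e : C, 0 < e & forall i, e <= r i.
Proof.
move=> r0; have s0 : 0 <= \sum_i (r i)^-1.
  by apply: sumr_ge0 => i _; rewrite invr_ge0 ltW.
exists (1 + \sum_i (r i)^-1)^-1; first by rewrite invr_gt0 ltr_pwDl.
move=> i; rewrite -[leRHS]invrK lef_pV2 ?posrE ?invr_gt0 ?ltr_pwDl //.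
rewrite (bigD1 i) //= addrCA lerDl addr_ge0 //.
by apply: sumr_ge0 => j _; rewrite invr_ge0 ltW.
Qed.

Definition approximable N (f : 'rV[C]_N -> C) := exists r M q, approx r M q f.

Lemma approx_unif N (I : finType) (h : I -> 'rV[C]_N -> C) :
  (forall i, approximable (h i)) ->
  exists r M q, forall i, approx r M (q i) (h i).
Proof.
move=> /choice[r /choice[M /choice[q H]]].
have r0 i : 0 < r i by case: (H i).
have M0 i : 0 <= M i := approx_M0 (H i).
have [e e0 er] := common_lower_bound r0; exists e, (\sum_i M i), q => i.
apply: approxW (H i) => //; rewrite (bigD1 i) //= lerDl.
exact: sumr_ge0.
Qed.

Lemma approx_unif2 N r M r' M' (q q' : nat -> mpoly N C) f g :
  approx r M q f -> approx r' M' q' g ->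
  exists r'' M'', approx r'' M'' q f /\ approx r'' M'' q' g.
Proof.
move=> A B; have M0 := approx_M0 A; have M'0 := approx_M0 B.
have [r0 _ _ _] := A; have [r'0 _ _ _] := B.
have [e e0 er] : exists2 e : C, 0 < e & forall b : bool, e <= (if b then r else r').
  by apply: common_lower_bound; case.
exists e, (M + M'); split.
  by apply: approxW A => //; rewrite ?(er true) // lerDl.
by apply: approxW B => //; rewrite ?(er false) // lerDr.
Qed.

(** Substituting functions that vanish at the origin: on a small enough
    polydisc they take values in the polydisc where [f] is approximated. *)
Lemma approx_comp N n r M r' M' (q : nat -> mpoly n C) (f : 'rV[C]_n -> C)
    (p : 'I_n -> nat -> mpoly N C) (h : 'I_n -> 'rV[C]_N -> C) :
  approx r M q f -> (forall i, approx r' M' (p i) (h i)) ->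
  (forall i d, ordge 1 (p i d)) -> 0 < r' -> 0 <= M' ->
  exists r'' M'', approx r'' M'' (fun d => pcomp (fun i => p i d) (q d))
    (fun x => f (\row_i h i x)).
Proof.
move=> A B p1 r'0 M'0; have M0 := approx_M0 A; have [r0 H1 H2 H3] := A.
have hr0 : 0 < hf * r by rewrite mulr_gt0 // half_gt0.
have hrr : hf * r <= r := ler_piMl (ltW r0) (half_le1 R).
have [T HT] : exists T, 2 * M' * hf ^+ T <= hf * r by apply: hf_small => //; rewrite mulr_ge0.
have T2 : hf ^+ T * M' <= hf * r.
  apply: le_trans HT; rewrite mulrC -mulrA mulr_natl mulr2n lerDr.
  by rewrite mulr_ge0 ?hf_ge0.
have r''0 : 0 < hf ^+ T * r' by rewrite mulr_gt0 ?hf_gt0.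
have r''r : hf ^+ T * r' <= r' by rewrite ler_piMl ?hf_le1 // ltW.
have pn i d : nrm (hf ^+ T * r') (p i d) <= hf ^+ T * M'.
  have [_ B1 _ _] := B i.
  apply: le_trans (nrm_ord (ltW r'0) (hf_ge0 _ _) (hf_le1 _ _) (p1 i d)) _.
  by rewrite expr1 ler_wpM2l ?hf_ge0.
exists (hf ^+ T * r'), (M + 2 / r * (M' * M)); split => //.
- move=> d; apply: (@le_trans _ _ M); last first.
    by rewrite lerDl !mulr_ge0 ?invr_ge0 // ltW.
  apply: le_trans (le_trans (le_nrm (q d) (ltW hr0) hrr) (H1 d)).
  apply: nrm_pcomp (ltW r''0) _ => i.
  exact: le_trans (pn i d) T2.
- move=> d; set P := fun i => p i d; set P' := fun i => p i d.+1.
  have -> : pcomp P' (q d.+1) - pcomp P (q d) =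
    pcomp P' (q d.+1 - q d) + (pcomp P' (q d) - pcomp P (q d)).
    by rewrite pcompB addrA subrK.
  apply: ordgeD; first by apply: ordge_pcomp => // i; apply: p1.
  by apply: pcomp_cong => i; have [_ _ B2 _] := B i; apply: B2.
- move=> x xr d; rewrite meval_pcomp.
  have xr' i : `|x 0 i| <= r' by apply: le_trans (xr i) r''r.
  have hx i : `|h i x| <= hf * r.
    have [_ _ _ B3] := B i.
    rewrite -[h i x](subrK (ev x (p i T))); apply: le_trans (ler_normD _ _) _.
    apply: le_trans HT; rewrite -mulrA mulr_natl mulr2n lerD ?B3 //.
    by apply: le_trans (meval_le _ xr) _; rewrite [leRHS]mulrC pn.
  have px i : `|ev x (p i d)| <= hf * r.
    by apply: le_trans (meval_le _ xr) _; apply: le_trans (pn i d) T2.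
  set y := \row_i h i x.
  have yE i : y 0 i = h i x by rewrite mxE.
  rewrite -[f y](subrK (ev y (q d))) -addrA.
  apply: le_trans (ler_normD _ _) _; rewrite mulrDl; apply: lerD.
    by apply: H3 => i; rewrite yE; apply: le_trans (hx i) hrr.
  have B3 i : `|y 0 i - ev x (p i d)| <= M' * hf ^+ d.
    by rewrite yE; have [_ _ _ ->] := B i.
  have hx' i : `|y 0 i| <= hf * r by rewrite yE.
  have := @meval_lip _ _ (hf * r) (M' * hf ^+ d) (fun i => y 0 i)
     (fun i => ev x (p i d)) (q d) (ltW hr0) _ hx' px B3.
  rewrite mulrA divff ?pnatr_eq0 // mul1r => /(_ _)/le_trans H.
  rewrite -(ler_pM2l hr0); apply: le_trans (H _ _ (ler_wpM2l _ (H1 d))) _.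
  + by rewrite mulr_ge0 ?hf_ge0.
  + by rewrite mulr_ge0 ?hf_ge0.
  have r_neq0 : r != 0 by rewrite gt_eqF.
  by rewrite le_eqVlt; apply/orP; left; apply/eqP; field.
Qed.

End Approx.

(** * Analytic germs are the approximable functions *)

Section AnalyticApprox.
Local Existing Instance totally_filter.
Variable R : realType.
Local Notation C := (Cplx R).
Local Notation hf := ((2 : C)^-1).
Local Notation ev x p := (meval (fun i => x 0 i) p).

Definition ptrunc N (c : multinom N -> C) (d : nat) : mpoly N C :=
  \sum_(a : bmultinom N d.+1) c a *: mpolyX C a.

Lemma coef_ptrunc N (c : multinom N -> C) d a : (mdeg a <= d)%N ->
  mcoeff a (ptrunc c d) = c a.
Proof. by move=> ad; rewrite /ptrunc (mcoeff_mpoly c). Qed.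

(** Embedding the monomials in the functions ['I_N -> 'I_d] bounds the sum by a
    product of [N] geometric series. *)
Lemma sum_hf_mdeg N d : \sum_(a : bmultinom N d) hf ^+ mdeg (bmnm a) <= 2 ^+ N.
Proof.
pose G (f : {ffun 'I_N -> 'I_d}) := \prod_i hf ^+ f i.
have bnd (a : bmultinom N d) i : (bmnm a i < d)%N.
  apply: leq_ltn_trans (bmdeg a).
  by rewrite mdegE (bigD1 i) //= leq_addr.
pose phi (a : bmultinom N d) : {ffun 'I_N -> 'I_d} := [ffun i => Ordinal (bnd a i)].
have inj : injective phi.
  move=> a b /ffunP E; apply/eqP; rewrite bmeqP; apply/eqP/mnmP => i.
  by have := E i; rewrite !ffunE => /(congr1 val).
have -> : \sum_(a : bmultinom N d) hf ^+ mdeg (bmnm a) = \sum_(a : bmultinom N d) G (phi a).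
  apply: eq_bigr => a _; rewrite mdegE -prodrXr; apply: eq_bigr => i _.
  by rewrite ffunE.
have G0 f : 0 <= G f by apply: prodr_ge0 => i _; apply: hf_ge0.
have geom k : \sum_(j < k) hf ^+ j <= 2.
  have : \sum_(j < k) hf ^+ j + 2 * hf ^+ k = 2.
    elim: k => [|k IH]; first by rewrite big_ord0 expr0 mulr1 add0r.
    by rewrite big_ord_recr /= hfS2 -{4}IH mulr_natl mulr2n; ring.
  by move=> E; rewrite -[leRHS]E lerDl mulr_ge0 // hf_ge0.
apply: (@le_trans _ _ (\sum_(f : {ffun 'I_N -> 'I_d}) G f)).
  have <- : \sum_(f in (phi @: [set: bmultinom N d])%SET) G f =
      \sum_(a : bmultinom N d) G (phi a).
    rewrite big_imset /=; last exact: in2W.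
    by apply: eq_bigl => a; rewrite inE.
  rewrite [leRHS](bigID (mem (phi @: [set: bmultinom N d])%SET)) /=.
  by rewrite lerDl; apply: sumr_ge0.
rewrite -(bigA_distr_bigA (fun (_ : 'I_N) (j : 'I_d) => hf ^+ j)) /=.
rewrite -[N in leRHS]card_ord -prodr_const.
by apply: ler_prod => i _; rewrite geom andbT sumr_ge0 // => j _; apply: hf_ge0.
Qed.

Lemma partial_sumE N (F : multinom N -> C) (A : finmap.finSet (multinom N)) :
  partial_sum F A = \sum_(a <- finmap.enum_fset A) F a.
Proof. by rewrite /partial_sum (finmap.big_seq_fsetE _ _ xpredT). Qed.

(** The truncations of the power series form the approximating sequence.
    Convergence at the point [(r0, ..., r0)] bounds all the terms there, since
    all but finitely many are differences of two late partial sums; hence the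
    norms of the truncations are bounded on half the polydisc. *)
Lemma analytic_approx N (f : 'rV[C]_N -> C) : analytic_germ f -> approximable f.
Proof.
move=> [c /near0P[r0 r0_gt0 H]].
have Hd (x : 'rV[C]_N) e : (forall i, `|x 0 i| <= r0) -> 0 < e ->
    exists A, forall B, {subset finmap.enum_fset A <= finmap.enum_fset B} ->
      `|f x - \sum_(a <- finmap.enum_fset B) c a * monomial a x| <= e.
  move=> xr e0; have /cvgrPdist_le H1 := H x xr; have [A _ AB] := H1 e e0.
  by exists A => B sub; rewrite -partial_sumE; apply: AB; apply/finmap.fsubsetP.
pose x0 : 'rV[C]_N := const_mx r0.
have mon0 a : monomial a x0 = r0 ^+ mdeg a.
  by rewrite /monomial mdegE -prodrXr; apply: eq_bigr => i _; rewrite mxE.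
have [M1 HM1] : exists M1, forall a, `|c a| * r0 ^+ mdeg a <= M1.
  have xr0 i : `|x0 0 i| <= r0 by rewrite mxE gtr0_norm.
  have [A HA] := Hd x0 1 xr0 ltr01.
  exists (2 + \sum_(a <- finmap.enum_fset A) `|c a| * r0 ^+ mdeg a) => a.
  have s0 (s : seq (multinom N)) : 0 <= \sum_(a <- s) `|c a| * r0 ^+ mdeg a.
    by apply: sumr_ge0 => b _; rewrite mulr_ge0 // exprn_ge0 // ltW.
  have [aA|aA] := boolP (a \in A).
    rewrite (big_rem a) //= addrCA lerDl addr_ge0 //.
  apply: (@le_trans _ _ 2); last by rewrite lerDl.
  have H1 := HA A (fun _ => id).
  have /HA H2 : {subset finmap.enum_fset A <= finmap.enum_fset (finmap.fsetU (finmap.fset1 a) A)}.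
    by move=> b bA; rewrite -[_ \in _]/(b \in finmap.fsetU _ _) finmap.in_fsetU bA orbT.
  have E : \sum_(b <- finmap.enum_fset (finmap.fsetU (finmap.fset1 a) A)) c b * monomial b x0
     = c a * monomial a x0 + \sum_(b <- finmap.enum_fset A) c b * monomial b x0.
    rewrite -(big_cons _ _ a (finmap.enum_fset A) xpredT (fun b => c b * monomial b x0)).
    apply: perm_big; apply: uniq_perm; rewrite ?finmap.fset_uniq //=.
      by rewrite finmap.fset_uniq andbT.
    move=> b; rewrite in_cons -[LHS]/(b \in finmap.fsetU _ _) finmap.in_fsetU.
    by rewrite finmap.in_fset1.
  have -> : `|c a| * r0 ^+ mdeg a = `|c a * monomial a x0|.
    by rewrite normrM mon0 normrX (gtr0_norm r0_gt0).
  have -> : c a * monomial a x0 =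
    (f x0 - \sum_(b <- finmap.enum_fset A) c b * monomial b x0) -
    (f x0 - \sum_(b <- finmap.enum_fset (finmap.fsetU (finmap.fset1 a) A)) c b * monomial b x0).
    by rewrite E; ring.
  by apply: le_trans (ler_normB _ _) _; rewrite -[2]/(1 + 1) lerD.
have M10 : 0 <= M1.
  by apply: le_trans (HM1 (@mnm0 N)); rewrite mulr_ge0 // exprn_ge0 // ltW.
pose r := hf * r0.
have rg0 : 0 < r by rewrite mulr_gt0 ?half_gt0.
have rr0 : r <= r0 := ler_piMl (ltW r0_gt0) (half_le1 R).
pose M := M1 * 2 ^+ N + 1.
have M0 : 0 < M by rewrite ltr_pwDr // mulr_ge0 // exprn_ge0.
have qn d : nrm r (ptrunc c d) <= M.
  apply: le_trans (nrm_sum _ _ _ (ltW rg0)) _.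
  apply: (@le_trans _ _ (\sum_(a : bmultinom N d.+1) M1 * hf ^+ mdeg (bmnm a))).
    apply: ler_sum => a _; rewrite nrmZX /r exprMn mulrCA mulrC.
    by rewrite ler_wpM2r ?hf_ge0.
  rewrite -mulr_sumr; apply: (@le_trans _ _ (M1 * 2 ^+ N)); last by rewrite lerDl.
  by rewrite ler_wpM2l // sum_hf_mdeg.
have qo d e : (d <= e)%N -> ordge d.+1 (ptrunc c e - ptrunc c d).
  move=> de a; rewrite ltnS => ad; rewrite mcoeffB !coef_ptrunc ?subrr //.
  exact: leq_trans ad de.
exists (hf * r), (2 * M), (ptrunc c); split.
- by rewrite mulr_gt0 ?half_gt0.
- move=> d; apply: le_trans (le_nrm _ _ _) (le_trans (qn d) _).
  + by rewrite ltW // mulr_gt0 ?half_gt0.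
  + exact: ler_piMl (ltW rg0) (half_le1 R).
  + by rewrite ler_peMl ?ler1n // ltW.
- by move=> d; apply: qo.
- move=> x xr d.
  have xr0 i : `|x 0 i| <= r0.
    apply: le_trans (xr i) _; apply: le_trans rr0.
    exact: ler_piMl (ltW rg0) (half_le1 R).
  have [A HA] := Hd x (M * hf ^+ d) xr0 (mulr_gt0 M0 (hf_gt0 _ _)).
  pose D := maxn d (\max_(a <- finmap.enum_fset A) mdeg a).
  pose s := [seq bmnm a | a <- index_enum (bmultinom N D.+1)].
  have us : uniq s.
    rewrite map_inj_uniq ?index_enum_uniq // => a b E; apply/eqP.
    by rewrite bmeqP E.
  have ms a : (a \in s) = (mdeg a <= D)%N.
    apply/mapP/idP => [[b _ ->]|aD]; first by have := bmdeg b.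
    by exists (BMultinom (aD : (mdeg a < D.+1)%N)); rewrite ?mem_index_enum.
  pose B := finmap.seq_fset tt s.
  have HB : `|f x - ev x (ptrunc c D)| <= M * hf ^+ d.
    have -> : ev x (ptrunc c D) = \sum_(a <- finmap.enum_fset B) c a * monomial a x.
      rewrite (perm_big (undup s)) /=; last exact: (@finmap.seq_fset_perm tt _ s).
      rewrite undup_id // big_map /ptrunc raddf_sum /=.
      by apply: eq_bigr => a _; rewrite mevalZ mevalX.
    apply: HA => a aA; rewrite -[_ \in _]/(a \in B) finmap.seq_fsetE ms.
    by rewrite leq_max; apply/orP; right; apply: leq_bigmax_seq.
  have -> : f x - ev x (ptrunc c d) =
    (f x - ev x (ptrunc c D)) + ev x (ptrunc c D - ptrunc c d).
    by rewrite mevalB addrA subrK.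
  apply: le_trans (ler_normD _ _) _.
  have -> : 2 * M * hf ^+ d = M * hf ^+ d + M * hf ^+ d by ring.
  apply: lerD => //; apply: le_trans (meval_le _ xr) _.
  have dD : (d <= D)%N := leq_maxl _ _.
  have := nrm_ord (ltW rg0) (ltW (half_gt0 R)) (half_le1 R) (qo _ _ dD).
  move=> /le_trans; apply; rewrite -(hfS2 _ d) mulrA [leRHS]mulrC.
  rewrite ler_wpM2l ?hf_ge0 //; apply: le_trans (nrmB _ _ (ltW rg0)) _.
  by rewrite mulr_natr mulr2n lerD.
Qed.

Lemma approx_coef N r M (q : nat -> mpoly N C) f a d e : approx r M q f ->
  (mdeg a <= d)%N -> (d <= e)%N -> mcoeff a (q e) = mcoeff a (q d).
Proof.
move=> [_ _ H _] ad /subnKC <-; elim: (e - d)%N => [|k IH]; first by rewrite addn0.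
rewrite -IH addnS; apply/eqP; rewrite -subr_eq0 -mcoeffB H // ltnS.
by rewrite (leq_trans ad) // leq_addr.
Qed.

(** The coefficient of [x^a] is read off [q (mdeg a)], where it is already
    stable. A finite partial sum containing all terms of degree at most [d] is a
    part of some [q D], and the rest of [q D] has order above [d]. *)
Lemma approx_analytic N (f : 'rV[C]_N -> C) : approximable f -> analytic_germ f.
Proof.
move=> [r [M [q A]]]; have M0 := approx_M0 A; have [r0 H1 H2 H3] := A.
exists (fun a => mcoeff a (q (mdeg a))); apply/near0P.
exists (hf * r); first by rewrite mulr_gt0 ?half_gt0.
move=> x xr; have xr' i : `|x 0 i| <= r.
  by apply: le_trans (xr i) _; apply: ler_piMl (ltW r0) (half_le1 R).
apply/cvgrPdist_le => e e0.
have [d Hd] : exists d, 2 * M * hf ^+ d <= e by apply: hf_small => //; rewrite mulr_ge0.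
pose s := [seq bmnm a | a <- index_enum (bmultinom N d.+1)].
have ms a : (mdeg a <= d)%N -> a \in s.
  move=> ad; apply/mapP.
  by exists (BMultinom (ad : (mdeg a < d.+1)%N)); rewrite ?mem_index_enum.
exists (finmap.seq_fset tt s) => // B /finmap.fsubsetP AB; rewrite /= partial_sumE.
set b := finmap.enum_fset B; have ub : uniq b by apply: finmap.fset_uniq.
have sb a : (mdeg a <= d)%N -> a \in b.
  by move=> /ms as_; apply: AB; rewrite finmap.seq_fsetE.
pose D := maxn d (\max_(a <- b) mdeg a).
pose T := \sum_(a <- b) mcoeff a (q D) *: mpolyX C a.
have coefT a : mcoeff a T = if a \in b then mcoeff a (q D) else 0.
  rewrite /T raddf_sum /=; under eq_bigr do rewrite mcoeffZ mcoeffX.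
  case: ifP => ab.
    rewrite (big_rem a) //= eqxx mulr1 big1_seq ?addr0 // => a' /andP[_].
    by rewrite mem_rem_uniq // inE => /andP[/negPf-> _]; rewrite mulr0.
  rewrite big1_seq // => a' /andP[_ a'b]; case: eqP => [E|_]; rewrite ?mulr0 //.
  by rewrite -E a'b in ab.
have -> : \sum_(a <- b) mcoeff a (q (mdeg a)) * monomial a x = ev x T.
  rewrite /T raddf_sum /= big_seq [RHS]big_seq; apply: eq_bigr => a ab.
  rewrite mevalZ mevalX /monomial; congr (_ * _).
  rewrite (approx_coef A (leqnn _)) // leq_max; apply/orP; right.
  exact: leq_bigmax_seq.
rewrite -(subrK (ev x (q D)) (f x)) -addrA -mevalB.
apply: le_trans (ler_normD _ _) _; apply: le_trans Hd.
have -> : 2 * M * hf ^+ d = M * hf ^+ d + hf ^+ d * M by ring.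
apply: lerD.
  by apply: le_trans (H3 x xr' D) _; rewrite ler_wpM2l // hf_anti // leq_maxl.
apply: le_trans (meval_le _ xr) _.
have o : ordge d (q D - T).
  by move=> a ad; rewrite mcoeffB coefT sb ?subrr // ltnW.
apply: le_trans (nrm_ord (ltW r0) (ltW (half_gt0 R)) (half_le1 R) o) _.
rewrite ler_wpM2l ?hf_ge0 //; apply: le_trans (H1 D).
rewrite /nrm (@sum_msupp _ _ _ (fun a => `|mcoeff a (q D - T)| * r ^+ mdeg a)
   (msupp (q D))) ?msupp_uniq //.
- apply: ler_sum => a _; rewrite ler_wpM2r ?exprn_ge0 ?(ltW r0) //.
  by rewrite mcoeffB coefT; case: ifP; rewrite ?subrr ?normr0 ?subr0.
- move=> a; rewrite !mcoeff_msupp mcoeffB coefT; case: ifP; rewrite ?subrr ?eqxx //.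
  by rewrite subr0.
- by move=> a ->; rewrite normr0 mul0r.
Qed.

End AnalyticApprox.

(** * Derivatives of germs *)

Section Derivatives.
Variable R : realType.
Local Notation C := (Cplx R).
Local Notation hf := ((2 : C)^-1).
Local Notation ev x p := (meval (fun i => x 0 i) p).

Lemma ordge_deriv (K : comNzRingType) N d i (p : mpoly N K) :
  ordge d.+1 p -> ordge d (mderiv i p).
Proof.
move=> P a ad; rewrite mcoeff_mderiv P ?mul0rn //.
by rewrite mdegD mdeg1 addn1.
Qed.

(** Directional derivatives are limits of difference quotients, so a quadratic
    bound on the error determines them. *)
Lemma partial_limit N i (f : 'rV[C]_N -> C) x l (B e0 : C) : 0 < B -> 0 < e0 ->
  (forall t, t != 0 -> `|t| <= e0 ->
     `|f (t *: delta_mx 0 i + x) - f x - t * l| <= `|t| ^+ 2 * B) ->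
  partial i f x = l.
Proof.
move=> B0 e00 H; rewrite /partial /derive; apply: cvg_lim => //.
apply/cvgrPdist_le => e e_gt0.
have eB : 0 < e / B by rewrite divr_gt0.
near=> t.
have t0 : t != 0 by near: t; exact: nbhs_dnbhs_neq.
have te0 : `|t| <= e0 by near: t; exact: dnbhs0_le.
have teB : `|t| <= e / B by near: t; exact: dnbhs0_le.
rewrite /= distrC; have := H t t0 te0.
set D := f _ - f x => HD.
have -> : t^-1 *: D - l = t^-1 * (D - t * l).
  by rewrite mulrBr mulrA mulVf // mul1r.
rewrite normrM normfV -(ler_pM2l (_ : 0 < `|t|)) ?normr_gt0 //.
rewrite mulrA divff ?normr_eq0 // mul1r; apply: le_trans HD _.
by rewrite expr2 -mulrA ler_wpM2l // -ler_pdivlMr.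
Unshelve. all: by end_near. Qed.

(** The derivatives of the approximating polynomials converge to some [g] on a
    smaller polydisc. Taylor's formula for [q D], with an error uniform in [D],
    shows that [g] is the derivative of [f]. *)
Lemma approx_deriv N r M (q : nat -> mpoly N C) f i : approx r M q f ->
  exists r' M', approx r' M' (fun d => mderiv i (q d.+1)) (partial i f).
Proof.
move=> A; have M0 := approx_M0 A; have [r0 H1 H2 H3] := A.
have h0 := half_gt0 R; have h1 := half_le1 R.
have h2 : 2 * hf = 1 by rewrite divff ?pnatr_eq0.
pose r1 := hf * r; pose r2 := hf * r1.
have r10 : 0 < r1 by rewrite mulr_gt0.
have r20 : 0 < r2 by rewrite mulr_gt0.
have r1r : r1 <= r := ler_piMl (ltW r0) h1.
have r2r1 : r2 <= r1 := ler_piMl (ltW r10) h1.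
have [g G] : exists g, approx (hf * r1) (4 * (M / r1)) (fun d => mderiv i (q d.+1)) g.
  apply: approx_cauchy => // d.
    rewrite ler_pdivlMr // mulrC; apply: le_trans (nrm_deriv _ _ (ltW r10)) _.
    by rewrite /r1 mulrA h2 mul1r.
  by rewrite -raddfB; apply: ordge_deriv.
exists (hf * r1), (4 * (M / r1)); apply: (approx_ext _ G) => x xr; apply/esym.
have [_ _ _ G3] := G.
set M' := 4 * (M / r1) in G3 *.
have M'0 : 0 <= M' by rewrite mulr_ge0 // divr_ge0 // ltW.
apply: (@partial_limit _ _ _ _ _ (M / r2 ^+ 2 + 1) r2) => //.
  by rewrite ltr_wpDl // divr_ge0 // exprn_ge0 // ltW.
move=> t t0 tr.
pose x' := t *: delta_mx 0 i + x.
have x'i : x' 0 i = x 0 i + t by rewrite !mxE !eqxx mulr1 addrC.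
have x'j j : j != i -> x' 0 j = x 0 j.
  by move=> ji; rewrite !mxE (negPf ji) andbF mulr0 add0r.
have xr1 j : `|x 0 j| <= r by apply: le_trans (xr j) (le_trans r2r1 r1r).
have x'r j : `|x' 0 j| <= r.
  have [->|ji] := eqVneq j i; last by rewrite x'j.
  rewrite x'i; apply: le_trans (ler_normD _ _) _; apply: le_trans r1r.
  have -> : r1 = hf * r1 + r2 by rewrite /r2 -mulrDl -[hf + hf]mulr2n -[hf *+ 2]mulr_natl h2 mul1r.
  by rewrite lerD.
have t2 : 0 < `|t| ^+ 2 by rewrite exprn_gt0 // normr_gt0.
pose K := 2 * M + `|t| * M'.
have K0 : 0 <= K by apply: addr_ge0; apply: mulr_ge0.
have [D HD] := hf_small K0 t2.
rewrite -/x'.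
have -> : f x' - f x - t * g x =
   (ev x' (q D.+1) - ev x (q D.+1) - t * ev x (mderiv i (q D.+1))) +
   ((f x' - ev x' (q D.+1)) + - (f x - ev x (q D.+1)) +
     - (t * (g x - ev x (mderiv i (q D.+1))))) by ring.
apply: le_trans (ler_normD _ _) _; rewrite [leRHS]mulrDr [X in _ <= _ + X]mulr1; apply: lerD.
  rewrite mulrA ler_pdivlMr ?exprn_gt0 // mulrC.
  have HT := @meval_taylor _ _ i (fun j => x 0 j) (fun j => x' 0 j) t r2 (q D.+1)
    (ltW r20) xr tr x'i x'j.
  apply: le_trans HT _.
  rewrite ler_wpM2l ?exprn_ge0 //; apply: le_trans (H1 D.+1).
  by rewrite /r2 mulrA h2 mul1r; apply: le_nrm => //; apply: ltW.
apply: le_trans HD; rewrite /K mulrDl.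
apply: le_trans (ler_normD _ _) _; rewrite !normrN normrM -mulrA; apply: lerD.
  apply: le_trans (ler_normD _ _) _; rewrite normrN mulr_natl mulr2n.
  have hD : M * hf ^+ D.+1 <= M * hf ^+ D by rewrite ler_wpM2l // hf_anti.
  by apply: lerD; apply: le_trans (H3 _ _ _) hD.
by rewrite -mulrA ler_wpM2l // G3.
Qed.

(** Iterated derivatives along a list of directions; unlike multi-indices, lists
    allow induction. *)
Definition partials N (s : seq 'I_N) (f : 'rV[C]_N -> C) := foldr (@partial R N) f s.

Lemma foldr_iter (I T : Type) (F : I -> T -> T) (e : I -> nat) (z : T) (s : seq I) :
  foldr (fun i g => iter (e i) (F i) g) z s =
  foldr F z (flatten [seq nseq (e i) i | i <- s]).
Proof.
elim: s => [//|i s IH]; rewrite /= foldr_cat -IH.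
by elim: (e i) => [//|k IHk]; rewrite /= IHk.
Qed.

Lemma mpartialE N (a : multinom N) (f : 'rV[C]_N -> C) :
  mpartial a f = partials (flatten [seq nseq (a i) i | i <- enum 'I_N]) f.
Proof. exact: foldr_iter. Qed.

Lemma approx_partials N r M (q : nat -> mpoly N C) f s : approx r M q f ->
  exists r' M', approx r' M' (fun d => foldr (@mderiv N C) (q (size s + d)%N) s) (partials s f).
Proof.
elim: s => [|i s IH] A; first by exists r, M.
have [r1 [M1 A1]] := IH A; have [r2 [M2 A2]] := approx_deriv i A1.
exists r2, M2.
have -> : (fun d => foldr (@mderiv N C) (q (size (i :: s) + d)%N) (i :: s)) =
    (fun d => mderiv i (foldr (@mderiv N C) (q (size s + d.+1)%N) s)).
  by apply: funext => d; rewrite /= addnS.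
exact: A2.
Qed.

(** [c] is the product of the exponents brought down by the derivations. *)
Lemma coef_mderivs N (s : seq 'I_N) (b : multinom N) :
  exists2 c : nat, (0 < c)%N & forall p : mpoly N C,
   mcoeff b (foldr (@mderiv N C) p s) =
   mcoeff (foldl (fun m i => mnm_add m (mnm1 i)) b s) p *+ c.
Proof.
elim: s b => [|i s IH] b; first by exists 1%N.
have [c c0 Hc] := IH (mnm_add b (mnm1 i)); exists (c * (b i).+1)%N.
  by rewrite muln_gt0 c0.
by move=> p; rewrite /= mcoeff_mderiv Hc mulrnA.
Qed.

Lemma foldl_flatten_nseq N (a b : multinom N) :
  foldl (fun m i => mnm_add m (mnm1 i)) b (flatten [seq nseq (a i) i | i <- enum 'I_N])
  = mnm_add b a.
Proof.
have H s : foldl (fun m i => mnm_add m (mnm1 i)) b s =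
   mnm_add b (\big[(@mnm_add N)/(@mnm0 N)]_(i <- s) mnm1 i).
  elim: s b => [|i s IH] b' /=; first by rewrite big_nil addm0.
  by rewrite IH big_cons -addmA.
rewrite H; congr mnm_add; rewrite big_flatten big_map [RHS]multinomUE_id.
rewrite [LHS]big_enum /=; apply: eq_bigr => i _.
rewrite big_nseq; elim: (a i) => [|k IH] /=; first by rewrite mulm0n.
by rewrite IH mulmS.
Qed.

Lemma approx_val0 N (f : 'rV[C]_N -> C) r M q : approx r M q f ->
  forall d, f 0 = mcoeff (@mnm0 N) (q d).
Proof.
move=> A d; have [r0 _ _ H3] := A.
have x0 i : `|(0 : 'rV[C]_N) 0 i| <= r by rewrite mxE normr0 ltW.
have e0 p : ev (0 : 'rV[C]_N) p = mcoeff (@mnm0 N) p.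
  rewrite (meval_seq (s := undup (@mnm0 N :: msupp p))) ?undup_uniq //; last first.
    by move=> a ap; rewrite mem_undup inE ap orbT.
  have h0 : @mnm0 N \in undup (@mnm0 N :: msupp p) by rewrite mem_undup inE eqxx.
  rewrite (bigD1_seq _ h0) ?undup_uniq //= [X in _ * X]big1 ?mulr1; last first.
    by move=> i _; rewrite mnm0E expr0.
  rewrite big1 ?addr0 // => a.
  rewrite -mdeg_eq0 mdegE sum_nat_eq0 => /forallPn[i /= ai].
  by rewrite (bigD1 i) //= mxE expr0n (negPf ai) mul0r mulr0.
apply/eqP; rewrite -subr_eq0; apply/eqP; apply: (@eq0_hf _ _ M) => k.
have [kd|/ltnW dk] := leqP k d.
  rewrite (approx_coef A (d := k)) ?mdeg0 // -e0; exact: H3.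
by rewrite -(approx_coef A (d := d) (e := k)) ?mdeg0 // -e0; apply: H3.
Qed.

Lemma mpartial_coef N (a : multinom N) : exists2 c : nat, (0 < c)%N &
  forall r M (q : nat -> mpoly N C) (f : 'rV[C]_N -> C), approx r M q f -> forall d, (mdeg a <= d)%N ->
  mpartial a f 0 = mcoeff a (q d) *+ c.
Proof.
have [c c0 Hc] := coef_mderivs (flatten [seq nseq (a i) i | i <- enum 'I_N]) (@mnm0 N).
exists c => // r M q f A d ad; rewrite mpartialE.
have [r' [M' B]] := approx_partials (flatten [seq nseq (a i) i | i <- enum 'I_N]) A.
rewrite (approx_val0 B d) Hc foldl_flatten_nseq add0m.
by rewrite (approx_coef A ad (leq_addl _ _)).
Qed.

Lemma mpartial_near N (a : multinom N) (f g : 'rV[C]_N -> C) :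
  near0 (fun x => f x = g x) -> mpartial a f 0 = mpartial a g 0.
Proof.
rewrite !mpartialE; set s := flatten _ => H.
suff : near0 (fun x => partials s f x = partials s g x) by move=> /near0_at0.
elim: s => //= i s IH; have := near0_near IH.
apply: near0_mono => x E.
exact: (@near_eq_derive _ _ _ (partials s f) (partials s g) x (delta_mx 0 i) E).
Qed.

(** Approximating sequences of one germ agree in low degrees: this is the
    uniqueness of power series expansions. *)
Lemma approx_unique N r M (q : nat -> mpoly N C) f r' M' q' g :
  approx r M q f -> approx r' M' q' g -> near0 (fun x => f x = g x) ->
  forall d, ordge d.+1 (q d - q' d).
Proof.
move=> A B E d a; rewrite ltnS => ad.
have [c c0 H] := mpartial_coef a.
rewrite mcoeffB; apply/eqP; rewrite subr_eq0.
have := H _ _ _ _ A d ad; rewrite (mpartial_near a E) (H _ _ _ _ B d ad).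
by move=> /eqP; rewrite eqr_pMn2r // eq_sym.
Qed.

End Derivatives.

(** * Operations on germs *)

#[local] Opaque analytic_germ ordge nrm pcomp.

Section Germs.
Variable R : realType.
Local Notation C := (Cplx R).
Local Notation hf := ((2 : C)^-1).
Local Notation ev x p := (meval (fun i => x 0 i) p).

Definition appr N (q : nat -> mpoly N C) (f : 'rV[C]_N -> C) :=
  exists r M, approx r M q f.

Lemma analyticP N (f : 'rV[C]_N -> C) : analytic_germ f <-> exists q, appr q f.
Proof.
split=> [/analytic_approx[r [M [q A]]]|[q [r [M A]]]]; first by exists q, r, M.
by apply: approx_analytic; exists r, M, q.
Qed.

Lemma apprD N q q' (f g : 'rV[C]_N -> C) : appr q f -> appr q' g ->
  appr (fun d => q d + q' d) (fun x => f x + g x).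
Proof.
move=> [r [M A]] [r' [M' B]]; have [s [L [A' B']]] := approx_unif2 A B.
by exists s, (L + L); apply: approxD.
Qed.

Lemma apprM N q q' (f g : 'rV[C]_N -> C) : appr q f -> appr q' g ->
  appr (fun d => q d * q' d) (fun x => f x * g x).
Proof.
move=> [r [M A]] [r' [M' B]]; have [s [L [A' B']]] := approx_unif2 A B.
by exists s, (3 * (L * L)); apply: approxM.
Qed.

Lemma appr_poly N (p : mpoly N C) : appr (fun=> p) (fun x => ev x p).
Proof. by exists 1, (nrm 1 p); apply: approx_poly. Qed.

Lemma appr_c N c : appr (fun=> mpolyC N c) (fun=> c).
Proof.
have -> : (fun=> c) = (fun x : 'rV[C]_N => ev x (mpolyC N c)).
  by apply: funext => x; rewrite mevalC.
exact: appr_poly.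
Qed.

Lemma appr_coord N i : appr (fun=> mpolyX C (mnm1 i)) (fun x : 'rV[C]_N => x 0 i).
Proof.
have -> : (fun x : 'rV[C]_N => x 0 i) = (fun x : 'rV[C]_N => ev x (mpolyX C (mnm1 i))).
  by apply: funext => x; rewrite mevalXU.
exact: appr_poly.
Qed.

Lemma appr_sum N (I : Type) (s : seq I) (P : pred I) (q : I -> nat -> mpoly N C)
    (f : I -> 'rV[C]_N -> C) :
  (forall i, P i -> appr (q i) (f i)) ->
  appr (fun d => \sum_(i <- s | P i) q i d) (fun x => \sum_(i <- s | P i) f i x).
Proof.
move=> H; elim: s => [|i s IH].
  have -> : (fun d => \sum_(i <- [::] | P i) q i d) = (fun=> mpolyC N 0).
    by apply: funext => d; rewrite big_nil mpolyC0.
  have -> : (fun x => \sum_(i <- [::] | P i) f i x) = (fun=> 0).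
    by apply: funext => d; rewrite big_nil.
  exact: appr_c.
have [Pi|nPi] := boolP (P i).
  have -> : (fun d => \sum_(j <- i :: s | P j) q j d) =
      (fun d => q i d + \sum_(j <- s | P j) q j d).
    by apply: funext => d; rewrite big_cons Pi.
  have -> : (fun x => \sum_(j <- i :: s | P j) f j x) =
      (fun x => f i x + \sum_(j <- s | P j) f j x).
    by apply: funext => d; rewrite big_cons Pi.
  by apply: apprD => //; apply: H.
have -> : (fun d => \sum_(j <- i :: s | P j) q j d) =
    (fun d => \sum_(j <- s | P j) q j d).
  by apply: funext => d; rewrite big_cons (negPf nPi).
have -> : (fun x => \sum_(j <- i :: s | P j) f j x) =
    (fun x => \sum_(j <- s | P j) f j x).
  by apply: funext => d; rewrite big_cons (negPf nPi).
exact: IH.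
Qed.

Lemma appr_shift N q (f : 'rV[C]_N -> C) k : appr q f -> appr (fun d => q (k + d)%N) f.
Proof.
move=> [r [M A]]; have M0 := approx_M0 A; have [r0 H1 H2 H3] := A.
exists r, M; split; [by []|by move=> d; apply: H1|move=> d|move=> x xr d].
  by rewrite addnS; apply: ordgeW (H2 _); rewrite ltnS leq_addl.
by apply: le_trans (H3 x xr _) _; rewrite ler_wpM2l // hf_anti // leq_addl.
Qed.

Lemma appr_near N q (f g : 'rV[C]_N -> C) : near0 (fun x => f x = g x) ->
  appr q f -> appr q g.
Proof. by move=> E [r [M A]]; have [r' A'] := approx_near E A; exists r', M. Qed.

Lemma appr_eq N q (f g : 'rV[C]_N -> C) : appr q f -> appr q g ->
  near0 (fun x => f x = g x).
Proof.
move=> [r [M A]] [r' [M' B]]; have [s [L [[s0 _ _ A'] [_ _ _ B']]]] := approx_unif2 A B.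
apply/near0P; exists s => // x xs; apply/eqP; rewrite -subr_eq0; apply/eqP.
apply: (@eq0_hf _ _ (2 * L)) => d.
have -> : f x - g x = (f x - ev x (q d)) - (g x - ev x (q d)) by ring.
apply: le_trans (ler_normB _ _) _; rewrite -mulrA mulr_natl mulr2n.
by apply: lerD; [apply: A'|apply: B'].
Qed.

Lemma appr_val0 N q (f : 'rV[C]_N -> C) d : appr q f -> f 0 = mcoeff (@mnm0 N) (q d).
Proof. by move=> [r [M A]]; apply: approx_val0 A _. Qed.

Lemma appr_comp N n (q : nat -> mpoly n C) (f : 'rV[C]_n -> C)
    (p : 'I_n -> nat -> mpoly N C) (h : 'I_n -> 'rV[C]_N -> C) :
  appr q f -> (forall i, appr (p i) (h i)) -> (forall i, h i 0 = 0) ->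
  appr (fun d => pcomp (fun i => p i d) (q d)) (fun x => f (\row_i h i x)).
Proof.
move=> [r [M A]] B h0.
have p1 i d : ordge 1 (p i d) by apply/ordge1_coef; rewrite -(appr_val0 d (B i)).
have [rr /choice[MM HM]] := choice B.
have rr0 i : 0 < rr i by case: (HM i).
have MM0 i : 0 <= MM i := approx_M0 (HM i).
have [e e0 er] := common_lower_bound rr0.
have B' i : approx e (\sum_j MM j) (p i) (h i).
  by apply: approxW (HM i) => //; rewrite (bigD1 i) //= lerDl sumr_ge0.
by apply: (approx_comp A B') => //; apply: sumr_ge0.
Qed.

Lemma an_near N (f g : 'rV[C]_N -> C) : near0 (fun x => f x = g x) ->
  analytic_germ f -> analytic_germ g.
Proof. by move=> E /analyticP[q A]; apply/analyticP; exists q; apply: appr_near A. Qed.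

Lemma an_poly N (p : mpoly N C) : analytic_germ (fun x : 'rV[C]_N => ev x p).
Proof. by apply/analyticP; exists (fun=> p); apply: appr_poly. Qed.

Lemma an_c N c : analytic_germ (fun _ : 'rV[C]_N => c).
Proof. by apply/analyticP; eexists; apply: appr_c. Qed.

Lemma an_coord N i : analytic_germ (fun x : 'rV[C]_N => x 0 i).
Proof. by apply/analyticP; eexists; apply: appr_coord. Qed.

Lemma anD N (f g : 'rV[C]_N -> C) : analytic_germ f -> analytic_germ g ->
  analytic_germ (fun x => f x + g x).
Proof.
move=> /analyticP[q A] /analyticP[q' B]; apply/analyticP.
by eexists; apply: apprD A B.
Qed.

Lemma anM N (f g : 'rV[C]_N -> C) : analytic_germ f -> analytic_germ g ->
  analytic_germ (fun x => f x * g x).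
Proof.
move=> /analyticP[q A] /analyticP[q' B]; apply/analyticP.
by eexists; apply: apprM A B.
Qed.

Lemma anN N (f : 'rV[C]_N -> C) : analytic_germ f -> analytic_germ (fun x => - f x).
Proof.
move=> A; have -> : (fun x => - f x) = (fun x => -1 * f x).
  by apply: funext => x; rewrite mulN1r.
apply: anM.
exact: an_c.
exact: A.
Qed.

Lemma anB N (f g : 'rV[C]_N -> C) : analytic_germ f -> analytic_germ g ->
  analytic_germ (fun x => f x - g x).
Proof. by move=> A B; apply: anD; [exact: A|exact: anN]. Qed.

Lemma an_sum N (I : Type) (s : seq I) (P : pred I) (f : I -> 'rV[C]_N -> C) :
  (forall i, P i -> analytic_germ (f i)) ->
  analytic_germ (fun x => \sum_(i <- s | P i) f i x).
Proof.
move=> H; elim: s => [|i s IH].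
  by under eq_fun do rewrite big_nil; apply: an_c.
have [Pi|/negPf nPi] := boolP (P i).
  by under eq_fun do rewrite big_cons Pi; apply: anD; [exact: H|exact: IH].
by under eq_fun do rewrite big_cons nPi; exact: IH.
Qed.

Lemma an_prod N (I : Type) (s : seq I) (P : pred I) (f : I -> 'rV[C]_N -> C) :
  (forall i, P i -> analytic_germ (f i)) ->
  analytic_germ (fun x => \prod_(i <- s | P i) f i x).
Proof.
move=> H; elim: s => [|i s IH].
  by under eq_fun do rewrite big_nil; apply: an_c.
have [Pi|/negPf nPi] := boolP (P i).
  by under eq_fun do rewrite big_cons Pi; apply: anM; [exact: H|exact: IH].
by under eq_fun do rewrite big_cons nPi; exact: IH.
Qed.

Lemma anX N (f : 'rV[C]_N -> C) k : analytic_germ f -> analytic_germ (fun x => f x ^+ k).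
Proof.
move=> A; elim: k => [|k IH]; first by under eq_fun do rewrite expr0; apply: an_c.
by under eq_fun do rewrite exprS; apply: anM; [exact: A|exact: IH].
Qed.

Lemma an_meval N n (p : mpoly n C) (h : 'I_n -> 'rV[C]_N -> C) :
  (forall i, analytic_germ (h i)) -> analytic_germ (fun x => meval (fun i => h i x) p).
Proof.
move=> H; under eq_fun do rewrite mevalE.
apply: an_sum => a _; apply: anM; first exact: an_c.
by apply: an_prod => i _; apply: anX.
Qed.

Lemma an_comp N n (f : 'rV[C]_n -> C) (h : 'I_n -> 'rV[C]_N -> C) :
  analytic_germ f -> (forall i, analytic_germ (h i)) -> (forall i, h i 0 = 0) ->
  analytic_germ (fun x => f (\row_i h i x)).
Proof.
move=> /analyticP[q A] H h0.
have /choice[p B] : forall i, exists q, appr q (h i) by move=> i; apply/analyticP.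
by apply/analyticP; eexists; apply: appr_comp A B h0.
Qed.

Lemma an_small N (f : 'rV[C]_N -> C) e : analytic_germ f -> f 0 = 0 -> 0 < e ->
  near0 (fun x => `|f x| <= e).
Proof.
move=> /analyticP[q [r [M A]]] f0 e0; have M0 := approx_M0 A; have [r0 H1 _ H3] := A.
have [T HT] : exists T, 2 * M * hf ^+ T <= e by apply: hf_small => //; rewrite mulr_ge0.
apply/near0P; exists (hf ^+ T * r); first by rewrite mulr_gt0 ?hf_gt0.
move=> x xr; have xr' i : `|x 0 i| <= r.
  by apply: le_trans (xr i) _; rewrite ler_piMl ?hf_le1 // ltW.
rewrite -[f x](subrK (ev x (q T))); apply: le_trans (ler_normD _ _) _.
apply: le_trans HT; rewrite -mulrA mulr_natl mulr2n lerD ?H3 //.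
apply: le_trans (meval_le _ xr) _.
apply: le_trans (nrm_ord (d := 1) (ltW r0) (hf_ge0 _ _) (hf_le1 _ _) _) _.
  by apply/ordge1_coef; rewrite -(approx_val0 A).
by rewrite expr1 mulrC ler_wpM2r ?hf_ge0.
Qed.

Lemma near0_comp N n (P : 'rV[C]_n -> Prop) (h : 'I_n -> 'rV[C]_N -> C) :
  near0 P -> (forall i, analytic_germ (h i)) -> (forall i, h i 0 = 0) ->
  near0 (fun x => P (\row_i h i x)).
Proof.
move=> /near0P[r r0 H] hA h0.
have : near0 (fun x => forall i, `|h i x| <= r).
  by apply: near0_all => i; apply: an_small.
by apply: near0_mono => x hx; apply: H => i; rewrite mxE.
Qed.

Lemma an_nz N (f : 'rV[C]_N -> C) : analytic_germ f -> f 0 != 0 ->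
  near0 (fun x => f x != 0).
Proof.
move=> A f0; have e0 : 0 < `|f 0| / 2 by rewrite divr_gt0 // normr_gt0.
have : near0 (fun x => `|f x - f 0| <= `|f 0| / 2).
  apply: (an_small (f := fun x => f x - f 0)); [|by rewrite subrr|exact: e0].
  by apply: anB; [exact: A|exact: an_c].
apply: near0_mono => x; apply: contraTneq => ->.
by rewrite sub0r normrN lt_geF // ltr_pdivrMr // ltr_pMr ?normr_gt0 // ltr1n.
Qed.

End Germs.

(** * The implicit function theorem *)

Section ImplicitFunction.
Variable R : realType.
Local Notation C := (Cplx R).
Local Notation hf := ((2 : C)^-1).
Local Notation ev x p := (meval (fun i => x 0 i) p).

(** For points [(x, y(x))] of a graph. *)
Definition glue (T : Type) N p (u : 'I_N -> T) (v : 'I_p -> T) (i : 'I_(N + p)) : T :=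
  match fintype.split i with inl a => u a | inr b => v b end.

Lemma row_glue N p (x : 'rV[C]_N) (u : 'I_N -> 'rV[C]_N -> C)
    (v : 'I_p -> 'rV[C]_N -> C) :
  \row_i glue u v i x = row_mx (\row_i u i x) (\row_j v j x).
Proof. by apply/rowP => i; rewrite !mxE /glue; case: (fintype.split i) => k; rewrite !mxE. Qed.

Lemma row_id N (x : 'rV[C]_N) : \row_i x 0 i = x.
Proof. by apply/rowP => i; rewrite mxE. Qed.

Section Iteration.
Variables (N p : nat) (r M : C).
Variables (qa : 'I_p -> 'I_N -> nat -> mpoly (N + p) C).
Variables (qb : 'I_p -> 'I_p -> 'I_p -> nat -> mpoly (N + p) C).

Definition subs (y : 'I_p -> mpoly N C) : 'I_(N + p) -> mpoly N C :=
  glue (fun i => mpolyX C (mnm1 i)) y.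

(** One fixed-point iteration, performed on the [d]-th approximations of the data. *)
Definition step (d : nat) (y : 'I_p -> mpoly N C) (j : 'I_p) : mpoly N C :=
  \sum_i mpolyX C (mnm1 i) * pcomp (subs y) (qa j i d) +
  \sum_k \sum_l y k * y l * pcomp (subs y) (qb j k l d).

Fixpoint iterate (d : nat) : 'I_p -> mpoly N C :=
  if d is d'.+1 then step d' (iterate d') else fun=> 0.

Lemma ordgeXU n (i : 'I_n) : ordge 1 (mpolyX C (mnm1 i)).
Proof. by rewrite -(mdeg1 i); apply: ordgeX. Qed.

Lemma step_ord d y : (forall j, ordge 1 (y j)) -> forall j, ordge 1 (step d y j).
Proof.
move=> y1 j; apply: ordgeD; apply: ordge_sum => i _.
  by apply: ordgeMr; apply: ordgeXU.
by apply: ordge_sum => k _; apply: ordgeMr; apply: ordgeMr.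
Qed.

Lemma iterate_ord d j : ordge 1 (iterate d j).
Proof. by elim: d j => [|d IH] j; [apply: ordge_0|apply: step_ord]. Qed.

Lemma subs_ord d i : ordge 1 (subs (iterate d) i).
Proof.
rewrite /subs /glue; case: (fintype.split i) => k; first exact: ordgeXU.
exact: iterate_ord.
Qed.

Hypothesis stab_a : forall j i d, ordge d.+1 (qa j i d.+1 - qa j i d).
Hypothesis stab_b : forall j k l d, ordge d.+1 (qb j k l d.+1 - qb j k l d).

(** Every term of the right-hand side contains a factor [x_i] or two factors
    [y], all of order at least 1, so each iteration fixes one more degree. *)
Lemma iterate_stab d j : ordge d.+1 (iterate d.+1 j - iterate d j).
Proof.
have E3 (u u' v v' B B' : mpoly N C) : u' * v' * B' - u * v * B =
   v' * (u' - u) * B' + u * (v' - v) * B' + u * (B' - B) * v by ring.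
elim: d j => [|d IH] j.
  by apply: ordgeB; [apply: iterate_ord|apply: ordge_0].
have cong P P' : ordge d.+1 (P' - P) ->
    ordge d.+1 (pcomp (subs (iterate d.+1)) P' - pcomp (subs (iterate d)) P).
  move=> HP; set s' := subs _; set s := subs _.
  have -> : pcomp s' P' - pcomp s P = pcomp s' (P' - P) + (pcomp s' P - pcomp s P).
    by rewrite pcompB addrA subrK.
  apply: ordgeD; first by apply: ordge_pcomp => // i; apply: subs_ord.
  apply: pcomp_cong => i; rewrite /s' /s /subs /glue; case: (fintype.split i) => k.
    by rewrite subrr; apply: ordge_0.
  exact: IH.
change (ordge d.+2 (step d.+1 (iterate d.+1) j - step d (iterate d) j)).
set y' := iterate d.+1; set y := iterate d.
rewrite /step opprD addrACA -!sumrB; apply: ordgeD; apply: ordge_sum => i _.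
  rewrite -mulrBr; apply: (@ordgeM _ _ 1 d.+1); first exact: ordgeXU.
  by apply: cong; apply: stab_a.
rewrite -sumrB; apply: ordge_sum => l _.
rewrite E3.
apply: ordgeD; last first.
  by apply: ordgeMr; apply: (@ordgeM _ _ 1 d.+1); [apply: iterate_ord|apply/cong/stab_b].
apply: ordgeD; apply: ordgeMr; apply: (@ordgeM _ _ 1 d.+1).
all: by [apply: iterate_ord|apply: IH].
Qed.

Hypothesis M0 : 0 <= M.
Hypothesis nrm_a : forall j i d, nrm r (qa j i d) <= M.
Hypothesis nrm_b : forall j k l d, nrm r (qb j k l d) <= M.

(** The fixed-point map preserves the ball of radius [s] when [rho] is small
    compared with [s] and [s] small compared with [1 / M]. *)
Lemma iterate_nrm (rho s : C) : 0 <= rho -> rho <= s -> s <= r ->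
  rho * (N%:R * M) + s * s * (p%:R * (p%:R * M)) <= s ->
  forall d j, nrm rho (iterate d j) <= s.
Proof.
move=> rho0 rs sr Hs; have s0 := le_trans rho0 rs.
elim=> [|d IH] j; first by rewrite nrm0.
have sub i : nrm rho (subs (iterate d) i) <= s.
  rewrite /subs /glue; case: (fintype.split i) => k; last exact: IH.
  by rewrite nrmX mdeg1 expr1.
have comp P : nrm r P <= M -> nrm rho (pcomp (subs (iterate d)) P) <= M.
  move=> HP; apply: le_trans (nrm_pcomp _ rho0 sub) _.
  exact: le_trans (le_nrm _ s0 sr) HP.
apply: le_trans Hs; apply: le_trans (nrmD _ _ rho0) _; apply: lerD.
  apply: le_trans (nrm_sum _ _ _ rho0) _.
  have -> : rho * (N%:R * M) = \sum_(i < N) (rho * M).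
    by rewrite sumr_const card_ord -[in RHS]mulr_natl mulrCA.
  apply: ler_sum => i _; apply: le_trans (nrmM _ _ rho0) _.
  by rewrite nrmX mdeg1 expr1 ler_wpM2l // comp.
apply: le_trans (nrm_sum _ _ _ rho0) _.
have -> : s * s * (p%:R * (p%:R * M)) = \sum_(k < p) \sum_(l < p) (s * s * M).
  have -> : \sum_(l < p) (s * s * M) = s * s * (p%:R * M).
    by rewrite sumr_const card_ord mulrCA mulr_natl.
  by rewrite sumr_const card_ord [in LHS]mulrCA [in LHS]mulr_natl [in RHS]mulr_natl mulr_natl.
apply: ler_sum => k _; apply: le_trans (nrm_sum _ _ _ rho0) _.
apply: ler_sum => l _; apply: le_trans (nrmM _ _ rho0) _.
apply: ler_pM; rewrite ?nrm_ge0 //; last exact: comp.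
by apply: le_trans (nrmM _ _ rho0) _; apply: ler_pM; rewrite ?nrm_ge0.
Qed.

End Iteration.

(** The implicit function theorem, for equations whose right-hand side is
    already split into terms small with [x] and terms quadratic in [y]. The
    iterates of the fixed-point map applied to the approximating polynomials
    are the approximating polynomials of the solution. *)
Theorem implicit_function N p (al : 'I_p -> 'I_N -> 'rV[C]_(N + p) -> C)
    (be : 'I_p -> 'I_p -> 'I_p -> 'rV[C]_(N + p) -> C) :
  (forall j i, analytic_germ (al j i)) -> (forall j k l, analytic_germ (be j k l)) ->
  exists y : 'I_p -> 'rV[C]_N -> C, [/\ forall j, analytic_germ (y j),
    forall j, y j 0 = 0 & near0 (fun x => forall j,
      let z := row_mx x (\row_k y k x) in
      y j x = \sum_i x 0 i * al j i z + \sum_k \sum_l y k x * y l x * be j k l z)].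
Proof.
move=> Aal Abe.
pose h (u : ('I_p * 'I_N) + ('I_p * 'I_p * 'I_p)) : 'rV[C]_(N + p) -> C :=
  match u with inl v => al v.1 v.2 | inr v => be v.1.1 v.1.2 v.2 end.
have [r [M [q A]]] : exists r M q, forall u, approx r M (q u) (h u).
  by apply: approx_unif => -[u|u]; apply: analytic_approx; rewrite /h.
(* When [p = 0] there are no data to make [r] positive and [M] nonnegative. *)
have [r0 M0] : 0 < (if pselect (0 < r) then r else 1) /\ 0 <= (if pselect (0 <= M) then M else 0).
  by split; case: pselect.
set r' := (X in 0 < X) in r0; set M' := (X in 0 <= X) in M0.
have A' u : approx r' M' (q u) (h u).
  have := A u => B; have MM := approx_M0 B; have [rr _ _ _] := B.
  by rewrite /r' /M'; do 2!case: pselect.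
pose qa j i := q (inl (j, i)); pose qb j k l := q (inr (j, k, l)).
have Ha j i : approx r' M' (qa j i) (al j i) := A' (inl (j, i)).
have Hb j k l : approx r' M' (qb j k l) (be j k l) := A' (inr (j, k, l)).
(* [s] is chosen for the quadratic terms, then [rho] for the terms in [x]. *)
have [T1 HT1] := @hf_small R 1 r' ler01 r0.
have P0 : 0 <= 2 * (p%:R * (p%:R * M')) by rewrite !mulr_ge0.
have [T2 HT2] := hf_small P0 (@ltr01 C).
pose s : C := hf ^+ maxn T1 T2.
have s0 : 0 < s := hf_gt0 _ _.
have sr : s <= r'.
  by apply: le_trans HT1; rewrite mul1r hf_anti // leq_maxl.
have sP : 2 * (s * s * (p%:R * (p%:R * M'))) <= s.
  rewrite -mulrA mulrCA -[leRHS]mulr1 ler_wpM2l ?(ltW s0) //.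
  apply: le_trans HT2; rewrite [leRHS]mulrC mulrCA ler_wpM2r //.
  by rewrite hf_anti // leq_maxr.
have Q0 : 0 <= 2 * (N%:R * M') + 1 by rewrite addr_ge0 ?mulr_ge0.
have [U HU] := hf_small Q0 s0.
pose rho : C := hf ^+ U.
have rho0 : 0 < rho := hf_gt0 _ _.
have rs : rho <= s.
  by apply: le_trans HU; rewrite mulrDl mul1r lerDr !mulr_ge0 ?hf_ge0.
have rQ : 2 * (rho * (N%:R * M')) <= s.
  apply: le_trans HU; rewrite [leRHS]mulrDl mul1r -[leLHS]mulrCA [leLHS]mulrC lerDl.
  exact: hf_ge0.
have Hs : rho * (N%:R * M') + s * s * (p%:R * (p%:R * M')) <= s.
  by rewrite -(ler_pM2l (_ : (0 : C) < 2)) // mulrDr [leRHS]mulr_natl mulr2n lerD.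
pose Y d := iterate qa qb d.
have Yn d j : nrm rho (Y d j) <= s.
  apply: (@iterate_nrm _ _ r' M') => //; last exact: ltW.
    by move=> j' i' d'; have [_ ->] := Ha j' i'.
  by move=> j' k' l' d'; have [_ ->] := Hb j' k' l'.
have Ys d j : ordge d.+1 (Y d.+1 j - Y d j).
  apply: iterate_stab => [j' i' d'|j' k' l' d'].
    by have [_ _ H _] := Ha j' i'; apply: H.
  by have [_ _ H _] := Hb j' k' l'; apply: H.
have /choice[y Hy] : forall j, exists f, approx (hf * rho) (4 * s) (fun d => Y d j) f.
  by move=> j; apply: approx_cauchy.
have Hy' j : appr (fun d => Y d j) (y j) by exists (hf * rho), (4 * s).
have y0 j : y j 0 = 0 by rewrite (appr_val0 0 (Hy' j)) mcoeff0.
exists y; split => [j|//|]; first by apply/analyticP; exists (fun d => Y d j).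
apply: near0_all => j.
pose co i : 'rV[C]_N -> C := fun x => x 0 i.
pose g := glue co y.
have gE x : \row_i g i x = row_mx x (\row_k y k x).
  by rewrite /g row_glue //; congr row_mx; apply: row_id.
pose Z d := subs (Y d).
have Hg i : appr (fun d => Z d i) (g i).
  rewrite /Z /subs /g /glue; case: (fintype.split i) => k; first exact: appr_coord.
  exact: Hy'.
have g0 i : g i 0 = 0.
  by rewrite /g /glue; case: (fintype.split i) => k //; rewrite /co mxE.
have Hc q' f : approx r' M' q' f -> appr (fun d => pcomp (Z d) (q' d)) (fun x => f (row_mx x (\row_k y k x))).
  move=> Hf; have : appr q' f by exists r', M'.
  move=> Hq; have <- : (fun x => f (\row_i g i x)) = (fun x => f (row_mx x (\row_k y k x))).
    by apply: funext => x; rewrite gE.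
  exact: (appr_comp Hq Hg g0).
(* Both sides of the equation are approximated by [Y (d+1)]. *)
apply: (@appr_eq _ _ (fun d => Y (1 + d)%N j)).
  exact: (appr_shift 1 (Hy' j)).
apply: apprD; apply: appr_sum => i _.
  by apply: apprM; [apply: appr_coord|apply: Hc].
apply: appr_sum => l _.
apply: apprM; last by apply: Hc.
by apply: apprM; apply: Hy'.
Qed.

End ImplicitFunction.

(** * Division, inversion and coordinate changes *)

#[local] Transparent ordge.

Section Division.
Variable R : realType.
Local Notation C := (Cplx R).
Local Notation hf := ((2 : C)^-1).
Local Notation ev x p := (meval (fun i => x 0 i) p).

Lemma mdeg_gt0 N (b : multinom N) : (0 < mdeg b)%N -> exists i, (0 < b i)%N.
Proof.
rewrite lt0n mdegE sum_nat_eq0 => /forallPn[i /= bi]; exists i.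
by rewrite lt0n.
Qed.

Lemma exists_submon N k (b : multinom N) : (k <= mdeg b)%N ->
  exists a, lem a b /\ mdeg a = k.
Proof.
elim: k => [|k IH] kb.
  by exists (@mnm0 N); rewrite mdeg0; split=> //; apply/mnm_lepP => i; rewrite mnm0E.
have [a [ab ak]] := IH (ltnW kb).
have [i bi] : exists i, (0 < mnm_sub b a i)%N.
  by apply: mdeg_gt0; have := congr1 (@mdeg N) (submK ab); rewrite mdegD ak; lia.
exists (mnm_add a (mnm1 i)); split; last by rewrite mdegD mdeg1 ak addn1.
apply/mnm_lepP => j; rewrite mnmDE mnm1E; have /mnm_lepP/(_ j) := ab.
by move: bi; rewrite mnmBE; case: eqP => [<-|_] /=; lia.
Qed.

Section Quotient.
Variables (N k : nat).
(* A choice of a divisor of degree [k] for each monomial of degree at least [k]. *)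
Variable sg : multinom N -> multinom N.
Hypothesis sgP : forall b, (k <= mdeg b)%N -> lem (sg b) b /\ mdeg (sg b) = k.

(** The sum of the terms of [p] to which [sg] assigns the divisor [a], divided by
    the monomial [a]. *)
Definition mquo (a : multinom N) (p : mpoly N C) : mpoly N C :=
  \sum_(b <- msupp p | (k <= mdeg b)%N && (sg b == a))
     mcoeff b p *: mpolyX C (mnm_sub b a).

Lemma coef_mquo a p e : mdeg a = k ->
  mcoeff e (mquo a p) =
  if sg (mnm_add e a) == a then mcoeff (mnm_add e a) p else 0.
Proof.
move=> ak; pose F b := if (k <= mdeg b)%N && (sg b == a) then
  mcoeff b p * (mnm_sub b a == e)%:R else 0.
have -> : mcoeff e (mquo a p) = \sum_(b <- msupp p) F b.
  rewrite /mquo raddf_sum /= big_mkcond /=; apply: eq_bigr => b _.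
  by rewrite mcoeffZ mcoeffX.
pose s := undup (mnm_add e a :: msupp p).
rewrite (@sum_msupp _ _ _ F s) ?undup_uniq //; last 2 first.
- by move=> b bp; rewrite mem_undup inE bp orbT.
- by move=> b b0; rewrite /F b0 mul0r; case: ifP.
have es : mnm_add e a \in s by rewrite mem_undup inE eqxx.
rewrite (bigD1_seq _ es) ?undup_uniq //= big1 ?addr0 => [|b be].
  by rewrite /F mdegD ak leq_addl /= addmK eqxx mulr1.
rewrite /F; case: ifP => // /andP[kb /eqP sb]; case: eqP => [E|_]; last by rewrite mulr0.
have [ab _] := sgP kb; rewrite sb in ab.
by move: be; rewrite -E submK // eqxx.
Qed.

Lemma mquo_ord a d p p' : mdeg a = k -> ordge (k + d) (p - p') ->
  ordge d (mquo a p - mquo a p').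
Proof.
move=> ak H e ed; rewrite mcoeffB !coef_mquo //; case: ifP => _; last by rewrite subrr.
by rewrite -mcoeffB H // mdegD ak addnC ltn_add2l.
Qed.

Lemma mquo_nrm a p (r : C) : 0 < r -> mdeg a = k -> nrm r (mquo a p) <= nrm r p / r ^+ k.
Proof.
move=> r0 ak; rewrite ler_pdivlMr ?exprn_gt0 // mulrC.
apply: le_trans (ler_wpM2l (exprn_ge0 _ (ltW r0)) (nrm_sum _ _ _ (ltW r0))) _.
rewrite mulr_sumr [leRHS](bigID (fun b => (k <= mdeg b)%N && (sg b == a))) /=.
rewrite -[leLHS]addr0; apply: lerD; last first.
  by apply: sumr_ge0 => b _; rewrite mulr_ge0 // exprn_ge0 // ltW.
apply: ler_sum => b /andP[kb /eqP sb]; rewrite nrmZX mulrCA -exprD.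
have [ab _] := sgP kb; rewrite sb in ab.
have := congr1 (@mdeg N) (submK ab); rewrite mdegD ak => Eb.
by rewrite -Eb addnC.
Qed.

Lemma sum_mquo p : ordge k p ->
  \sum_(a : bmultinom N k.+1 | mdeg a == k) mpolyX C a * mquo a p = p.
Proof.
move=> Hp; rewrite [RHS]mpolyE /mquo.
under eq_bigr do rewrite mulr_sumr.
under eq_bigr do rewrite big_mkcond /=.
rewrite exchange_big /= big_seq [RHS]big_seq; apply: eq_bigr => b bp.
have kb : (k <= mdeg b)%N := ordge_supp Hp bp.
have [sb1 sb2] := sgP kb.
have sbk : (mdeg (sg b) < k.+1)%N by rewrite sb2.
rewrite (bigD1 (BMultinom sbk)) /= ?sb2 ?eqxx // kb big1 ?addr0 => [|a /andP[_ /negPf na]].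
  by rewrite -scalerAr -mpolyXD addmC submK.
case: eqP => // E; move: na; rewrite bmeqP /= E eqxx //.
Qed.

End Quotient.

(** Division is done monomial by monomial on the approximating polynomials; the
    choice of the divisors does not depend on the polynomial, so the quotients
    stabilize too, and dividing by [x^a] costs a factor [r^-k] in norm. *)
Theorem analytic_division N (f : 'rV[C]_N -> C) k : analytic_germ f ->
  (forall a : multinom N, (mdeg a < k)%N -> mpartial a f 0 = 0) ->
  exists g : multinom N -> 'rV[C]_N -> C,
   [/\ forall a, analytic_germ (g a),
       near0 (fun x => f x =
         \sum_(a : bmultinom N k.+1 | mdeg a == k) monomial a x * g a x) &
       forall a, mdeg a = k -> mpartial a f 0 = 0 -> g a 0 = 0].
Proof.
move=> /analyticP[q [r [M A]]] H; have [r0 H1 H2 H3] := A; have M0 := approx_M0 A.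
have coef0 a d : mpartial a f 0 = 0 -> (mdeg a <= d)%N -> mcoeff a (q d) = 0.
  move=> E ad; have [c c0 Hc] := mpartial_coef R a.
  have := Hc _ _ _ _ A d ad; rewrite E => /esym/eqP.
  by rewrite mulrn_eq0 (gtn_eqF c0) => /eqP.
have /choice[sg sgP] : forall b : multinom N, exists a, (k <= mdeg b)%N -> lem a b /\ mdeg a = k.
  move=> b; have [kb|nkb] := leqP k (mdeg b); last by exists b.
  by have [a Ha] := exists_submon kb; exists a.
pose Q d := q (k + d)%N.
have Qord d : ordge k (Q d).
  by move=> a ak; apply: coef0 (H a ak) _; rewrite (leq_trans (ltnW ak)) // leq_addr.
have /choice[g Hg] : forall a, exists g, mdeg a = k ->
    appr (fun d => mquo k sg a (Q d)) g.
  move=> a; have [ak|nak] := pselect (mdeg a = k); last by exists (fun=> 0).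
  have [g Hg] : exists g, approx (hf * r) (4 * (M / r ^+ k)) (fun d => mquo k sg a (Q d)) g.
    apply: approx_cauchy => // d.
      apply: le_trans (mquo_nrm sgP _ r0 ak) _.
      by apply: ler_wpM2r; [rewrite invr_ge0 exprn_ge0 // ltW|exact: H1].
    by apply: (mquo_ord sgP ak); rewrite /Q !addnS; apply: H2.
  by exists g => _; exists (hf * r), (4 * (M / r ^+ k)).
pose g' a := if pselect (mdeg a = k) then g a else fun=> 0.
have Hg' a : mdeg a = k -> appr (fun d => mquo k sg a (Q d)) (g' a).
  by move=> ak; rewrite /g'; case: pselect => [E|/(_ ak) //]; exact: Hg.
exists g'; split.
- move=> a; have [ak|nak] := pselect (mdeg a = k).
    by apply/analyticP; exists (fun d => mquo k sg a (Q d)); apply: Hg'.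
  by rewrite /g'; case: pselect => [/nak //|E]; exact: an_c.
- have AQ : appr Q f by apply: appr_shift; exists r, M.
  apply: (appr_eq AQ).
  have EQ : Q = fun d => \sum_(a : bmultinom N k.+1 | mdeg a == k) mpolyX C a * mquo k sg a (Q d).
    by apply: funext => d; rewrite (sum_mquo sgP).
  rewrite [X in appr X _]EQ.
  apply: appr_sum => a /eqP ak; apply: apprM; last exact: Hg'.
  have -> : @monomial R N a = (fun x => ev x (mpolyX C a)).
    by apply: funext => x; rewrite mevalX.
  exact: appr_poly.
- move=> a ak E; rewrite (appr_val0 0 (Hg' a ak)) (coef_mquo sgP) // add0m.
  by case: ifP => // _; rewrite coef0 // ak leq_addr.
Qed.

(** Division by the monomials of degree 1. *)
Lemma hadamard N (f : 'rV[C]_N -> C) : analytic_germ f -> f 0 = 0 ->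
  exists g : 'I_N -> 'rV[C]_N -> C, (forall i, analytic_germ (g i)) /\
    near0 (fun x => f x = \sum_i x 0 i * g i x).
Proof.
move=> A f0; have [|g [G1 G2 _]] := analytic_division (k := 1) A.
  move=> a; rewrite ltnS leqn0 mdeg_eq0 => /eqP ->.
  have /analyticP[q [r [M B]]] := A.
  have [c c0 Hc] := mpartial_coef R (@mnm0 N).
  by rewrite (Hc _ _ _ _ B 0%N) ?mdeg0 // -(approx_val0 B) f0 mul0rn.
have mono a x : mdeg a = 1%N -> @monomial R N a x = \sum_i (a i)%:R * x 0 i.
  move=> /eqP/mdeg1P[i /eqP ->].
  rewrite /monomial (bigD1 i) //= [RHS](bigD1 i) //= mnm1E eqxx expr1 mul1r.
  rewrite [in LHS]big1 => [|j /negPf ji]; last by rewrite mnm1E eq_sym ji.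
  by rewrite big1 ?addr0 ?mulr1 // => j /negPf ji; rewrite mnm1E eq_sym ji mul0r.
exists (fun i x => \sum_(a : bmultinom N 2 | mdeg a == 1%N) (bmnm a i)%:R * g a x); split.
  by move=> i; apply: an_sum => a _; apply: anM; [exact: an_c|exact: G1].
apply: near0_mono G2 => x ->.
under [RHS]eq_bigr do rewrite mulr_sumr.
rewrite exchange_big /=; apply: eq_bigr => a /eqP ak.
rewrite mono // mulr_suml; apply: eq_bigr => i _.
by rewrite mulrA [x 0 i * _]mulrC.
Qed.

(** Writing [f / f(0) = 1 + e], the inverse [1 + y] of [f / f(0)] solves
    [y = - e (1 + y)], to which the implicit function theorem applies since [e]
    is a combination of the [x_i]. *)
Lemma an_inv N (f : 'rV[C]_N -> C) : analytic_germ f -> f 0 != 0 ->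
  analytic_germ (fun x => (f x)^-1).
Proof.
move=> A f0.
have [g [G1 G2]] : exists g : 'I_N -> 'rV[C]_N -> C, (forall i, analytic_germ (g i)) /\
    near0 (fun x => f x / f 0 - 1 = \sum_i x 0 i * g i x).
  apply: hadamard; last by rewrite divff // subrr.
  by apply: anB; [apply: anM; [exact: A|exact: an_c]|exact: an_c].
pose al (j : 'I_1) i (z : 'rV[C]_(N + 1)) :=
  - (g i (\row_l z 0 (lshift 1 l)) * (1 + z 0 (rshift N j))).
have Aal j i : analytic_germ (al j i).
  apply: anN; apply: anM; last by apply: anD; [exact: an_c|exact: an_coord].
  apply: (@an_comp _ _ _ (g i) (fun l z => z 0 (lshift 1 l))) => [||l].
  - exact: G1.
  - by move=> l; exact: an_coord.
  - by rewrite mxE.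
have [y [Y1 Y2 Y3]] := implicit_function Aal (fun j k l => @an_c R (N + 1) 0).
apply: (@an_near _ _ (fun x => (1 + y 0 x) / f 0)); last first.
  by apply: anM; [apply: anD; [exact: an_c|exact: Y1]|exact: an_c].
apply: near0_mono (near0_and (near0_and G2 Y3) (an_nz A f0)) => x [[E1 E2] fx].
have := E2 0; rewrite /= [X in _ + X]big1 ?addr0 => [|k _]; last first.
  by rewrite big1 // => l _; rewrite mulr0.
have rowE : \row_l row_mx x (\row_k y k x) 0 (lshift 1 l) = x.
  by apply/rowP => l; rewrite mxE row_mxEl.
under eq_bigr do rewrite /al rowE row_mxEr mxE mulrN mulrA.
rewrite sumrN -mulr_suml -E1 => E3.
have E4 : f x / f 0 * (1 + y 0 x) = 1.
  have -> : f x / f 0 * (1 + y 0 x) = (f x / f 0 - 1) * (1 + y 0 x) + 1 + y 0 x by ring.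
  by rewrite {2}E3; ring.
by apply: (mulfI fx); rewrite [RHS]divff // -[RHS]E4 mulrA mulrAC.
Qed.

Lemma an_det N p (A : 'rV[C]_N -> 'M[C]_p) : analytic_germ_mx A ->
  analytic_germ (fun x => \det (A x)).
Proof.
move=> H; apply: an_sum => s _; apply: anM; first exact: an_c.
by apply: an_prod => i _; apply: H.
Qed.

Lemma GL_of_det N p (A : 'rV[C]_N -> 'M[C]_p) : analytic_germ_mx A ->
  \det (A 0) != 0 -> GL_germ A /\ GL_germ (fun x => invmx (A x)).
Proof.
move=> H A0; have nz : near0 (fun x => A x \in unitmx).
  by apply: near0_mono (an_nz (an_det H) A0) => x; rewrite unitmxE unitfE.
have Hi : analytic_germ_mx (fun x => invmx (A x)).
  move=> i j; apply: (@an_near _ _ (fun x => (\det (A x))^-1 * (\adj (A x)) i j)).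
    by apply: near0_mono nz => x ux; rewrite /invmx ux [RHS]mxE.
  apply: anM; first by apply: an_inv; [exact: an_det|exact: A0].
  under eq_fun do rewrite mxE.
  apply: anM; first exact: an_c.
  apply: an_det => k l; under eq_fun do rewrite !mxE; exact: H.
split; split.
- exact: H.
- exists (fun x => invmx (A x)); split; [exact: Hi| |].
    by apply: near0_mono nz => x ux; rewrite mulmxV.
  by apply: near0_mono nz => x ux; rewrite mulVmx.
- exact: Hi.
- exists A; split; [exact: H| |].
    by apply: near0_mono nz => x ux; rewrite mulVmx.
  by apply: near0_mono nz => x ux; rewrite mulmxV.
Qed.

Lemma quadratic_subst N (x : 'I_N -> C) (A G : 'I_N -> 'I_N -> C) :
  \sum_k \sum_l (\sum_a x a * A k a) * (\sum_b x b * A l b) * G k l =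
  \sum_a \sum_b x a * x b * \sum_k \sum_l A k a * A l b * G k l.
Proof.
pose F k l a b := x a * x b * (A k a * A l b * G k l).
transitivity (\sum_k \sum_l \sum_a \sum_b F k l a b).
  apply: eq_bigr => k _; apply: eq_bigr => l _; rewrite !mulr_suml.
  apply: eq_bigr => a _; rewrite mulr_sumr mulr_suml; apply: eq_bigr => b _.
  by rewrite /F; ring.
transitivity (\sum_a \sum_b \sum_k \sum_l F k l a b); last first.
  apply: eq_bigr => a _; apply: eq_bigr => b _; rewrite mulr_sumr.
  by apply: eq_bigr => k _; rewrite mulr_sumr.
transitivity (\sum_k \sum_a \sum_l \sum_b F k l a b).
  by apply: eq_bigr => k _; rewrite exchange_big.
rewrite exchange_big; apply: eq_bigr => a _.
under eq_bigr do rewrite exchange_big.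
by rewrite exchange_big.
Qed.

(** Coordinate changes tangent to the identity, with the second-order terms in
    the form required by the implicit function theorem. *)
Definition tangent_id N (h : 'I_N -> 'rV[C]_N -> C) :=
  exists g : 'I_N -> 'I_N -> 'I_N -> 'rV[C]_N -> C,
    (forall j k l, analytic_germ (g j k l)) /\
    near0 (fun x => forall j, h j x = x 0 j + \sum_k \sum_l x 0 k * x 0 l * g j k l x).

(** The equation [h(y) = x] reads [y_j = x_j - sum y_k y_l g_jkl(y)]. The
    solution [y] vanishes at the origin, hence is a combination of the [x_i], and
    substituting this in the quadratic terms shows that [y] is tangent to the
    identity as well. *)
Lemma right_inverse N (h : 'I_N -> 'rV[C]_N -> C) : tangent_id h ->
  exists k : 'I_N -> 'rV[C]_N -> C, [/\ forall j, analytic_germ (k j),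
    forall j, k j 0 = 0, tangent_id k &
    near0 (fun x => forall j, h j (\row_i k i x) = x 0 j)].
Proof.
move=> [g [G1 G2]].
pose al (j i : 'I_N) (z : 'rV[C]_(N + N)) : C := (i == j)%:R.
pose be j k l (z : 'rV[C]_(N + N)) := - g j k l (\row_i z 0 (rshift N i)).
have Aal j i : analytic_germ (al j i) by exact: an_c.
have Abe j k l : analytic_germ (be j k l).
  apply: anN; apply: (@an_comp _ _ _ (g j k l) (fun i z => z 0 (rshift N i))) => [||i].
  - exact: G1.
  - by move=> i; exact: an_coord.
  - by rewrite mxE.
have [y [Y1 Y2 Y3]] := implicit_function Aal Abe.
have rowE x : \row_i row_mx x (\row_k y k x) 0 (rshift N i) = \row_k y k x.
  by apply/rowP => i; rewrite mxE row_mxEr.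
have Y4 : near0 (fun x => forall j, y j x =
    x 0 j - \sum_k \sum_l y k x * y l x * g j k l (\row_i y i x)).
  apply: near0_mono Y3 => x E j; rewrite {1}E /=; congr (_ + _).
    rewrite (bigD1 j) //= /al eqxx mulr1 big1 ?addr0 // => i /negPf ->.
    by rewrite mulr0.
  rewrite -sumrN; apply: eq_bigr => k _; rewrite -sumrN; apply: eq_bigr => l _.
  by rewrite /be rowE mulrN.
exists y; split=> //.
- have /choice[ka Hka] : forall k, exists ka : 'I_N -> 'rV[C]_N -> C,
      (forall i, analytic_germ (ka i)) /\ near0 (fun x => y k x = \sum_i x 0 i * ka i x).
    by move=> k; apply: hadamard.
  have ka1 k i : analytic_germ (ka k i) by case: (Hka k).
  have ka2 : near0 (fun x => forall k, y k x = \sum_i x 0 i * ka k i x).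
    by apply: near0_all => k; case: (Hka k).
  exists (fun j a b x => - \sum_k \sum_l ka k a x * ka l b x * g j k l (\row_i y i x)).
  split.
    move=> j a b; apply: anN; apply: an_sum => k _; apply: an_sum => l _.
    apply: anM; first by apply: anM; exact: ka1.
    by apply: (an_comp (G1 j k l)) => [i|i]; [exact: Y1|exact: Y2].
  apply: near0_mono (near0_and Y4 ka2) => x [E1 E2] j; rewrite {1}E1.
  congr (_ + _).
  under eq_bigr do under eq_bigr do rewrite !E2.
  under [RHS]eq_bigr do under eq_bigr do rewrite mulrN.
  under [RHS]eq_bigr do rewrite sumrN.
  by rewrite sumrN (quadratic_subst _ _ (fun k l => g j k l _)).
- apply: near0_mono (near0_and Y4 (near0_comp G2 Y1 Y2)) => x [E1 E2] j.
  rewrite E2 mxE {1}E1.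
  under [X in _ + X = _]eq_bigr do under eq_bigr do rewrite !mxE.
  by rewrite subrK.
Qed.

(** Right inverses suffice, since they can be inverted on the right again. *)
Lemma tangent_id_diffeo N (h : 'I_N -> 'rV[C]_N -> C) :
  (forall j, analytic_germ (h j)) -> (forall j, h j 0 = 0) -> tangent_id h ->
  diffeo_germ (fun x => \row_i h i x).
Proof.
move=> A h0 T.
have [k [K1 K2 K3 K4]] := right_inverse T.
have [k' [L1 L2 _ L4]] := right_inverse K3.
have anrow (g : 'I_N -> 'rV[C]_N -> C) : (forall j, analytic_germ (g j)) ->
    analytic_germ_mx (fun x => \row_i g i x).
  by move=> Hg i j; under eq_fun do rewrite mxE; apply: Hg.
have row0 (g : 'I_N -> 'rV[C]_N -> C) : (forall j, g j 0 = 0) -> \row_i g i 0 = 0.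
  by move=> Hg; apply/rowP => i; rewrite !mxE.
have hk : near0 (fun x => \row_i h i (\row_j k j x) = x).
  by apply: near0_mono K4 => x E; apply/rowP => i; rewrite mxE E.
have kk : near0 (fun x => \row_i k i (\row_j k' j x) = x).
  by apply: near0_mono L4 => x E; apply/rowP => i; rewrite mxE E.
split; [exact: anrow|exact: row0|exists (fun x => \row_i k i x)].
split; [exact: anrow|exact: row0| |exact: hk].
(* A right inverse of the right inverse [k] has to be [h] itself. *)
apply: near0_mono (near0_and kk (near0_comp hk L1 L2)) => x [E1 E2].
by rewrite E1 in E2; rewrite E2 E1.
Qed.

End Division.

(** * The tangent module of a polynomial matrix *)

Section TangentModule.
Variables (K : fieldType) (N m n : nat).
Local Notation P := (mpoly N K).
Local Notation MM := ('M[P]_(m, n)).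
Implicit Types (F M : MM).

Definition dmx (l : 'I_N) (F : MM) : MM := map_mx (mderiv l) F.

(** The polynomial version of the extended tangent space of [F]. *)
Definition Tp (F M : MM) : Prop := exists (u : 'I_N -> P) (b : 'M[P]_m) (c : 'M[P]_n),
  M = \sum_l u l *: dmx l F + b *m F + F *m c.

Lemma Tp0 F : Tp F 0.
Proof.
exists (fun=> 0), 0, 0; rewrite mul0mx mulmx0 !addr0 big1 // => l _.
by rewrite scale0r.
Qed.

Lemma TpD F M M' : Tp F M -> Tp F M' -> Tp F (M + M').
Proof.
move=> [u [b [c ->]]] [u' [b' [c' ->]]].
exists (fun l => u l + u' l), (b + b'), (c + c').
rewrite mulmxDl mulmxDr addrACA; congr (_ + _); rewrite addrACA; congr (_ + _).
by rewrite -big_split; apply: eq_bigr => l _; rewrite scalerDl.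
Qed.

Lemma TpZ F M (p : P) : Tp F M -> Tp F (p *: M).
Proof.
move=> [u [b [c ->]]]; exists (fun l => p * u l), (p *: b), (p *: c).
rewrite !scalerDr scalemxAl scalemxAr; congr (_ + _ + _).
by rewrite scaler_sumr; apply: eq_bigr => l _; rewrite scalerA.
Qed.

Lemma Tp_sum F (I : Type) (s : seq I) (Q : pred I) (M : I -> MM) :
  (forall i, Q i -> Tp F (M i)) -> Tp F (\sum_(i <- s | Q i) M i).
Proof. by move=> H; apply: big_ind => //; [apply: Tp0|apply: TpD]. Qed.

Definition ordmx d (M : MM) := forall i j, ordge d (M i j).

Lemma ordmxD d M M' : ordmx d M -> ordmx d M' -> ordmx d (M + M').
Proof. by move=> A B i j; rewrite mxE; apply: ordgeD. Qed.

Lemma ordmxZ d e (p : P) M : ordge d p -> ordmx e M -> ordmx (d + e) (p *: M).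
Proof. by move=> A B i j; rewrite mxE; apply: ordgeM. Qed.

Lemma ordmx0 d : ordmx d 0.
Proof. by move=> i j; rewrite mxE; apply: ordge_0. Qed.

Lemma ordmx_sum d (I : Type) (s : seq I) (Q : pred I) (M : I -> MM) :
  (forall i, Q i -> ordmx d (M i)) -> ordmx d (\sum_(i <- s | Q i) M i).
Proof. by move=> H; apply: big_ind => //; [apply: ordmx0|apply: ordmxD]. Qed.

Definition Emx (a : multinom N) (i : 'I_m) (j : 'I_n) : MM := mpolyX K a *: delta_mx i j.

Lemma Emx_mul a b i j : Emx (mnm_add a b) i j = mpolyX K a *: Emx b i j.
Proof. by rewrite /Emx mpolyXD scalerA. Qed.

Lemma mx_monomials M : M = \sum_i \sum_j \sum_(a <- msupp (M i j))
  mpolyC N (mcoeff a (M i j)) *: Emx a i j.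
Proof.
rewrite {1}(matrix_sum_delta M); apply: eq_bigr => i _; apply: eq_bigr => j _.
rewrite {1}(mpolyE (M i j)) scaler_suml; apply: eq_bigr => a _.
by rewrite /Emx scalerA mul_mpolyC.
Qed.

(** If the forms of degree [s] belong to the tangent module up to higher order
    then, by multiplying with monomials, so do all matrices of order [s], up
    to an arbitrarily high order. *)
Lemma Tp_iterate F s :
  (forall a i j, mdeg a = s -> exists2 T, Tp F T & ordmx s.+1 (Emx a i j - T)) ->
  forall d M, ordmx s M -> exists2 T, Tp F T & ordmx (s + d) (M - T).
Proof.
move=> H; have mono a i j : (s <= mdeg a)%N ->
    exists2 T, Tp F T & ordmx (mdeg a).+1 (Emx a i j - T).
  move=> sa; have [b [ba bs]] := exists_submon sa.
  have [T T1 T2] := H b i j bs.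
  exists (mpolyX K (mnm_sub a b) *: T); first exact: TpZ.
  rewrite -{2}(submK ba) Emx_mul -scalerBr.
  have -> : (mdeg a).+1 = (mdeg (mnm_sub a b) + s.+1)%N.
    by rewrite -{1}(submK ba) mdegD bs addnS.
  by apply: ordmxZ => //; apply: ordgeX.
elim=> [|d IH] M HM; first by exists 0; [apply: Tp0|rewrite addn0 subr0].
have [T T1 T2] := IH M HM.
set M' := M - T in T2; have [h Hh] : exists h : multinom N -> 'I_m -> 'I_n -> MM,
    forall a i j, (s <= mdeg a)%N -> Tp F (h a i j) /\ ordmx (mdeg a).+1 (Emx a i j - h a i j).
  have H' (t : multinom N * 'I_m * 'I_n) : exists T, (s <= mdeg t.1.1)%N ->
      Tp F T /\ ordmx (mdeg t.1.1).+1 (Emx t.1.1 t.1.2 t.2 - T).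
    have [st|ts] := leqP s (mdeg t.1.1); last by exists 0.
    by have [T' A B] := mono t.1.1 t.1.2 t.2 st; exists T'.
  have [h Hh] := choice H'; exists (fun a i j => h (a, i, j)) => a i j.
  exact: (Hh (a, i, j)).
pose S := \sum_i \sum_j \sum_(a <- msupp (M' i j)) mpolyC N (mcoeff a (M' i j)) *: h a i j.
have big_ord i j a : a \in msupp (M' i j) -> (s + d <= mdeg a)%N.
  by apply: ordge_supp; apply: T2.
exists (T + S).
  apply: TpD => //; apply: Tp_sum => i _; apply: Tp_sum => j _.
  rewrite big_seq; apply: Tp_sum => a /big_ord sa; apply: TpZ.
  by case: (Hh a i j) => //; apply: leq_trans sa; apply: leq_addr.
rewrite opprD addrA -/M' {1}(mx_monomials M') /S -sumrB; apply: ordmx_sum => i _.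
rewrite -sumrB; apply: ordmx_sum => j _.
rewrite -sumrB big_seq; apply: ordmx_sum => a /big_ord sa; rewrite -scalerBr.
have sa' : (s <= mdeg a)%N by apply: leq_trans sa; apply: leq_addr.
have [_ O] := Hh a i j sa'.
move=> k l; rewrite mxE; apply: ordgeMl.
by apply: ordgeW (O k l); rewrite addnS ltnS.
Qed.

Section Span.
Variable (s : nat).
Local Notation J := (bmultinom N s * 'I_m * 'I_n)%type.

Definition lincomb (S : {set J}) (z : J -> K) : MM :=
  \sum_(t in S) mpolyC N (z t) *: Emx (bmnm t.1.1) t.1.2 t.2.

Definition spanned F (S : {set J}) (M : MM) := exists z, Tp F (M - lincomb S z).

Definition independent F (S : {set J}) := forall z, Tp F (lincomb S z) ->
  forall t, t \in S -> z t = 0.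

Lemma lincombD S z z' : lincomb S z + lincomb S z' = lincomb S (fun t => z t + z' t).
Proof.
rewrite /lincomb -big_split; apply: eq_bigr => t _.
by rewrite mpolyCD scalerDl.
Qed.

Lemma lincombZ S z c : mpolyC N c *: lincomb S z = lincomb S (fun t => c * z t).
Proof.
rewrite /lincomb scaler_sumr; apply: eq_bigr => t _.
by rewrite mpolyCM scalerA.
Qed.

Lemma spannedD F S M M' : spanned F S M -> spanned F S M' -> spanned F S (M + M').
Proof.
move=> [z A] [z' B]; exists (fun t => z t + z' t).
by rewrite -lincombD opprD addrACA; apply: TpD.
Qed.

Lemma spannedZ F S c M : spanned F S M -> spanned F S (mpolyC N c *: M).
Proof.
move=> [z A]; exists (fun t => c * z t).
by rewrite -lincombZ -scalerBr; apply: TpZ.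
Qed.

Lemma spannedT F S M : Tp F M -> spanned F S M.
Proof.
move=> A; exists (fun=> 0); rewrite /lincomb big1 ?subr0 // => t _.
by rewrite mpolyC0 scale0r.
Qed.

Lemma spanned_lincomb F S z : spanned F S (lincomb S z).
Proof. by exists z; rewrite subrr; apply: Tp0. Qed.

Lemma spanned_sum F S (I : Type) (r : seq I) (Q : pred I) (M : I -> MM) :
  (forall i, Q i -> spanned F S (M i)) -> spanned F S (\sum_(i <- r | Q i) M i).
Proof.
by move=> H; apply: big_ind => //; [apply/spannedT/Tp0|apply: spannedD].
Qed.

(** A maximal independent set of monomial matrices of degree below [s]. *)
Lemma exists_basis F : (forall M, ordmx s M -> Tp F M) ->
  exists S, independent F S /\ forall M, spanned F S M.
Proof.
move=> H.
have ind0 : independent F finset.set0 by move=> z _ t; rewrite finset.in_set0.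
have [S /asboolP S1 S2] : exists2 S, `[< independent F S >] &
    forall S', `[< independent F S' >] -> (#|S'| <= #|S|)%N.
  have ind0' : `[< independent F finset.set0 >] by apply/asboolP.
  by case: (@arg_maxnP _ finset.set0 (fun S => `[< independent F S >]) (fun S => #|S|) ind0') => S; exists S.
exists S; split=> // M.
have mono (t : J) : spanned F S (Emx (bmnm t.1.1) t.1.2 t.2).
  have [tS|tS] := boolP (t \in S).
    exists (fun t' => (t' == t)%:R); rewrite /lincomb (bigD1 t) //= eqxx mpolyC1 scale1r.
    rewrite big1 ?addr0 ?subrr => [|t' /andP[_ /negPf ->]]; first exact: Tp0.
    by rewrite mpolyC0 scale0r.
  have : ~ independent F (t |: S)%SET.
    move=> ind; have /S2 : `[< independent F (t |: S)%SET >] by apply/asboolP.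
    by rewrite cardsU1 tS ltnn.
  move=> /existsNP[z /not_implyP[zT /existsNP[t' /not_implyP[t'S zt']]]].
  have E : lincomb (t |: S)%SET z = mpolyC N (z t) *: Emx (bmnm t.1.1) t.1.2 t.2 + lincomb S z.
    by rewrite /lincomb big_setU1.
  rewrite E in zT.
  have zt : z t != 0.
    apply/eqP => zt; rewrite zt mpolyC0 scale0r add0r in zT.
    by move: t'S; rewrite finset.in_setU1 => /orP[/eqP E'|/(S1 z zT)//]; rewrite E' zt in zt'.
  exists (fun t' => - (z t)^-1 * z t'); rewrite -lincombZ.
  have := TpZ (mpolyC N (z t)^-1) zT; rewrite scalerDr scalerA -mpolyCM mulVf //.
  by rewrite mpolyC1 scale1r mpolyCN scaleNr opprK.
rewrite (mx_monomials M); apply: spanned_sum => i _; apply: spanned_sum => j _.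
apply: spanned_sum => a _; apply: spannedZ.
have [sa|sa] := leqP s (mdeg a); last exact: (mono (BMultinom sa, i, j)).
apply/spannedT/H => k l; rewrite !mxE; apply: ordgeMr.
by apply: ordgeW sa _; apply: ordgeX.
Qed.

(** In a finite-dimensional quotient the powers of each variable [x_l] are
    dependent, so a nonzero polynomial in [x_l] annihilates it. Write that
    polynomial as [V_l x_l^(k_l)] with [V_l(0)] nonzero: [U] is the product of
    the normalized [V_l], and a monomial of degree above the sum of the [k_l] is
    divisible by some [x_l^(k_l)]. *)
Lemma local_annihilator F (S : {set J}) : (forall M, spanned F S M) ->
  exists (U : P) (k : nat), meval (fun=> 0) U = 1 /\
    forall a i j, (k <= mdeg a)%N -> Tp F (U *: Emx a i j).
Proof.
move=> span.
pose X l : P := mpolyX K (mnm1 l).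
pose phi l (q : {poly K}) : P := (map_poly (@mpolyC N K) q).[X l].
have phiM l q q' : phi l (q * q') = phi l q * phi l q'.
  by rewrite /phi rmorphM hornerM.
have ann l i j : exists2 q : {poly K}, q != 0 & Tp F (phi l q *: delta_mx i j).
  pose d := #|{: J}|.
  have /choice[z Hz] : forall k : 'I_d.+1, exists z, Tp F (X l ^+ k *: delta_mx i j - lincomb S z).
    by move=> k; apply: span.
  pose Z : 'M[K]_(d.+1, d) := \matrix_(k, t) z k (enum_val t).
  have [la la0 laZ] : exists2 la : 'rV[K]_d.+1, la != 0 & la *m Z = 0.
    have : kermx Z != 0.
      rewrite -mxrank_eq0 mxrank_ker -lt0n subn_gt0.
      by apply: leq_ltn_trans (rank_leq_col Z) _.
    move=> /rowV0Pn[la la1 la0]; exists la => //.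
    by apply/eqP; rewrite -sub_kermx.
  exists (\poly_(k < d.+1) la 0 (inord k)).
    apply: contraNneq la0 => /polyP E; apply/eqP/rowP => k.
    by have := E k; rewrite coef_poly ltn_ord coef0 inord_val mxE.
  have -> : phi l (\poly_(k < d.+1) la 0 (inord k)) *: delta_mx i j =
      \sum_(k < d.+1) mpolyC N (la 0 k) *: (X l ^+ k *: delta_mx i j - lincomb S (z k)) :> MM.
    transitivity (\sum_(k < d.+1) mpolyC N (la 0 k) *: (X l ^+ k *: delta_mx i j) : MM).
      rewrite /phi poly_def rmorph_sum /= horner_sum scaler_suml.
      apply: eq_bigr => k _; rewrite inord_val -mul_polyC rmorphM /= map_polyC /=.
      by rewrite map_polyXn hornerM hornerC hornerXn scalerA.
    under [RHS]eq_bigr do rewrite scalerBr.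
    rewrite sumrB; rewrite [X in _ = _ - X](_ : _ = 0) ?subr0 //.
    under eq_bigr do rewrite lincombZ /lincomb.
    rewrite exchange_big /= big1 // => t _; rewrite -scaler_suml.
    rewrite -raddf_sum /= (_ : \sum_k _ = 0) ?mpolyC0 ?scale0r //.
    have /rowP/(_ (enum_rank t)) := laZ; rewrite !mxE => E; rewrite -[RHS]E.
    by apply: eq_bigr => k _; rewrite mxE enum_rankK.
  by apply: Tp_sum => k _; apply: TpZ.
have ann' l : exists (V : P) (k : nat), meval (fun=> 0) V = 1 /\
    forall i j, Tp F ((V * X l ^+ k) *: delta_mx i j).
  have /choice[q Hq] : forall t : 'I_m * 'I_n, exists q : {poly K},
      q != 0 /\ Tp F (phi l q *: delta_mx t.1 t.2).
    by move=> [i j]; have [q q0 Tq] := ann l i j; exists q.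
  pose Q := \prod_t q t.
  have Q0 : Q != 0 by apply/prodf_neq0 => t _; case: (Hq t).
  have TQ i j : Tp F (phi l Q *: delta_mx i j).
    rewrite /Q (bigD1 (i, j)) //= mulrC phiM -scalerA; apply: TpZ.
    by case: (Hq (i, j)).
  have [k [V /implyP/(_ Q0) V0 EQ]] := multiplicity_XsubC Q 0.
  have V0' : V.[0] != 0 by [].
  exists (mpolyC N (V.[0])^-1 * phi l V), k; split.
    rewrite mevalM mevalC /phi -horner_map /= -map_poly_comp.
    have -> : meval (fun=> 0) (X l) = 0 by rewrite mevalXU.
    rewrite (eq_map_poly (g := idfun)); last by move=> c /=; rewrite mevalC.
    by rewrite map_poly_id // mulVf.
  move=> i j; rewrite -mulrA -scalerA; apply: TpZ.
  suff -> : phi l V * X l ^+ k = phi l Q by [].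
  by rewrite EQ phiM subr0 /phi map_polyXn hornerXn.
have /choice[V /choice[kk HV]] := ann'.
exists (\prod_l V l), (\sum_l kk l).+1%N; split.
  by rewrite rmorph_prod big1 // => l _; case: (HV l).
move=> a i j ka.
have [l kl] : exists l, (kk l <= a l)%N.
  apply/existsP; apply: contraTT ka => /existsPn H; rewrite -ltnNge ltnS mdegE.
  by apply: leq_sum => l _; have := H l; rewrite -ltnNge => /ltnW.
rewrite (bigD1 l) //= mulrC -scalerA; apply: TpZ.
have la : lem (mnm_muln (mnm1 l) (kk l)) a.
  apply/mnm_lepP => l'; rewrite mulmnE mnm1E; case: eqP => [<-|_]; first by rewrite mul1n.
  by rewrite mul0n.
rewrite /Emx -(submK la) mpolyXD -mpolyXn scalerA mulrCA -scalerA; apply: TpZ.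
by have [_ HT] := HV l; apply: HT.
Qed.

End Span.

Section Graded.
Variable w : 'I_N -> nat.
Hypothesis w_gt0 : forall l, (0 < w l)%N.
Local Notation wt a := ((fil_mon w a)%:Z).

Implicit Types (p q : P).

Lemma wtD a b : wt (mnm_add a b) = wt a + wt b.
Proof.
rewrite /fil_mon -PoszD -big_split /=; congr Posz; apply: eq_bigr => i _.
by rewrite mnmDE mulnDr.
Qed.

Lemma wtU l : wt (mnm1 l) = (w l)%:Z.
Proof.
rewrite /fil_mon (bigD1 l) //= mnm1E eqxx muln1 big1 ?addn0 // => i /negPf il.
by rewrite mnm1E eq_sym il muln0.
Qed.

Lemma mdeg_le_wt a : (mdeg a)%:Z <= wt a.
Proof. by rewrite mdegE lez_nat; apply: leq_sum => i _; rewrite leq_pmull. Qed.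

(** Being weighted homogeneous of degree [t], having weighted degree below [t],
    and the component of degree [t]. Degrees are integers since they will be
    shifted by the [d_ij]. *)
Definition whom (t : int) (p : P) := forall a, a \in msupp p -> wt a = t.
Definition wlt (t : int) (p : P) := forall a, a \in msupp p -> wt a < t.
Definition wcomp (t : int) (p : P) : P :=
  \sum_(a <- msupp p | wt a == t) mcoeff a p *: mpolyX K a.

Lemma coef_wcomp t p a : mcoeff a (wcomp t p) = if wt a == t then mcoeff a p else 0.
Proof.
rewrite /wcomp raddf_sum /= big_mkcond /=.
pose G b := if wt b == t then mcoeff b p * (b == a)%:R else 0.
rewrite (eq_bigr G) => [|b _]; last by rewrite mcoeffZ mcoeffX.
pose s := undup (a :: msupp p).
rewrite (@sum_msupp _ _ _ G s) ?undup_uniq //; last 2 first.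
- by move=> b bp; rewrite mem_undup inE bp orbT.
- by move=> b b0; rewrite /G b0 mul0r; case: ifP.
have as_ : a \in s by rewrite mem_undup inE eqxx.
rewrite (bigD1_seq _ as_) ?undup_uniq //= big1 ?addr0 => [|b /negPf ba].
  by rewrite /G eqxx mulr1.
by rewrite /G ba mulr0; case: ifP.
Qed.

Lemma wcompD t p q : wcomp t (p + q) = wcomp t p + wcomp t q.
Proof.
by apply/mpolyP => a; rewrite mcoeffD !coef_wcomp mcoeffD; case: ifP; rewrite ?addr0.
Qed.

Lemma wcomp0 t : wcomp t 0 = 0.
Proof. by apply/mpolyP => a; rewrite coef_wcomp mcoeff0; case: ifP. Qed.

Lemma wcomp_sum t (I : Type) (s : seq I) (Q : pred I) (G : I -> P) :
  wcomp t (\sum_(i <- s | Q i) G i) = \sum_(i <- s | Q i) wcomp t (G i).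
Proof. by apply: (big_morph (wcomp t)); [apply: wcompD|apply: wcomp0]. Qed.

Lemma wcompZ t c p : wcomp t (c *: p) = c *: wcomp t p.
Proof.
by apply/mpolyP => a; rewrite mcoeffZ !coef_wcomp mcoeffZ; case: ifP; rewrite ?mulr0.
Qed.

Lemma whom_wcomp t p : whom t (wcomp t p).
Proof. by move=> a; rewrite mcoeff_msupp coef_wcomp; case: (wt a =P t) => //; rewrite eqxx. Qed.

Lemma wcomp_whom t s p : whom s p -> wcomp t p = if s == t then p else 0.
Proof.
move=> H; apply/mpolyP => a; rewrite coef_wcomp.
have [ap|ap] := boolP (a \in msupp p).
  by rewrite (H a ap); case: ifP; rewrite ?mcoeff0.
by rewrite (memN_msupp_eq0 ap); do 2!case: ifP; rewrite ?mcoeff0 ?(memN_msupp_eq0 ap).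
Qed.

Lemma msuppM_ex (p q : P) a : a \in msupp (p * q) -> exists b c,
  [/\ b \in msupp p, c \in msupp q & a = mnm_add b c].
Proof. by move=> /msuppM_le/allpairsP[[b c] [/= H1 H2 ->]]; exists b, c. Qed.

Lemma whomM s t p q : whom s p -> whom t q -> whom (s + t) (p * q).
Proof. by move=> A B a /msuppM_ex[b [c [/A <- /B <- ->]]]; rewrite wtD. Qed.

Lemma wltM s t p q : whom s p -> wlt t q -> wlt (s + t) (p * q).
Proof. by move=> A B a /msuppM_ex[b [c [/A <- /B H ->]]]; rewrite wtD ltrD2l. Qed.

Lemma wlt0 t : wlt t 0.
Proof. by move=> a; rewrite msupp0. Qed.

Lemma wltD t p q : wlt t p -> wlt t q -> wlt t (p + q).
Proof. by move=> A B a /msuppD_le; rewrite mem_cat => /orP[/A|/B]. Qed.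

Lemma wltN t p : wlt t p -> wlt t (- p).
Proof. by move=> A a; rewrite (perm_mem (msuppN p)) => /A. Qed.

Lemma wlt_sum t (I : Type) (s : seq I) (Q : pred I) (G : I -> P) :
  (forall i, Q i -> wlt t (G i)) -> wlt t (\sum_(i <- s | Q i) G i).
Proof. by move=> H; apply: big_ind => //; [apply: wlt0|apply: wltD]. Qed.

Lemma deriv_supp l p a : a \in msupp (mderiv l p : P) ->
  exists2 b, b \in msupp p & wt b = wt a + (w l)%:Z.
Proof.
rewrite mcoeff_msupp mcoeff_mderiv => H; exists (mnm_add a (mnm1 l)).
  by rewrite mcoeff_msupp; apply: contraNneq H => ->; rewrite mul0rn.
by rewrite wtD wtU.
Qed.

Lemma whom_deriv l t p : whom t p -> whom (t - (w l)%:Z) (mderiv l p).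
Proof. by move=> A a /deriv_supp[b /A <- ->]; rewrite addrK. Qed.

Lemma wlt_deriv l t p : wlt t p -> wlt (t - (w l)%:Z) (mderiv l p).
Proof. by move=> A a /deriv_supp[b /A + E]; rewrite E => H; rewrite ltrBrDr. Qed.

Lemma wcompM e t p q : whom t q -> wcomp e (p * q) = wcomp (e - t) p * q.
Proof.
move=> Hq; rewrite {1}(mpolyE p) mulr_suml wcomp_sum.
rewrite [wcomp (e - t) p]/wcomp mulr_suml [RHS]big_mkcond; apply: eq_bigr => a _.
have Ha : whom (wt a) (mpolyX K a) by move=> b; rewrite msuppX inE => /eqP ->.
rewrite -scalerAl wcompZ (wcomp_whom _ (whomM Ha Hq)).
rewrite eq_sym -subr_eq eq_sym.
by case: ifP; rewrite ?scaler0.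
Qed.

Section Homogeneous.
Variables (D : 'M[nat]_(m, n)) (F : MM) (i0 : 'I_m) (j0 : 'I_n).
Hypothesis Fhom : forall i j, whom (D i j)%:Z (F i j).
Hypothesis Dtype : forall i l j k,
  (D i j)%:Z - (D i k)%:Z = (D l j)%:Z - (D l k)%:Z :> int.

(** The component of degree [e] for the grading in which the monomial [x^a] in
    position [(i, j)] has degree [wt a - d_ij], so that [F] has degree 0. *)
Definition gcomp (e : int) (M : MM) : MM :=
  \matrix_(i, j) wcomp (e + (D i j)%:Z) (M i j).

Lemma gcompD e M M' : gcomp e (M + M') = gcomp e M + gcomp e M'.
Proof. by apply/matrixP => i j; rewrite !mxE wcompD. Qed.

Lemma gcomp0 e : gcomp e 0 = 0.
Proof. by apply/matrixP => i j; rewrite !mxE wcomp0. Qed.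

Lemma gcomp_sum e (I : Type) (s : seq I) (Q : pred I) (G : I -> MM) :
  gcomp e (\sum_(i <- s | Q i) G i) = \sum_(i <- s | Q i) gcomp e (G i).
Proof. by apply: (big_morph (gcomp e)); [apply: gcompD|apply: gcomp0]. Qed.

Lemma gcompZ e c M : gcomp e (mpolyC N c *: M) = mpolyC N c *: gcomp e M.
Proof. by apply/matrixP => i j; rewrite !mxE !mul_mpolyC wcompZ. Qed.

Lemma gcomp_Emx e a i j :
  gcomp e (Emx a i j) = if wt a == e + (D i j)%:Z then Emx a i j else 0.
Proof.
apply/matrixP => k l; rewrite /Emx !mxE.
have Ha : whom (wt a) (mpolyX K a) by move=> b; rewrite msuppX inE => /eqP ->.
have [/andP[/eqP-> /eqP->]|/negPf H] := boolP ((k == i) && (l == j)).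
  rewrite mulr1 (wcomp_whom _ Ha); case: ifP => _; rewrite !mxE ?eqxx ?mulr1 //.
by rewrite mulr0 wcomp0; case: ifP; rewrite !mxE ?H ?mulr0.
Qed.

(** The generators [d_l F], [e_ik F] and [F e_kj] are homogeneous of degrees
    [- w_l], [d_kj - d_ij] and [d_ik - d_ij], the last two being independent of
    [j] and of [i] respectively by the condition on the [d_ij]; this is why they
    can be computed in the column [j0] and in the row [i0]. So the component of
    degree [e] of a tangent vector is the tangent vector of the components of its
    coefficients. *)
Lemma Tp_graded e M : Tp F M -> exists (u : 'I_N -> P) (b : 'M[P]_m) (c : 'M[P]_n),
  [/\ gcomp e M = \sum_l u l *: dmx l F + b *m F + F *m c,
     forall l, whom (e + (w l)%:Z) (u l),
     forall i k j, whom (e + (D i j)%:Z - (D k j)%:Z) (b i k) &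
     forall i k j, whom (e + (D i j)%:Z - (D i k)%:Z) (c k j)].
Proof.
move=> [u [b [c ->]]].
have Drow i k j j' : e + (D i j)%:Z - (D k j)%:Z = e + (D i j')%:Z - (D k j')%:Z.
  by have := Dtype i k j j'; lia.
have Dcol i i' k j : e + (D i j)%:Z - (D i k)%:Z = e + (D i' j)%:Z - (D i' k)%:Z.
  by have := Dtype i i' j k; lia.
exists (fun l => wcomp (e + (w l)%:Z) (u l)).
exists (\matrix_(i, k) wcomp (e + (D i j0)%:Z - (D k j0)%:Z) (b i k)).
exists (\matrix_(k, j) wcomp (e + (D i0 j)%:Z - (D i0 k)%:Z) (c k j)).
split.
- rewrite !gcompD gcomp_sum; congr (_ + _ + _).
  + apply: eq_bigr => l _; apply/matrixP => i j; rewrite !mxE.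
    rewrite (wcompM _ _ (whom_deriv (@Fhom i j))); congr (wcomp _ _ * _); lia.
  + apply/matrixP => i j; rewrite !mxE wcomp_sum; apply: eq_bigr => k _.
    by rewrite (wcompM _ _ (@Fhom k j)) mxE (Drow i k j j0).
  + apply/matrixP => i j; rewrite !mxE wcomp_sum; apply: eq_bigr => k _.
    rewrite mulrC (wcompM _ _ (@Fhom i k)) mxE (Dcol i i0 k j).
    by rewrite mulrC.
- by move=> l; apply: whom_wcomp.
- by move=> i k j; rewrite mxE (Drow i k j j0); apply: whom_wcomp.
- by move=> i k j; rewrite mxE (Dcol i i0 k j); apply: whom_wcomp.
Qed.

Lemma Tp_gcomp e M : Tp F M -> Tp F (gcomp e M).
Proof. by move=> /(Tp_graded e)[u [b [c [-> _ _ _]]]]; exists u, b, c. Qed.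

(** As the weights are positive, the degree of a monomial is at least its order
    up to a constant. A monomial matrix that is tangent up to high order is thus
    the component, in its own degree, of a tangent vector. *)
Lemma Tp_complete s :
  (forall a i j, mdeg a = s -> exists2 T, Tp F T & ordmx s.+1 (Emx a i j - T)) ->
  forall M, ordmx s M -> Tp F M.
Proof.
move=> H M HM; rewrite (mx_monomials M); apply: Tp_sum => i _; apply: Tp_sum => j _.
rewrite big_seq; apply: Tp_sum => a /(ordge_supp (HM i j)) sa; apply: TpZ.
have HE : ordmx s (Emx a i j).
  by move=> k l; rewrite !mxE; apply: ordgeMr; apply: ordgeW sa _; apply: ordgeX.
pose d := (fil_mon w a + \sum_k \sum_l D k l).+1%N.
have [T T1 T2] := Tp_iterate H d HE.
pose e := wt a - (D i j)%:Z.
have -> : Emx a i j = gcomp e T; last exact: Tp_gcomp.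
have <- : gcomp e (Emx a i j) = Emx a i j by rewrite gcomp_Emx /e subrK eqxx.
rewrite -[Emx a i j](subrK T) gcompD.
suff -> : gcomp e (Emx a i j - T) = 0 by rewrite add0r.
apply/matrixP => k l; rewrite mxE [RHS]mxE; apply/mpolyP => b.
rewrite coef_wcomp mcoeff0; case: eqP => // E.
apply/(T2 k l b); have := mdeg_le_wt b; rewrite E /e.
have : (D k l <= \sum_k \sum_l D k l)%N.
  by rewrite (bigD1 k) //= (bigD1 l) //= -addnA leq_addr.
rewrite /d; lia.
Qed.

End Homogeneous.

(** By induction on the degree of [M]: its leading component is a combination of
    [S] plus a tangent vector of [F], and replacing [F] by [F + G] in this tangent
    vector, with the same homogeneous coefficients, changes only terms of lower
    degree. *)
Lemma spanned_perturb (D : 'M[nat]_(m, n)) (F G : MM) (i0 : 'I_m) (j0 : 'I_n) s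
    (S : {set bmultinom N s * 'I_m * 'I_n}) :
  (forall i j, whom (D i j)%:Z (F i j)) -> (forall i j, wlt (D i j)%:Z (G i j)) ->
  (forall i l j k, (D i j)%:Z - (D i k)%:Z = (D l j)%:Z - (D l k)%:Z :> int) ->
  (forall M, spanned F S M) -> forall M, spanned (F + G) S M.
Proof.
move=> Fhom Glow Dtype span.
pose Dl := (\sum_i \sum_j D i j)%N.
have DDl i j : (D i j <= Dl)%N by rewrite /Dl (bigD1 i) //= (bigD1 j) //= -addnA leq_addr.
(* Degrees of matrices are at least [- Dl], which is where the induction starts. *)
suff H k : forall M, (forall i j, wlt (k%:Z - Dl%:Z + (D i j)%:Z) (M i j)) ->
    spanned (F + G) S M.
  move=> M; pose bnd i j := (\max_(a <- msupp (M i j)) fil_mon w a)%N.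
  apply: (H (Dl + (\sum_i \sum_j bnd i j)).+1%N) => i j a aM.
  have : (fil_mon w a <= bnd i j)%N by apply: leq_bigmax_seq.
  have : (bnd i j <= \sum_i \sum_j bnd i j)%N.
    by rewrite (bigD1 i) //= (bigD1 j) //= -addnA leq_addr.
  lia.
elim: k => [|k IH] M HM.
  suff -> : M = 0 by apply/spannedT/Tp0.
  apply/matrixP => i j; rewrite mxE; apply: msuppnil0.
  case E: (msupp (M i j)) => [//|a l].
  have : a \in msupp (M i j) by rewrite E inE eqxx.
  by move=> /(HM i j a); have := DDl i j; lia.
set e := k%:Z - Dl%:Z in IH.
have [z zT] := span M.
have [u [b [c [E hu hb hc]]]] := Tp_graded i0 j0 Fhom Dtype e zT.
pose t F := \sum_l u l *: dmx l F + b *m F + F *m c : MM.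
have tD : t (F + G) = t F + t G.
  rewrite /t mulmxDr mulmxDl [RHS]addrACA; congr (_ + _).
  rewrite [RHS]addrACA; congr (_ + _).
  rewrite -big_split; apply: eq_bigr => l _; rewrite /= -scalerDr; congr (_ *: _).
  by apply/matrixP => i j; rewrite !mxE mderivD.
have EL : gcomp D e (lincomb S z) = lincomb S (fun t =>
    if wt (bmnm t.1.1) == e + (D t.1.2 t.2)%:Z then z t else 0).
  rewrite /lincomb gcomp_sum; apply: eq_bigr => y _; rewrite gcompZ gcomp_Emx.
  by case: ifP => // _; rewrite scaler0 mpolyC0 scale0r.
have -> : M = t (F + G) + gcomp D e (lincomb S z) + (M - gcomp D e M - t G).
  have EM : gcomp D e M = t F + gcomp D e (lincomb S z).
    by rewrite /t -E -gcompD subrK.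
  by rewrite tD EM; apply/matrixP => i j; rewrite !mxE; ring.
apply: spannedD; [apply: spannedD|].
- by apply: spannedT; exists u, b, c.
- by rewrite EL; apply: spanned_lincomb.
apply: IH => i j; rewrite !mxE; apply: wltD.
  move=> a; rewrite mcoeff_msupp mcoeffB coef_wcomp.
  case: (wt a =P e + (D i j)%:Z) => [_|ne].
    by rewrite subrr eqxx.
  by rewrite subr0 -mcoeff_msupp => /(HM i j a); move: ne; rewrite /e; lia.
apply: wltN; apply: wltD; [apply: wltD|].
- rewrite summxE; apply: wlt_sum => l _; rewrite !mxE => a aM.
  by have := wltM (hu l) (wlt_deriv (l := l) (@Glow i j)) aM; lia.
- apply: wlt_sum => k' _ a aM.
  by have := wltM (hb i k' j) (@Glow k' j) aM; lia.
- apply: wlt_sum => k' _ a; rewrite mulrC => aM.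
  by have := wltM (hc i k' j) (@Glow i k') aM; lia.
Qed.

End Graded.
End TangentModule.

(** * Derivations of the complex numbers *)

Section Derivations.
Variable L : numClosedFieldType.
Implicit Types (G : set (L * L)).

(** The graph of a derivation defined on a subring of [L]: a subring of the dual
    numbers [a + b epsilon] over [L] that meets [L epsilon] in 0. *)
Definition partial_derivation G := [/\ G (1, 0),
  forall a b, G a -> G b -> G (a.1 - b.1, a.2 - b.2),
  forall a b, G a -> G b -> G (a.1 * b.1, a.1 * b.2 + a.2 * b.1) &
  forall v, G (0, v) -> v = 0].

Section OneStep.
Variable G : set (L * L).
Hypothesis Gder : partial_derivation G.

Lemma der1 : G (1, 0). Proof. by case: Gder. Qed.
Lemma derB x u y v : G (x, u) -> G (y, v) -> G (x - y, u - v).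
Proof. by case: Gder => _ H _ _ A B; apply: (H _ _ A B). Qed.
Lemma derM x u y v : G (x, u) -> G (y, v) -> G (x * y, x * v + u * y).
Proof. by case: Gder => _ _ H _ A B; apply: (H _ _ A B). Qed.
Lemma der0 : G (0, 0).
Proof. by have := derB der1 der1; rewrite !subrr. Qed.
Lemma derN x u : G (x, u) -> G (- x, - u).
Proof. by move=> A; have := derB der0 A; rewrite !sub0r. Qed.
Lemma derD x u y v : G (x, u) -> G (y, v) -> G (x + y, u + v).
Proof. by move=> A /derN B; have := derB A B; rewrite !opprK. Qed.
Lemma der_sum I (r : seq I) (P : pred I) (x u : I -> L) :
  (forall i, P i -> G (x i, u i)) ->
  G (\sum_(i <- r | P i) x i, \sum_(i <- r | P i) u i).
Proof.
by move=> H; apply: (big_ind2 (fun a b => G (a, b))) => // *; [apply: der0|apply: derD].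
Qed.
Lemma der_fun x u v : G (x, u) -> G (x, v) -> u = v.
Proof.
move=> A B; have := derB A B; rewrite subrr; case: Gder => _ _ _ H /H/eqP.
by rewrite subr_eq0 => /eqP.
Qed.
Lemma der_nat k : G (k%:R, 0).
Proof.
elim: k => [|k IH]; first exact: der0.
by have := derD IH der1; rewrite natr1 addr0.
Qed.

(** [q] is [p] with the derivation applied to its coefficients. *)
Definition polyder (p q : {poly L}) := forall i, G (p`_i, q`_i).

Lemma polyderC a a' : G (a, a') -> polyder a%:P a'%:P.
Proof. by move=> H [|i]; rewrite !coefC //=; apply: der0. Qed.
Lemma polyderX : polyder 'X 0.
Proof. by move=> i; rewrite coefX coef0; case: (i == 1%N); [apply: der1|apply: der0]. Qed.
Lemma polyderB p q p' q' : polyder p q -> polyder p' q' -> polyder (p - p') (q - q').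
Proof. by move=> A B i; rewrite !coefB; apply: derB. Qed.
Lemma polyderM p q p' q' : polyder p q -> polyder p' q' ->
  polyder (p * p') (p * q' + q * p').
Proof.
move=> A B i; rewrite coefD !coefM -big_split /=.
by apply: der_sum => j _; apply: derM.
Qed.
Lemma polyder_deriv p q : polyder p q -> polyder p^`() q^`().
Proof.
move=> A i; rewrite !coef_deriv -mulr_natl -[q`_i.+1 *+ _]mulr_natl.
by have := derM (der_nat i.+1) (A i.+1); rewrite mul0r addr0.
Qed.

Variable g : L.

(** The derivative of [p.[g]] that is forced by the product rule once [g] has the
    derivative [de]. *)
Definition dval (de : L) (p q : {poly L}) : L := q.[g] + p^`().[g] * de.

Lemma dvalM de p q p' q' :
  dval de (p * p') (p * q' + q * p') = p.[g] * dval de p' q' + dval de p q * p'.[g].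
Proof. by rewrite /dval derivM !hornerE; ring. Qed.

Lemma dvalB de p q p' q' : dval de (p - p') (q - q') = dval de p q - dval de p' q'.
Proof. by rewrite /dval derivB !hornerE; ring. Qed.

Definition adjoin (de : L) : set (L * L) :=
  [set x | exists p q, polyder p q /\ x = (p.[g], dval de p q)].

Lemma adjoin_derivation de :
  (forall p q, polyder p q -> p.[g] = 0 -> dval de p q = 0) -> partial_derivation (adjoin de).
Proof.
move=> H; split.
- exists 1, 0; split; last by rewrite /dval -polyC1 derivC !horner0 hornerC mul0r addr0.
  by have := polyderC der1; rewrite polyC1 polyC0.
- move=> _ _ [p [q [A ->]]] [p' [q' [B ->]]] /=.
  exists (p - p'), (q - q'); split; first exact: polyderB.
  by rewrite dvalB !hornerE.
- move=> _ _ [p [q [A ->]]] [p' [q' [B ->]]] /=.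
  exists (p * p'), (p * q' + q * p'); split; first exact: polyderM.
  by rewrite dvalM hornerM.
- by move=> v [p [q [A [E ->]]]]; apply: H => //.
Qed.

Lemma adjoin_sub de : G `<=` adjoin de.
Proof.
move=> [a a'] A; exists a%:P, a'%:P; split; first exact: polyderC.
by rewrite /dval derivC horner0 !hornerC mul0r addr0.
Qed.

Lemma adjoin_mem de : adjoin de (g, de).
Proof.
exists 'X, 0; split; first exact: polyderX.
by rewrite /dval derivX !hornerE ?mul1r ?add0r.
Qed.

Definition transcendental_over := forall p q, polyder p q -> p.[g] = 0 -> p = 0.

Lemma adjoin_trans de : transcendental_over -> partial_derivation (adjoin de).
Proof.
move=> T; apply: adjoin_derivation => p q A pg; have p0 := T p q A pg.
have -> : q = 0.
  apply/polyP => i; have := A i; rewrite p0 coef0.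
  by case: Gder => _ _ _ H /H.
by rewrite /dval p0 deriv0 !horner0 mul0r addr0.
Qed.

(** If [g] is transcendental over the domain, any value will do. Otherwise let
    [p0] be a polynomial of minimal degree that vanishes at [g]: its derivative
    does not vanish at [g], and the value of the extension is the one for which
    [p0.[g] = 0] has derivative 0. Every other polynomial vanishing at [g] is
    reduced by pseudo-division, because the domain is only a ring. *)
Lemma adjoin_exists : exists de, partial_derivation (adjoin de).
Proof.
have [T|] := pselect transcendental_over; first by exists 0; apply: adjoin_trans.
move=> /existsNP[p1 /existsNP[q1 /not_implyP[A1 /not_implyP[g1 p1n]]]].
pose ann k := `[< exists p q, [/\ polyder p q, p.[g] = 0, p != 0 & size p = k] >].
have exk : exists k, ann k.
  by exists (size p1); apply/asboolP; exists p1, q1; split=> //; apply/eqP.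
case: (ex_minnP exk) => k /asboolP[p0 [q0 [A0 g0 p0n sk]]] kmin.
have small p q : polyder p q -> p.[g] = 0 -> (size p < k)%N -> p = 0.
  move=> A pg; apply: contraTeq => pn; rewrite -leqNgt; apply: kmin.
  by apply/asboolP; exists p, q.
have dg : p0^`().[g] != 0.
  apply/eqP => E; have := small _ _ (polyder_deriv A0) E.
  rewrite -sk => /(_ (lt_size_deriv p0n)) d0.
  have sz : (size p0 <= 1)%N.
    rewrite leqNgt; apply/negP => s1.
    have : p0`_(size p0).-2.+1 *+ (size p0).-2.+1 = 0 by rewrite -coef_deriv d0 coef0.
    have -> : (size p0).-2.+1 = (size p0).-1 by lia.
    move=> /eqP; rewrite mulrn_eq0 -/(lead_coef p0) lead_coef_eq0 (negPf p0n) orbF.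
    lia.
  have := size1_polyC sz => E1; move: g0 p0n; rewrite E1 hornerC => ->.
  by rewrite polyC0 eqxx.
pose de := - q0.[g] / p0^`().[g]; exists de.
have d0 : dval de p0 q0 = 0 by rewrite /dval /de mulrC divfK // subrr.
apply: adjoin_derivation => p q.
have [s] := ubnP (size p); elim: s p q => // s IH p q ps A pg.
have [pk|kp] := ltnP (size p) k.
  have p00 := small p q A pg pk.
  have -> : q = 0.
    apply/polyP => i; have := A i; rewrite p00 coef0.
    by case: Gder => _ _ _ H /H.
  by rewrite /dval p00 deriv0 !horner0 mul0r addr0.
pose e := (size p - k)%N.
pose a := lead_coef p0; pose a' := q0`_(size p0).-1.
pose b := lead_coef p; pose b' := q`_(size p).-1.
have Ga : G (a, a') := A0 _.
have Gb : G (b, b') := A _.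
have AX : polyder 'X^e 0.
  elim: (e) => [|j IHj].
    by have := polyderC der1; rewrite polyC1 polyC0 expr0.
  have := polyderM polyderX IHj; rewrite mulr0 mul0r addr0 exprS; apply.
have A2 := polyderB (polyderM (polyderC Ga) A) (polyderM (polyderM (polyderC Gb) AX) A0).
have := IH _ _ _ A2.
rewrite dvalB !dvalM !hornerE pg g0 d0 !mulr0 !addr0 !subr0.
move=> H.
have /eqP : a * dval de p q = 0.
  apply: H => //.
  have k0 : (0 < k)%N by rewrite -sk lt0n size_poly_eq0.
  apply: (@leq_ltn_trans (size p).-1); last by lia.
  apply/leq_sizeP => i pi.
  rewrite coefB -mulrA !coefCM coefXnM.
  have [ie|ei] := ltnP i e; first by move: ie; rewrite /e; lia.
  have [ip|ip] := leqP (size p) i.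
    rewrite [p`_i]nth_default // [p0`_(i - e)]nth_default ?mulr0 ?subrr //.
    by rewrite sk /e; lia.
  have Ei : i = (size p).-1 by lia.
  have -> : (i - e = (size p0).-1)%N by rewrite sk /e; lia.
  by rewrite Ei mulrC subrr.
by rewrite mulf_eq0 lead_coef_eq0 (negPf p0n) /= => /eqP.
Qed.

End OneStep.

(** Zorn's lemma: a partial derivation extends to the whole field. *)
Lemma der_extend G : partial_derivation G -> exists D : L -> L, [/\ {morph D : x y / x + y},
  forall x y, D (x * y) = x * D y + D x * y & forall x u, G (x, u) -> D x = u].
Proof.
move=> G0; pose P (X : set (L * L)) := partial_derivation (X `|` G).
have [A [PA maxA]] : exists A, P A /\ forall B, A `<` B -> ~ P B.
  apply: Zorn_bigcup => F FP Ftot; rewrite /P.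
  have up a : (\bigcup_(X in F) X `|` G) a -> G a \/ exists2 X, F X & (X `|` G) a.
    by move=> [[X FX Xa]|Ga]; [right; exists X => //; left|left].
  have down X a : F X -> (X `|` G) a -> (\bigcup_(X in F) X `|` G) a.
    by move=> FX [Xa|Ga]; [left; exists X|right].
  have up2 a b : (\bigcup_(X in F) X `|` G) a -> (\bigcup_(X in F) X `|` G) b ->
     (G a /\ G b) \/ exists X, [/\ F X, (X `|` G) a & (X `|` G) b].
    move=> /up[Ga|[X FX Xa]] /up[Gb|[Y FY Yb]].
    - by left.
    - by right; exists Y; split=> //; right.
    - by right; exists X; split=> //; right.
    - right; have [XY|YX] := Ftot X Y FX FY.
        by exists Y; split=> //; case: Xa => [/XY|]; [left|right].
      by exists X; split=> //; case: Yb => [/YX|]; [left|right].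
  split.
  - by right; case: G0.
  - move=> a b Ha Hb; have [[Ga Gb]|[X [FX Xa Xb]]] := up2 a b Ha Hb.
      by right; case: G0 => _ H _ _; apply: H.
    by apply: (down X _ FX); case: (FP X FX) => _ H _ _; apply: H.
  - move=> a b Ha Hb; have [[Ga Gb]|[X [FX Xa Xb]]] := up2 a b Ha Hb.
      by right; case: G0 => _ _ H _; apply: H.
    by apply: (down X _ FX); case: (FP X FX) => _ _ H _; apply: H.
  - move=> v /up[Gv|[X FX Xv]]; first by case: G0 => _ _ _ H; apply: H.
    by case: (FP X FX) => _ _ _ H; apply: H.
set M := A `|` G; have Mder : partial_derivation M := PA.
have tot g : exists u, M (g, u).
  have [de Ade] := adjoin_exists Mder g; exists de.
  apply: contrapT => nM; apply: (maxA (adjoin M g de)); last first.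
    rewrite /P (_ : _ `|` G = adjoin M g de) //.
    by apply/setUidl => x Gx; apply: adjoin_sub => //; right.
  split; first by move=> x Ax; apply: adjoin_sub => //; left.
  by move=> /(_ _ (adjoin_mem Mder g de)) Ag; apply: nM; left.
have [D HD] := choice tot; exists D; split.
- move=> x y; apply: (der_fun Mder (HD _)); exact: (derD Mder).
- move=> x y; apply: (der_fun Mder (HD _)); exact: (derM Mder).
- by move=> x u Gx; apply: (der_fun Mder (HD _)); right.
Qed.

Definition enumerable (A : set L) := exists f : nat -> L, A `<=` range f.

Lemma roots_exist (p : {poly L}) : p != 0 -> exists r : seq L, forall x, p.[x] = 0 -> x \in r.
Proof.
move=> p0; have [r E] := closed_field_poly_normal p; exists r => x px.
have : root p x by rewrite /root px.
by rewrite {1}E rootZ ?lead_coef_eq0 // root_prod_XsubC.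
Qed.

(** Polynomials over an enumerated set are coded by lists of integers, and a root
    by such a list together with its position among the roots. *)
Lemma enumerable_algebraic (A : set L) : enumerable A ->
  enumerable [set x | exists p : {poly L}, [/\ forall i, A p`_i, p != 0 & p.[x] = 0]].
Proof.
move=> [f Af].
pose pol (c : seq nat) : {poly L} := Poly [seq f i | i <- c].
have /choice[rt Hrt] : forall c, exists r : seq L, pol c != 0 -> forall x, (pol c).[x] = 0 -> x \in r.
  by move=> c; have [E|/roots_exist[r]] := eqVneq (pol c) 0; [exists [::]|exists r].
pose h (t : seq nat * nat) := nth 0 (rt t.1) t.2.
exists (fun n => if (choice.unpickle n : option (seq nat * nat)) is Some t then h t else 0).
move=> x [p [pA p0 px]].
have /choice[c Hc] : forall i, exists n, f n = p`_i.
  by move=> i; have [n _ E] := Af _ (pA i); exists n.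
pose cs := [seq c i | i <- iota 0 (size p)].
have Ep : pol cs = p.
  apply/polyP => i; rewrite coef_Poly -map_comp.
  have [ip|pi] := ltnP i (size p).
    by rewrite (nth_map 0%N) ?size_iota //= nth_iota // add0n Hc.
  by rewrite !nth_default // size_map size_iota.
have xr : x \in rt cs by apply: Hrt; rewrite Ep.
exists (choice.pickle (cs, index x (rt cs))) => //.
by rewrite choice.pickleK /h /= nth_index.
Qed.

Lemma enumerable_adjoin (A : set L) (c : L) : enumerable A ->
  enumerable [set x | exists p : {poly L}, (forall i, A p`_i) /\ x = p.[c]].
Proof.
move=> [f Af].
pose pol (c : seq nat) : {poly L} := Poly [seq f i | i <- c].
exists (fun n => if (choice.unpickle n : option (seq nat)) is Some s then (pol s).[c] else 0).
move=> x [p [pA ->]].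
have /choice[d Hd] : forall i, exists n, f n = p`_i.
  by move=> i; have [n _ E] := Af _ (pA i); exists n.
pose cs := [seq d i | i <- iota 0 (size p)].
have Ep : pol cs = p.
  apply/polyP => i; rewrite coef_Poly -map_comp.
  have [ip|pi] := ltnP i (size p).
    by rewrite (nth_map 0%N) ?size_iota //= nth_iota // add0n Hd.
  by rewrite !nth_default // size_map size_iota.
by exists (choice.pickle cs) => //; rewrite choice.pickleK Ep.
Qed.

Section Generic.
Hypothesis uncountable : forall h : nat -> L, exists x, forall n, h n != x.

Definition domain G : set L := [set x | exists u, G (x, u)].

(** The [c_j] are chosen one after the other outside the countable set of the
    numbers algebraic over the previous ones, so that derivations can take any
    values on them. The domain [B] does not depend on these values, which allows
    the next element to be chosen before them. *)
Lemma generic_elements (A : set L) q : enumerable A ->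
  partial_derivation [set x | A x.1 /\ x.2 = 0] ->
  exists (c : nat -> L) (B : set L), enumerable B /\
    forall de : nat -> L, exists G, [/\ partial_derivation G, domain G = B,
      forall a, A a -> G (a, 0) & forall j, (j < q)%N -> G (c j, de j)].
Proof.
move=> Aen A0; elim: q => [|q [c [B [Ben H]]]].
  exists (fun=> 0), A; split=> // de; exists [set x | A x.1 /\ x.2 = 0]; split=> //.
  by apply/seteqP; split => [x [u []]|x Ax] //; exists 0.
have [f Hf] := enumerable_algebraic Ben.
have [g Hg] := uncountable f.
exists (fun j => if j == q then g else c j).
exists [set x | exists p : {poly L}, (forall i, B p`_i) /\ x = p.[g]].
split; first exact: enumerable_adjoin.
move=> de; have [G [Gder GB GA Gc]] := H de.
have T : transcendental_over G g.
  move=> p p' Gp pg; apply: contrapT => /eqP p0.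
  have [|n _ E] := Hf g; last by have := Hg n; rewrite E eqxx.
  by exists p; split=> // i; rewrite -GB; exists p'`_i.
exists (adjoin G g (de q)); split.
- exact: adjoin_trans.
- apply/seteqP; split => [x [u [p [p' [Gp [-> _]]]]]|x [p [pB ->]]].
    by exists p; split=> // i; rewrite -GB; exists p'`_i.
  have /choice[u Hu] : forall i, exists u, G (p`_i, u).
    by move=> i; have := pB i; rewrite -GB.
  pose p' := \poly_(i < size p) u i.
  exists (dval g (de q) p p'), p, p'; split=> // i.
  rewrite coef_poly; case: ltnP => [_|pi]; first exact: Hu.
  by rewrite nth_default //; apply: der0.
- by move=> a Aa; apply: adjoin_sub => //; apply: GA.
- move=> j jq; case: eqP => [->|/eqP jn]; first exact: adjoin_mem.
  by apply: adjoin_sub => //; apply: Gc; rewrite ltn_neqAle jn -ltnS.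
Qed.

End Generic.

End Derivations.

Section ComplexDerivations.
Variable R : realType.
Local Notation C := (Cplx R).

Lemma real_uncountable (h : nat -> R) : exists x, forall n, h n != x.
Proof.
apply: contrapT => H.
have all_h x : exists n, h n = x.
  by apply: contrapT => nx; apply: H; exists x => n; apply/eqP => E; apply: nx; exists n.
have cnt : countable `[0 : R, 1]%classic.
  apply: (@sub_countable _ _ _ (range h)).
    by apply: subset_card_le => x _; have [n <-] := all_h x; exists n.
  exact: (sub_countable (card_image_le h setT)).
have := countable_lebesgue_measure0 cnt.
rewrite lebesgue_measure_itv /= lte_fin ltr01 -EFinB subr0 => /eqP.
by rewrite eqe oner_eq0.
Qed.

Lemma complex_uncountable (h : nat -> C) : exists x, forall n, h n != x.
Proof.
have [x Hx] := real_uncountable (fun n => complex.Re (h n)).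
exists (x%:C)%C => n; apply: contraNneq (Hx n) => ->.
by rewrite eqxx.
Qed.

(** The subring generated by [s]: a ring is the domain of the zero derivation. *)
Lemma countable_subring (s : seq C) : exists A : set C,
  [/\ enumerable A, partial_derivation [set x | A x.1 /\ x.2 = 0] & {in s, forall a, A a}].
Proof.
elim: s => [|a s [A [Aen Ader As]]].
  exists (range (fun z : int => z%:~R)); split=> //.
    exists (fun n => if (choice.unpickle n : option int) is Some z then z%:~R else 0).
    by move=> _ [z _ <-]; exists (choice.pickle z) => //; rewrite choice.pickleK.
  split=> /=.
  - by split=> //; exists 1.
  - by move=> [_ _] [_ _] [[z _ <-] /= ->] [[z' _ <-] /= ->]; rewrite -intrB subrr; split=> //; exists (z - z').
  - move=> [_ _] [_ _] [[z _ <-] /= ->] [[z' _ <-] /= ->]; rewrite -intrM mulr0 mul0r addr0.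
    by split=> //; exists (z * z').
  - by move=> v [].
set G := [set x | A x.1 /\ x.2 = 0] in Ader.
have polA (p : {poly C}) : (forall i, A p`_i) <-> polyder G p 0.
  by split=> [H i|H i]; [rewrite coef0; split=> //; apply: H|case: (H i)].
exists [set x | exists p : {poly C}, (forall i, A p`_i) /\ x = p.[a]].
split; first exact: enumerable_adjoin.
- split=> /=.
  + split=> //; exists 1; split; last by rewrite hornerC.
    by apply/polA; have := polyderC Ader (der1 Ader); rewrite polyC1 polyC0.
  + move=> [_ _] [_ _] [[p [/polA pA ->]] /= ->] [[p' [/polA pA' ->]] /= ->]; rewrite subrr.
    split=> //; exists (p - p'); split; last by rewrite !hornerE.
    by apply/polA; have := polyderB Ader pA pA'; rewrite subrr.
  + move=> [_ _] [_ _] [[p [/polA pA ->]] /= ->] [[p' [/polA pA' ->]] /= ->].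
    rewrite mulr0 mul0r addr0; split=> //; exists (p * p'); split; last by rewrite hornerM.
    by apply/polA; have := polyderM Ader pA pA'; rewrite mulr0 mul0r addr0.
  + by move=> v [].
- move=> x; rewrite inE => /orP[/eqP ->|xs].
    exists 'X; split; last by rewrite hornerX.
    by apply/polA; apply: polyderX.
  exists x%:P; split; last by rewrite hornerC.
  by apply/polA; have := polyderC Ader (conj (As x xs) erefl : G (x, 0)); rewrite polyC0.
Qed.

Definition derivation (D : C -> C) :=
  {morph D : x y / x + y} /\ forall x y, D (x * y) = x * D y + D x * y.

(** The [c_j] are algebraically independent over [s], in the form in which this is
    used: they have partial derivatives. *)
Lemma generic_derivations (s : seq C) q : exists c : nat -> C,
  forall de : nat -> C, exists D, [/\ derivation D,
    {in s, forall a, D a = 0} & forall j, (j < q)%N -> D (c j) = de j].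
Proof.
have [A [Aen Ader As]] := countable_subring s.
have [c [B [_ H]]] := generic_elements complex_uncountable q Aen Ader.
exists c => de; have [G [Gder _ GA Gc]] := H de.
have [D [D1 D2 D3]] := der_extend Gder.
by exists D; split=> // [a /As /GA /D3|j /Gc /D3].
Qed.

End ComplexDerivations.

(** * Jets *)

Section Congruence.
Variables (K : comNzRingType) (N : nat).
Local Notation P := (mpoly N K).

Definition eqm (d m n : nat) (A B : 'M[P]_(m, n)) := forall i j, ordge d (A i j - B i j).

Lemma eqm_refl d m n (A : 'M[P]_(m, n)) : eqm d A A.
Proof. by move=> i j; rewrite subrr; apply: ordge_0. Qed.

Lemma eqm_eqr d m n (A B C : 'M[P]_(m, n)) : eqm d A B -> B = C -> eqm d A C.
Proof. by move=> H <-. Qed.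

Lemma eqm_sym d m n (A B : 'M[P]_(m, n)) : eqm d A B -> eqm d B A.
Proof. by move=> H i j; rewrite -opprB; apply: ordgeN. Qed.

Lemma eqm_trans d m n (B A C : 'M[P]_(m, n)) : eqm d A B -> eqm d B C -> eqm d A C.
Proof.
move=> H1 H2 i j; rewrite -[A i j](subrK (B i j)) -addrA.
by apply: ordgeD.
Qed.

Lemma eqmD d m n (A B A' B' : 'M[P]_(m, n)) : eqm d A B -> eqm d A' B' ->
  eqm d (A + A') (B + B').
Proof. by move=> H1 H2 i j; rewrite !mxE opprD addrACA; apply: ordgeD. Qed.

Lemma eqm_sum d m n (I : Type) (s : seq I) (Q : pred I) (A B : I -> 'M[P]_(m, n)) :
  (forall i, Q i -> eqm d (A i) (B i)) ->
  eqm d (\sum_(i <- s | Q i) A i) (\sum_(i <- s | Q i) B i).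
Proof. by move=> H; apply: big_ind2 => //; [apply: eqm_refl|move=> *; apply: eqmD]. Qed.

Lemma eqmM d m n k (A B : 'M[P]_(m, n)) (A' B' : 'M[P]_(n, k)) :
  eqm d A B -> eqm d A' B' -> eqm d (A *m A') (B *m B').
Proof.
move=> H1 H2 i j; rewrite !mxE -sumrB; apply: ordge_sum => l _.
have -> : A i l * A' l j - B i l * B' l j =
  (A i l - B i l) * A' l j + B i l * (A' l j - B' l j) by ring.
by apply: ordgeD; [apply: ordgeMr|apply: ordgeMl].
Qed.

Lemma eqmZ d m n (p : P) (A B : 'M[P]_(m, n)) : eqm d A B -> eqm d (p *: A) (p *: B).
Proof. by move=> H i j; rewrite !mxE -mulrBr; apply: ordgeMl. Qed.

End Congruence.
Arguments eqm_refl {K N} d {m n} A.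
Arguments eqmZ {K N d m n} p {A B} _.

Section SubstMatrix.
Variables (K : comNzRingType) (N k : nat) (h : 'I_N -> mpoly k K).
Local Notation pm A := (map_mx (pcomp h) A).

Lemma pmM m n l (A : 'M[mpoly N K]_(m, n)) (B : 'M[mpoly N K]_(n, l)) : pm (A *m B) = pm A *m pm B.
Proof.
apply/matrixP => i j; rewrite !mxE pcomp_sum; apply: eq_bigr => a _.
by rewrite pcompM !mxE.
Qed.

Lemma pmD m n (A B : 'M[mpoly N K]_(m, n)) : pm (A + B) = pm A + pm B.
Proof. by apply/matrixP => i j; rewrite !mxE pcompD. Qed.

Lemma pmZ m n (p : mpoly N K) (A : 'M[mpoly N K]_(m, n)) : pm (p *: A) = pcomp h p *: pm A.
Proof. by apply/matrixP => i j; rewrite !mxE pcompM. Qed.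

Lemma pm_sum m n (I : Type) (s : seq I) (Q : pred I) (A : I -> 'M[mpoly N K]_(m, n)) :
  pm (\sum_(i <- s | Q i) A i) = \sum_(i <- s | Q i) pm (A i).
Proof.
apply/matrixP => i j; rewrite !mxE !summxE pcomp_sum.
by apply: eq_bigr => a _; rewrite mxE.
Qed.

Lemma pm_eqm d m n (A B : 'M[mpoly N K]_(m, n)) : (forall i, ordge 1 (h i)) ->
  eqm d A B -> eqm d (pm A) (pm B).
Proof. by move=> h1 H i j; rewrite !mxE -pcompB; apply: ordge_pcomp. Qed.

End SubstMatrix.

Section SubstComp.
Variables (K : comNzRingType) (N k l : nat).

Lemma pcomp_comp (g : 'I_k -> mpoly l K) (h : 'I_N -> mpoly k K) p :
  pcomp g (pcomp h p) = pcomp (fun i => pcomp g (h i)) p.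
Proof.
rewrite [pcomp h p]pcompE [RHS]pcompE pcomp_sum; apply: eq_bigr => a _.
rewrite -mul_mpolyC pcompM pcompC mul_mpolyC; congr (_ *: _).
have pcomp1 : pcomp g 1 = 1 by rewrite -mpolyC1 pcompC mpolyC1.
rewrite (big_morph (pcomp g) (pcompM g) pcomp1); apply: eq_bigr => i _.
by elim: (a i) => [|j IH]; rewrite ?expr0 // !exprS pcompM IH.
Qed.

Lemma pcomp_id (p : mpoly N K) : pcomp (fun i => mpolyX K (mnm1 i)) p = p.
Proof.
rewrite pcompE [RHS]mpolyE; apply: eq_bigr => a _.
by rewrite [mpolyX K a]mpolyXE_id.
Qed.

End SubstComp.

Section CoefDerivation.
Variables (R : realType) (D : Cplx R -> Cplx R).
Hypothesis DD : derivation D.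
Local Notation C := (Cplx R).

Lemma derivation0 : D 0 = 0.
Proof.
case: DD => H _; have := H 0 0; rewrite addr0 => /eqP.
by rewrite -subr_eq subrr eq_sym => /eqP.
Qed.

Lemma derivation_sum (I : Type) (s : seq I) (Q : pred I) (f : I -> C) :
  D (\sum_(i <- s | Q i) f i) = \sum_(i <- s | Q i) D (f i).
Proof. by case: DD => H _; apply: (big_morph D) => //; apply: derivation0. Qed.

Section FixN.
Variable N : nat.
Local Notation P := (mpoly N C).
Implicit Types (p q : P).

Definition Dp (p : P) : P := \sum_(a <- msupp p) D (mcoeff a p) *: mpolyX C a.

Lemma coef_Dp p a : mcoeff a (Dp p) = D (mcoeff a p).
Proof.
rewrite /Dp raddf_sum /=.
pose G b := D (mcoeff b p) * (b == a)%:R.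
rewrite (eq_bigr G) => [|b _]; last by rewrite mcoeffZ mcoeffX.
pose s := undup (a :: msupp p).
rewrite (@sum_msupp _ _ _ G s) ?undup_uniq //; last 2 first.
- by move=> b bp; rewrite mem_undup inE bp orbT.
- by move=> b b0; rewrite /G b0 derivation0 mul0r.
have as_ : a \in s by rewrite mem_undup inE eqxx.
rewrite (bigD1_seq _ as_) ?undup_uniq //= big1 ?addr0 => [|b /negPf ba].
  by rewrite /G eqxx mulr1.
by rewrite /G ba mulr0.
Qed.

Lemma DpD p q : Dp (p + q) = Dp p + Dp q.
Proof.
by case: DD => H _; apply/mpolyP => a; rewrite mcoeffD !coef_Dp mcoeffD H.
Qed.

Lemma Dp0 : Dp 0 = 0.
Proof. by apply/mpolyP => a; rewrite coef_Dp mcoeff0 derivation0. Qed.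

Lemma Dp_sum (I : Type) (s : seq I) (Q : pred I) (f : I -> P) :
  Dp (\sum_(i <- s | Q i) f i) = \sum_(i <- s | Q i) Dp (f i).
Proof. by apply: (big_morph Dp); [apply: DpD|apply: Dp0]. Qed.

Lemma DpB p q : Dp (p - q) = Dp p - Dp q.
Proof.
by have := DpD (p - q) q; rewrite subrK => ->; rewrite addrK.
Qed.

Lemma DpM p q : Dp (p * q) = p * Dp q + Dp p * q.
Proof.
case: DD => H1 H2; apply/mpolyP => a; rewrite mcoeffD coef_Dp !mcoeffM derivation_sum.
rewrite -big_split; apply: eq_bigr => b _ /=.
by rewrite H2 !coef_Dp.
Qed.

Lemma ordge_Dp d p : ordge d p -> ordge d (Dp p).
Proof. by move=> H a ad; rewrite coef_Dp H // derivation0. Qed.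

Lemma Dp_ZX c a : Dp (c *: mpolyX C a) = D c *: mpolyX C a.
Proof.
apply/mpolyP => b; rewrite coef_Dp !mcoeffZ mcoeffX.
by case: eqP; rewrite ?mulr1 // !mulr0 derivation0.
Qed.

End FixN.

#[local] Opaque Dp.

(** The chain rule, when [D] acts on the coefficients of both [q] and [h]. Both
    sides follow the same sum and product rules in [q], so it suffices to compare
    them on constants and variables. *)
Lemma Dp_pcomp N k (h : 'I_N -> mpoly k C) (q : mpoly N C) :
  Dp (pcomp h q) = pcomp h (Dp q) + \sum_l Dp (h l) * pcomp h (mderiv l q).
Proof.
have D1 : D 1 = 0.
  case: DD => _ H; have := H 1 1; rewrite !mulr1 mul1r => /eqP.
  by rewrite -subr_eq subrr eq_sym => /eqP.
have Dp1 n : Dp (1 : mpoly n C) = 0.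
  by have := @Dp_ZX n 1 (@mnm0 n); rewrite D1 scale1r scale0r mpolyX0.
pose ok (q : mpoly N C) := Dp (pcomp h q) = pcomp h (Dp q) + \sum_l Dp (h l) * pcomp h (mderiv l q).
have okD q1 q2 : ok q1 -> ok q2 -> ok (q1 + q2).
  rewrite /ok => E1 E2.
  have -> : pcomp h (q1 + q2) = pcomp h q1 + pcomp h q2 := pcompD _ _ _.
  have -> : Dp (pcomp h q1 + pcomp h q2) = Dp (pcomp h q1) + Dp (pcomp h q2) := DpD _ _.
  have -> : Dp (q1 + q2) = Dp q1 + Dp q2 := DpD _ _.
  have -> : pcomp h (Dp q1 + Dp q2) = pcomp h (Dp q1) + pcomp h (Dp q2) := pcompD _ _ _.
  have -> : \sum_l Dp (h l) * pcomp h (mderiv l (q1 + q2)) =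
      \sum_l Dp (h l) * pcomp h (mderiv l q1) + \sum_l Dp (h l) * pcomp h (mderiv l q2).
    rewrite -big_split; apply: eq_bigr => l _ /=.
    by rewrite (mderivD l q1 q2) (pcompD h (mderiv l q1)) mulrDr.
  exact: etrans (f_equal2 +%R E1 E2) (addrACA _ _ _ _).
have okM q1 q2 : ok q1 -> ok q2 -> ok (q1 * q2).
  rewrite /ok => E1 E2.
  have -> : pcomp h (q1 * q2) = pcomp h q1 * pcomp h q2 := pcompM _ _ _.
  have -> : Dp (pcomp h q1 * pcomp h q2) =
    pcomp h q1 * Dp (pcomp h q2) + Dp (pcomp h q1) * pcomp h q2 := DpM _ _.
  have -> : Dp (q1 * q2) = q1 * Dp q2 + Dp q1 * q2 := DpM _ _.
  have -> : pcomp h (q1 * Dp q2 + Dp q1 * q2) =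
      pcomp h q1 * pcomp h (Dp q2) + pcomp h (Dp q1) * pcomp h q2.
    by rewrite (pcompD h (q1 * Dp q2)) (pcompM h q1) (pcompM h (Dp q1)).
  have -> : \sum_l Dp (h l) * pcomp h (mderiv l (q1 * q2)) =
      pcomp h q1 * (\sum_l Dp (h l) * pcomp h (mderiv l q2)) +
      (\sum_l Dp (h l) * pcomp h (mderiv l q1)) * pcomp h q2.
    rewrite mulr_suml mulr_sumr -big_split; apply: eq_bigr => l _ /=.
    have alg (d a1 b2 b1 a2 : mpoly k C) : d * (a1 * b2 + b1 * a2) = b1 * (d * a2) + d * a1 * b2.
      by ring.
    have E := etrans (f_equal (pcomp h) (mderivM l q1 q2))
      (etrans (pcompD _ _ _) (f_equal2 +%R (pcompM _ _ _) (pcompM _ _ _))).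
    exact: etrans (f_equal ( *%R (Dp (h l))) E) (alg _ _ _ _ _).
  have alg (b1 b2 a1 a2 s1 s2 : mpoly k C) :
    b1 * (a2 + s2) + (a1 + s1) * b2 = b1 * a2 + a1 * b2 + (b1 * s2 + s1 * b2) by ring.
  exact: etrans (f_equal2 +%R (f_equal ( *%R (pcomp h q1)) E2)
    (f_equal ( *%R^~ (pcomp h q2)) E1)) (alg _ _ _ _ _ _).
have pc0 : pcomp h 0 = 0 by rewrite -mpolyC0 pcompC mpolyC0.
have okC c : ok (mpolyC N c).
  rewrite /ok pcompC big1 ?addr0 => [|l _]; last by rewrite mderivC pc0 mulr0.
  have DC n : Dp (mpolyC n c) = mpolyC n (D c).
    apply/mpolyP => a; rewrite coef_Dp !mcoeffC.
    by case: eqP; rewrite ?mulr1 // !mulr0 derivation0.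
  by rewrite !DC pcompC.
have okX i : ok (mpolyX C (mnm1 i)).
  rewrite /ok pcompXU.
  have -> : Dp (mpolyX C (mnm1 i)) = 0.
    by have := @Dp_ZX N 1 (mnm1 i); rewrite D1 scale1r scale0r.
  rewrite pc0 add0r (bigD1 i) //= big1 ?addr0 => [|l /negPf li].
    rewrite mderivX mnm1E eqxx scale1r (_ : mnm_sub _ _ = @mnm0 N).
      by rewrite mpolyX0 -mpolyC1 pcompC mpolyC1 mulr1.
    by apply/mnmP => j; rewrite mnmBE mnm0E subnn.
  by rewrite mderivX mnm1E eq_sym li scale0r pc0 mulr0.
have ok1 : ok 1 by rewrite -mpolyC1; apply: okC.
change (ok q); rewrite (mpolyE q).
have ok0 : ok 0 by have := okC 0; rewrite mpolyC0.
apply: (big_ind ok); [exact: ok0|exact: okD|move=> a _].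
rewrite -mul_mpolyC; apply: (okM _ _ (okC _)).
rewrite mpolyXE_id; apply: (big_ind ok); [exact: ok1|exact: okM|move=> i _].
elim: (a i) => [|j IH]; first by rewrite expr0; exact: ok1.
by rewrite exprS; exact: (okM _ _ (okX i) IH).
Qed.

End CoefDerivation.
Arguments Dp {R} D {N} p.

Section Transfer.
Variables (K : fieldType) (N m n s : nat).
Local Notation P := (mpoly N K).
Local Notation MM := ('M[P]_(m, n)).
Variables (p : MM) (b l : 'M[P]_m) (sm s' : 'M[P]_n) (h kk : 'I_N -> P).
Hypotheses (h1 : forall i, ordge 1 (h i)) (k1 : forall i, ordge 1 (kk i)).
Hypothesis lb : eqm s.+1 (l *m b) 1%:M.
Hypothesis ss : eqm s.+1 (sm *m s') 1%:M.
Hypothesis hk : forall i, ordge s.+1 (pcomp kk (h i) - mpolyX K (mnm1 i)).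
Local Notation pm f A := (map_mx (pcomp f) A).
(* The forms of degree [s] are tangent at [b (p o h) sm]. *)
Hypothesis V : forall a i j, mdeg a = s -> exists (be : 'M[P]_m) (u : 'I_N -> P) (ga : 'M[P]_n),
  eqm s.+1 (Emx K a i j) (be *m pm h p *m sm
     + \sum_x u x *: (b *m pm h (dmx x p) *m sm) + b *m pm h p *m ga).

(* [M] becomes a tangent vector at [p o h] after multiplication by the inverses
   of [b] and [sm]. *)
Let good (M : MM) := exists (be : 'M[P]_m) (u : 'I_N -> P) (ga : 'M[P]_n),
  eqm s.+1 (l *m M *m s') (be *m pm h p + \sum_x u x *: pm h (dmx x p) + pm h p *m ga).

Let good0 M : ordmx s.+1 M -> good M.
Proof.
move=> HM; exists 0, (fun=> 0), 0; rewrite mul0mx mulmx0 addr0 big1 ?addr0.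
  have H0 : eqm s.+1 M 0 by move=> i j; rewrite mxE subr0.
  have := eqmM (eqmM (eqm_refl s.+1 l) H0) (eqm_refl s.+1 s').
  by rewrite mulmx0 mul0mx.
by move=> x _; rewrite scale0r.
Qed.

Let goodD M M' : good M -> good M' -> good (M + M').
Proof.
move=> [be [u [ga H]]] [be' [u' [ga' H']]].
exists (be + be'), (fun x => u x + u' x), (ga + ga').
rewrite mulmxDr mulmxDl; apply: eqm_trans (eqmD H H') _.
rewrite mulmxDl mulmxDr.
have -> : \sum_x (u x + u' x) *: pm h (dmx x p) =
   \sum_x u x *: pm h (dmx x p) + \sum_x u' x *: pm h (dmx x p).
  by rewrite -big_split; apply: eq_bigr => x _; rewrite scalerDl.
by rewrite addrACA [X in X + _]addrACA; apply: eqm_refl.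
Qed.

Let goodZ (q : P) M : good M -> good (q *: M).
Proof.
move=> [be [u [ga H]]]; exists (q *: be), (fun x => q * u x), (q *: ga).
have -> : l *m (q *: M) *m s' = q *: (l *m M *m s') by rewrite -scalemxAr -scalemxAl.
have -> : (q *: be) *m pm h p + \sum_x (q * u x) *: pm h (dmx x p) + pm h p *m (q *: ga)
    = q *: (be *m pm h p + \sum_x u x *: pm h (dmx x p) + pm h p *m ga).
  have Es : \sum_x (q * u x) *: pm h (dmx x p) = q *: (\sum_x u x *: pm h (dmx x p)).
    by rewrite scaler_sumr; apply: eq_bigr => x _; rewrite scalerA.
  by rewrite Es scalerDr scalerDr (scalemxAl q be) (scalemxAr q (pm h p) ga).
exact: eqmZ.
Qed.

Let goodV a i j : mdeg a = s -> good (Emx K a i j).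
Proof.
move=> /(V i j)[be [u [ga H]]].
exists (l *m be), u, (ga *m s').
apply: eqm_trans (eqmM (eqmM (eqm_refl _ l) H) (eqm_refl _ s')) _.
rewrite !mulmxDr !mulmxDl; apply: eqmD; first apply: eqmD.
- rewrite !mulmxA -(mulmxA (l *m be *m _)).
  by have := eqmM (eqm_refl s.+1 (l *m be *m pm h p)) ss; rewrite mulmx1.
- rewrite mulmx_sumr mulmx_suml; apply: eqm_sum => x _.
  rewrite -scalemxAr -scalemxAl; apply: eqmZ.
  rewrite !mulmxA -(mulmxA (l *m b *m _)).
  have := eqmM (eqmM lb (eqm_refl s.+1 (pm h (dmx x p)))) ss.
  by rewrite mul1mx mulmx1.
- have := eqmM (eqmM lb (eqm_refl s.+1 (pm h p))) (eqm_refl s.+1 (ga *m s')).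
  by rewrite mul1mx !mulmxA.
Qed.

Let good_sum I (r : seq I) (Q : pred I) (A : I -> MM) :
  (forall x, Q x -> good (A x)) -> good (\sum_(x <- r | Q x) A x).
Proof. by move=> H; apply: (big_ind good) => //; apply/good0/ordmx0. Qed.

Let good_ord M : ordmx s M -> good M.
Proof.
move=> HM; rewrite (mx_monomials M).
apply: good_sum => i _; apply: good_sum => j _; rewrite big_seq; apply: good_sum => a.
move=> /(ordge_supp (HM i j)); rewrite leq_eqVlt => /orP[/eqP sa|sa].
  by apply: goodZ; apply: goodV.
apply: good0 => x y; rewrite !mxE; apply: ordgeMl; apply: ordgeMr.
by apply: ordgeW sa _; apply: ordgeX.
Qed.

(** The image [b (x^a e_ij o h) sm] of [x^a e_ij] under the coordinate changes has
    order [s], hence is a tangent vector at [b (p o h) sm] by [V]; undoing the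
    coordinate changes gives a tangent vector at [p]. *)
Lemma tangent_transfer a i j : mdeg a = s ->
  exists2 T, Tp p T & ordmx s.+1 (Emx K a i j - T).
Proof.
move=> sa; have HE : ordmx s (Emx K a i j).
  by move=> x y; rewrite !mxE; apply: ordgeMr; rewrite -sa; apply: ordgeX.
pose v := b *m pm h (Emx K a i j) *m sm.
have Hv : ordmx s v.
  move=> x y; rewrite mxE; apply: ordge_sum => z _; apply: ordgeMr.
  rewrite mxE; apply: ordge_sum => t _; apply: ordgeMl.
  by rewrite mxE; apply: ordge_pcomp.
have [be [u [ga H]]] := good_ord Hv.
have Hl : eqm s.+1 (l *m v *m s') (pm h (Emx K a i j)).
  rewrite /v !mulmxA -(mulmxA (l *m b *m _)).
  have := eqmM (eqmM lb (eqm_refl s.+1 (pm h (Emx K a i j)))) ss.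
  by rewrite mul1mx mulmx1.
(* [kk] is an inverse of [h] up to the order that matters. *)
have back (A : MM) : eqm s.+1 (pm kk (pm h A)) A.
  move=> x y; rewrite !mxE pcomp_comp -[A x y in X in _ - X]pcomp_id.
  exact: pcomp_cong.
have := eqm_trans (eqm_sym (back (Emx K a i j)))
   (pm_eqm k1 (eqm_trans (eqm_sym Hl) H)).
move=> /eqm_eqr H2'; have H2 := H2' _ (etrans (pmD kk _ _) (f_equal2 +%R (etrans (pmD kk _ _)
  (f_equal2 +%R (pmM kk _ _) (pm_sum kk _ _ _))) (pmM kk _ _))).
exists (\sum_x pcomp kk (u x) *: dmx x p + pm kk be *m p + p *m pm kk ga).
  by exists (fun x => pcomp kk (u x)), (pm kk be), (pm kk ga).
suff H3 : eqm s.+1 (Emx K a i j)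
    (\sum_x pcomp kk (u x) *: dmx x p + pm kk be *m p + p *m pm kk ga).
  by move=> x y; have := H3 x y; rewrite !mxE.
apply: eqm_trans H2 _; rewrite [X in eqm _ (X + _) _]addrC.
apply: eqmD; first apply: eqmD.
- by apply: eqm_sum => x _; rewrite pmZ; apply: eqmZ; apply: back.
- by apply: eqmM; [apply: eqm_refl|apply: back].
- by apply: eqmM; [apply: back|apply: eqm_refl].
Qed.

End Transfer.

(** * Determined germs: the tangent module contains high-order matrices *)

Section Necessity.
Variables (R : realType) (N m n : nat).
Local Notation C := (Cplx R).
Local Notation P := (mpoly N C).
Local Notation MM := ('M[P]_(m, n)).
Local Notation ev x p := (meval (fun i => x 0 i) p).

Definition evmx (x : 'rV[C]_N) m n (A : 'M[P]_(m, n)) : 'M[C]_(m, n) :=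
  map_mx (fun q => ev x q) A.

Lemma evmxM x k l s (A : 'M[P]_(k, l)) (B : 'M[P]_(l, s)) :
  evmx x (A *m B) = evmx x A *m evmx x B.
Proof.
apply/matrixP => i j; rewrite !mxE raddf_sum; apply: eq_bigr => a _ /=.
by rewrite mevalM !mxE.
Qed.

Lemma evmxD x k l (A B : 'M[P]_(k, l)) : evmx x (A + B) = evmx x A + evmx x B.
Proof. by apply/matrixP => i j; rewrite !mxE mevalD. Qed.

Lemma appr_unique d (q q' : nat -> P) (f g : 'rV[C]_N -> C) :
  appr q f -> appr q' g -> near0 (fun x => f x = g x) -> ordge d.+1 (q d - q' d).
Proof. by move=> [r [M A]] [r' [M' B]] E; apply: approx_unique A B E d. Qed.

(** [Q d] agrees with the Taylor expansion of [A] up to degree [d]. *)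
Definition apprmx k l (Q : nat -> 'M[P]_(k, l)) (A : 'rV[C]_N -> 'M[C]_(k, l)) :=
  forall i j, appr (fun d => Q d i j) (fun x => A x i j).

Lemma analytic_apprmx k l (A : 'rV[C]_N -> 'M[C]_(k, l)) : analytic_germ_mx A ->
  exists Q, apprmx Q A.
Proof.
move=> H.
have /choice[q Hq] : forall t : 'I_k * 'I_l, exists q, appr q (fun x => A x t.1 t.2).
  by move=> t; apply/analyticP; apply: H.
exists (fun d => \matrix_(i, j) q (i, j) d) => i j.
have -> : (fun d => (\matrix_(i, j) q (i, j) d) i j) = q (i, j).
  by apply: funext => d; rewrite mxE.
exact: (Hq (i, j)).
Qed.

Lemma apprmxM k l s (Q : nat -> 'M[P]_(k, l)) (Q' : nat -> 'M[P]_(l, s)) A B :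
  apprmx Q A -> apprmx Q' B -> apprmx (fun d => Q d *m Q' d) (fun x => A x *m B x).
Proof.
move=> H H' i j.
have -> : (fun d => (Q d *m Q' d) i j) = (fun d => \sum_a Q d i a * Q' d a j).
  by apply: funext => d; rewrite mxE.
have -> : (fun x => (A x *m B x) i j) = (fun x => \sum_a A x i a * B x a j).
  by apply: funext => d; rewrite mxE.
by apply: appr_sum => a _; apply: apprM.
Qed.

Lemma apprmx_poly k l (A : 'M[P]_(k, l)) : apprmx (fun=> A) (fun x => evmx x A).
Proof.
move=> i j; have -> : (fun x => evmx x A i j) = (fun x => ev x (A i j)).
  by apply: funext => x; rewrite mxE.
exact: appr_poly.
Qed.

Lemma apprmx_unique d k l (Q Q' : nat -> 'M[P]_(k, l)) A B :
  apprmx Q A -> apprmx Q' B -> near0 (fun x => A x = B x) -> eqm d.+1 (Q d) (Q' d).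
Proof.
move=> H H' E i j; apply: (@appr_unique d _ _ _ _ (H i j) (H' i j)).
by apply: near0_mono E => x ->.
Qed.

End Necessity.

Section DetTangent.
Variables (R : realType) (N m n : nat).
Local Notation C := (Cplx R).
Local Notation P := (mpoly N C).
Local Notation MM := ('M[P]_(m, n)).
Local Notation ev x p := (meval (fun i => x 0 i) p).
Local Notation pm f A := (map_mx (pcomp f) A).
Local Notation Dm D A := (map_mx (Dp D) A).

Lemma add_flip (V : zmodType) (x y z : V) : x + y + z = z + y + x.
Proof. by rewrite addrC (addrC x) addrA. Qed.

Lemma DmM D (DD : derivation D) k l s (A : 'M[P]_(k, l)) (B : 'M[P]_(l, s)) :
  Dm D (A *m B) = A *m Dm D B + Dm D A *m B.
Proof.
apply/matrixP => i j; rewrite !mxE Dp_sum // -big_split; apply: eq_bigr => a _ /=.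
by rewrite !mxE; exact: DpM.
Qed.

Lemma Dm_eqm D (DD : derivation D) d k l (A B : 'M[P]_(k, l)) : eqm d A B ->
  eqm d (Dm D A) (Dm D B).
Proof. by move=> H i j; rewrite !mxE -DpB //; apply: ordge_Dp. Qed.

(** A jet identity [p + sum_t c_t E_t = b (p o h) sm] in which the [c_t] are
    independent over the coefficients of [p]: differentiating it with respect
    to [c_t] exhibits [E_t] as a tangent vector. *)
Lemma differentiate_jet s (p : MM) (b : 'M[P]_m) (sm : 'M[P]_n) (h : 'I_N -> P)
    (J : finType) (E : J -> MM) (c : J -> C) (t0 : J) D :
  derivation D -> (forall i j a, D (mcoeff a (p i j)) = 0) ->
  (forall t i j a, exists k : nat, mcoeff a (E t i j) = k%:R) ->
  (forall t, D (c t) = (t == t0)%:R) ->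
  eqm s.+1 (p + \sum_t mpolyC N (c t) *: E t) (b *m pm h p *m sm) ->
  exists (be : 'M[P]_m) (u : 'I_N -> P) (ga : 'M[P]_n),
  eqm s.+1 (E t0) (be *m pm h p *m sm
     + \sum_x u x *: (b *m pm h (dmx x p) *m sm) + b *m pm h p *m ga).
Proof.
move=> DD Dpc En Dc H.
have D1 : D 1 = 0.
  case: DD => _ H1; have := H1 1 1; rewrite !mulr1 mul1r => /eqP.
  by rewrite -subr_eq subrr eq_sym => /eqP.
have Dn k : D k%:R = 0.
  elim: k => [|k IH]; first by rewrite derivation0.
  by rewrite -natr1; case: DD => -> _; rewrite IH D1 addr0.
have DE t : Dm D (E t) = 0.
  apply/matrixP => i j; rewrite !mxE; apply/mpolyP => a.
  by rewrite coef_Dp // mcoeff0; have [k ->] := En t i j a.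
have Dp0m : Dm D p = 0.
  by apply/matrixP => i j; rewrite !mxE; apply/mpolyP => a; rewrite coef_Dp // mcoeff0.
have DcE t : Dm D (mpolyC N (c t) *: E t) = mpolyC N (D (c t)) *: E t.
  apply/matrixP => i j.
  rewrite mxE.
  rewrite [X in Dp D X]mxE.
  rewrite [RHS]mxE.
  have E1 : Dp D (E t i j) = 0 by have := congr1 (fun A : MM => A i j) (DE t); rewrite !mxE.
  have E2 : Dp D (mpolyC N (c t)) = mpolyC N (D (c t)).
    apply/mpolyP => a; rewrite coef_Dp // !mcoeffC.
    by case: eqP; rewrite ?mulr1 // !mulr0 derivation0.
  have alg (x y z : P) : x * 0 + y * z = y * z by rewrite mulr0 add0r.
  exact: etrans (DpM DD _ _) (etrans (f_equal2 +%R (f_equal ( *%R _) E1)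
    (f_equal ( *%R^~ _) E2)) (alg _ _ _)).
have LHS : Dm D (p + \sum_t mpolyC N (c t) *: E t) = E t0.
  transitivity (Dm D p + \sum_t Dm D (mpolyC N (c t) *: E t)).
    apply/matrixP => i j; rewrite !mxE DpD // !summxE Dp_sum //; congr (_ + _).
    by apply: eq_bigr => t _; rewrite [RHS]mxE.
  rewrite Dp0m add0r (bigD1 t0) //= big1 ?addr0 => [|t /negPf tt0].
    by rewrite DcE Dc eqxx mpolyC1 scale1r.
  by rewrite DcE Dc tt0 mpolyC0 scale0r.
have Dchain : Dm D (pm h p) = \sum_x Dp D (h x) *: pm h (dmx x p).
  apply/matrixP => i j; rewrite !mxE Dp_pcomp // summxE.
  have -> : Dp D (p i j) = 0.
    by have := congr1 (fun A : MM => A i j) Dp0m; rewrite !mxE.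
  have -> : pcomp h 0 = 0 by rewrite -mpolyC0 pcompC mpolyC0.
  by rewrite add0r; apply: eq_bigr => x _; rewrite !mxE.
exists (Dm D b), (fun x => Dp D (h x)), (Dm D sm).
have := Dm_eqm DD H; rewrite LHS => H'; apply: eqm_trans H' _.
rewrite !DmM // Dchain mulmxDl addrC.
rewrite mulmx_sumr mulmx_suml addrAC [X in eqm _ (X + _) _]addrC.
rewrite [X in eqm _ X _](_ : _ = Dm D b *m pm h p *m sm +
  \sum_x Dp D (h x) *: (b *m pm h (dmx x p) *m sm) + b *m pm h p *m Dm D sm); first exact: eqm_refl.
have -> : \sum_x b *m (Dp D (h x) *: pm h (dmx x p)) *m sm =
    \sum_x Dp D (h x) *: (b *m pm h (dmx x p) *m sm).
  by apply: eq_bigr => x _; rewrite -scalemxAr -scalemxAl.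
exact: add_flip.
Qed.

End DetTangent.

Section Determined.
Variables (R : realType) (N m n : nat).
Local Notation C := (Cplx R).
Local Notation P := (mpoly N C).
Local Notation MM := ('M[P]_(m, n)).
Local Notation ev x p := (meval (fun i => x 0 i) p).

(** The perturbation of [F] by generic constant multiples of all the monomial
    matrices [E_t] of degree [r+1] has the same [r]-jet, hence is equivalent to
    [F]; the resulting identity of jets of order [r+1] is differentiated with
    respect to each of the constants. *)
Theorem determined_tangent (F : 'rV[C]_N -> 'M[C]_(m, n)) (p : MM) r :
  near0 (fun x => F x = evmx x p) -> G_determined r F ->
  forall a i j, mdeg a = r.+1 -> exists2 T, Tp p T & ordmx r.+2 (Emx C a i j - T).
Proof.
move=> Fp det.
(* All monomials of degree at most [r+1] index the perturbation; [E] discards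
   those of lower degree. *)
pose J := (bmultinom N r.+2 * 'I_m * 'I_n)%type.
pose E (t : J) : MM := if mdeg (bmnm t.1.1) == r.+1 then Emx C (bmnm t.1.1) t.1.2 t.2 else 0.
pose coefs := flatten [seq [seq mcoeff a (p t.1 t.2) | a <- msupp (p t.1 t.2)] |
  t <- enum (('I_m * 'I_n)%type : finType)].
have [c0 Hc0] := generic_derivations coefs #|{: J}|.
pose c (t : J) := c0 (enum_rank t).
pose p' := p + \sum_t mpolyC N (c t) *: E t.
have p'p i j : ordge r.+1 (p' i j - p i j).
  rewrite mxE addrC addKr summxE; apply: ordge_sum => t _; rewrite mxE; apply: ordgeMl.
  rewrite /E; case: eqP => [tr|_]; last by rewrite mxE; apply: ordge_0.
  by rewrite !mxE; apply: ordgeMr => b; rewrite mcoeffX; case: eqP => // <-; rewrite tr ltnn.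
have Fij i j : appr (fun=> p i j) (fun x => F x i j).
  apply: appr_near (appr_poly (p i j)); apply: near0_mono Fp => x ->.
  by rewrite mxE.
have [h [S [L [[hA h0 [k [kA k0 kh hk]]] [SA [S' [S'A SS' _]]] [LA [B [BA LB BL]]] eqF]]]] :
    G_equivalent (fun x => evmx x p') F.
  apply: det.
    by move=> i j; under eq_fun do rewrite mxE; apply: an_poly.
  move=> a ar i j; have [cc cc0 Hcc] := mpartial_coef R a.
  have [r1 [M1 A1]] := Fij i j.
  have [r2 [M2 A2]] : appr (fun=> p' i j) (fun x => evmx x p' i j).
    exact: (apprmx_poly p' i j).
  rewrite (Hcc _ _ _ _ A1 _ ar) (Hcc _ _ _ _ A2 _ ar).
  congr (_ *+ _); apply/eqP; rewrite -subr_eq0 -mcoeffB.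
  by apply/eqP/(p'p i j a).
have [hq Hh] := analytic_apprmx hA.
have [kq Hk] := analytic_apprmx kA.
have [Lq HL] := analytic_apprmx LA.
have [Bq HB] := analytic_apprmx BA.
have [Sq HS] := analytic_apprmx SA.
have [S'q HS'] := analytic_apprmx S'A.
pose e := r.+1.
have hrow x : \row_i h x 0 i = h x by apply/rowP => i; rewrite mxE.
have krow x : \row_i k x 0 i = k x by apply/rowP => i; rewrite mxE.
have h00 i : h 0 0 i = 0 by rewrite h0 mxE.
have k00 i : k 0 0 i = 0 by rewrite k0 mxE.
have Hph : apprmx (fun d => map_mx (pcomp (fun i => hq d 0 i)) p) (fun x => evmx (h x) p).
  move=> i j; have -> : (fun d => (map_mx (pcomp (fun i => hq d 0 i)) p) i j) =
      (fun d => pcomp (fun i => hq d 0 i) (p i j)) by apply: funext => d; rewrite mxE.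
  have -> : (fun x => evmx (h x) p i j) = (fun x => ev (\row_i h x 0 i) (p i j)).
    by apply: funext => x; rewrite mxE hrow.
  exact: (appr_comp (appr_poly (p i j)) (Hh 0) h00).
(* [B] is the inverse of [L], which spares inverting a matrix of polynomials. *)
have eqF' : near0 (fun x => evmx x p' = B x *m evmx (h x) p *m S x).
  have Fh : near0 (fun x => F (h x) = evmx (h x) p).
    have := near0_comp Fp (fun i => hA 0 i) h00.
    by apply: near0_mono => x; rewrite hrow.
  apply: near0_mono (near0_and (near0_and eqF LB) Fh) => x [[-> LBx] ->].
  congr (_ *m _ *m _).
  have [uL] := mulmx1_unit LBx.
  by rewrite -[RHS]mul1mx -(mulVmx uL) -mulmxA LBx mulmx1.
have jet1 : eqm e.+1 p' (Bq e *m map_mx (pcomp (fun i => hq e 0 i)) p *m Sq e).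
  apply: (apprmx_unique (Q := fun=> p')
    (Q' := fun d => Bq d *m map_mx (pcomp (fun i => hq d 0 i)) p *m Sq d) _ _ eqF').
    exact: apprmx_poly.
  exact: (apprmxM (apprmxM HB Hph) HS).
have one k' : apprmx (fun=> 1%:M : 'M[P]_k') (fun=> 1%:M).
  move=> i j; have -> : (fun=> (1%:M : 'M[P]_k') i j) = (fun=> mpolyC N ((i == j)%:R)).
    by move=> T; apply: funext => d; rewrite mxE; case: eqP; rewrite ?mpolyC1 ?mpolyC0.
  have -> : (fun=> (1%:M : 'M[C]_k') i j) = (fun=> (i == j)%:R).
    by move=> T; apply: funext => d; rewrite mxE.
  exact: appr_c.
have jet2 : eqm e.+1 (Lq e *m Bq e) 1%:M.
  by apply: (apprmx_unique (apprmxM HL HB) (one m)).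
have jet3 : eqm e.+1 (Sq e *m S'q e) 1%:M.
  by apply: (apprmx_unique (apprmxM HS HS') (one n)).
have jet4 i : ordge e.+1 (pcomp (fun j => kq e 0 j) (hq e 0 i) - mpolyX C (mnm1 i)).
  have Hhk : appr (fun d => pcomp (fun j => kq d 0 j) (hq d 0 i)) (fun x => h (k x) 0 i).
    have -> : (fun x => h (k x) 0 i) = (fun x => h (\row_j k x 0 j) 0 i).
      by apply: funext => x; rewrite krow.
    exact: (appr_comp (Hh 0 i) (Hk 0) k00).
  apply: (@appr_unique R N e _ (fun=> mpolyX C (mnm1 i)) _ _ Hhk (appr_coord R i)).
  by apply: near0_mono hk => x ->.
have h1 i : ordge 1 (hq e 0 i) by apply/ordge1_coef; rewrite -(appr_val0 e (Hh 0 i)).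
have k1 i : ordge 1 (kq e 0 i) by apply/ordge1_coef; rewrite -(appr_val0 e (Hk 0 i)).
apply: (tangent_transfer h1 k1 jet2 jet3 jet4) => a i j ar.
have ar' : (mdeg a < r.+2)%N by rewrite ar.
pose t0 : J := (BMultinom ar', i, j).
have Et0 : E t0 = Emx C a i j by rewrite /E /= ar eqxx.
have [D [DD Ds Dc]] := Hc0 (fun x => (x == enum_rank t0)%:R).
rewrite -Et0; apply: (differentiate_jet (c := c) DD) jet1.
- move=> i' j' b; have [bp|/memN_msupp_eq0 ->] := boolP (b \in msupp (p i' j')); last first.
    exact: derivation0.
  apply: Ds; apply/flattenP; exists [seq mcoeff a (p i' j') | a <- msupp (p i' j')].
    by apply/mapP; exists (i', j') => //; rewrite mem_enum.
  by apply/mapP; exists b.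
- move=> t i' j' b; rewrite /E; case: ifP => _; last by exists 0%N; rewrite mxE mcoeff0.
  rewrite !mxE; case: (_ && _); last by exists 0%N; rewrite mulr0 mcoeff0.
  by exists (bmnm t.1.1 == b); rewrite mulr1 mcoeffX.
- move=> t; rewrite /c Dc ?ltn_ord //; congr ((_ : bool)%:R).
  by rewrite (inj_eq val_inj) (inj_eq enum_rank_inj).
Qed.

End Determined.

(** * Squares of ideals and Taylor's formula *)

Section IdealSquare.
Variables (A : comNzRingType) (I : finType) (g : I -> A).

(** Membership in the ideal generated by the [g i], and in its square. *)
Definition inI (f : A) := exists l : I -> A, f = \sum_i g i * l i.
Definition inI2 (f : A) := exists q : I -> I -> A, f = \sum_i \sum_j g i * g j * q i j.

Lemma inI0 : inI 0.
Proof. by exists (fun=> 0); rewrite big1 // => i _; rewrite mulr0. Qed.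

Lemma inI_gen i : inI (g i).
Proof.
exists (fun j => (j == i)%:R); rewrite (bigD1 i) //= eqxx mulr1 big1 ?addr0 //.
by move=> j /negPf->; rewrite mulr0.
Qed.

Lemma inID f f' : inI f -> inI f' -> inI (f + f').
Proof.
move=> [l ->] [l' ->]; exists (fun i => l i + l' i).
by rewrite -big_split; apply: eq_bigr => i _; rewrite mulrDr.
Qed.

Lemma inIMr f c : inI f -> inI (f * c).
Proof.
move=> [l ->]; exists (fun i => l i * c).
by rewrite mulr_suml; apply: eq_bigr => i _; rewrite mulrA.
Qed.

Lemma inI_sum (J : Type) (s : seq J) (Q : pred J) (F : J -> A) :
  (forall i, Q i -> inI (F i)) -> inI (\sum_(i <- s | Q i) F i).
Proof. by move=> H; apply: big_ind => //; [apply: inI0|apply: inID]. Qed.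

Lemma inI20 : inI2 0.
Proof. by exists (fun _ _ => 0); rewrite big1 // => i _; rewrite big1 // => j _; rewrite mulr0. Qed.

Lemma inI2D f f' : inI2 f -> inI2 f' -> inI2 (f + f').
Proof.
move=> [l ->] [l' ->]; exists (fun i j => l i j + l' i j).
rewrite -big_split; apply: eq_bigr => i _; rewrite -big_split; apply: eq_bigr => j _.
by rewrite mulrDr.
Qed.

Lemma inI2Mr f c : inI2 f -> inI2 (f * c).
Proof.
move=> [l ->]; exists (fun i j => l i j * c).
rewrite mulr_suml; apply: eq_bigr => i _; rewrite mulr_suml; apply: eq_bigr => j _.
by rewrite mulrA.
Qed.

Lemma inI2Ml f c : inI2 f -> inI2 (c * f).
Proof. by rewrite mulrC; apply: inI2Mr. Qed.

Lemma inI2_sum (J : Type) (s : seq J) (Q : pred J) (F : J -> A) :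
  (forall i, Q i -> inI2 (F i)) -> inI2 (\sum_(i <- s | Q i) F i).
Proof. by move=> H; apply: big_ind => //; [apply: inI20|apply: inI2D]. Qed.

Lemma inIM f f' : inI f -> inI f' -> inI2 (f * f').
Proof.
move=> [l ->] [l' ->]; exists (fun i j => l i * l' j).
rewrite mulr_suml; apply: eq_bigr => i _; rewrite mulr_sumr; apply: eq_bigr => j _.
exact: mulrACA.
Qed.

Lemma inI2I f : inI2 f -> inI f.
Proof.
move=> [q ->]; apply: inI_sum => i _; apply: inI_sum => j _.
by rewrite -mulrA; apply: inIMr; apply: inI_gen.
Qed.

Section Matrices.

Definition mxI m n (M : 'M[A]_(m, n)) := forall i j, inI (M i j).
Definition mxI2 m n (M : 'M[A]_(m, n)) := forall i j, inI2 (M i j).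

Lemma mxI2D m n (M M' : 'M[A]_(m, n)) : mxI2 M -> mxI2 M' -> mxI2 (M + M').
Proof. by move=> H H' i j; rewrite mxE; apply: inI2D. Qed.

Lemma mxID m n (M M' : 'M[A]_(m, n)) : mxI M -> mxI M' -> mxI (M + M').
Proof. by move=> H H' i j; rewrite mxE; apply: inID. Qed.

Lemma mxI2I m n (M : 'M[A]_(m, n)) : mxI2 M -> mxI M.
Proof. by move=> H i j; apply: inI2I. Qed.

Lemma mxIM m n k (M : 'M[A]_(m, n)) (M' : 'M[A]_(n, k)) : mxI M -> mxI M' -> mxI2 (M *m M').
Proof. by move=> H H' i j; rewrite mxE; apply: inI2_sum => l _; apply: inIM. Qed.

Lemma mxIMr m n k (M : 'M[A]_(m, n)) (M' : 'M[A]_(n, k)) : mxI M -> mxI (M *m M').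
Proof. by move=> H i j; rewrite mxE; apply: inI_sum => l _; apply: inIMr. Qed.

(** With [Z = D + Q], the remainder is [Q] plus products involving two of the
    matrices [B], [Z], [C]. *)
Lemma mxI2_product m n (B : 'M[A]_m) (Cc : 'M[A]_n) (E D Q : 'M[A]_(m, n)) :
  mxI B -> mxI Cc -> mxI D -> mxI2 Q ->
  mxI2 ((1%:M + B) *m (E + D + Q) *m (1%:M + Cc) - E - (D + B *m E + E *m Cc)).
Proof.
move=> HB HC HD HQ; set Z := D + Q.
have HZ : mxI Z by apply: mxID HD (mxI2I HQ).
have -> : (1%:M + B) *m (E + D + Q) *m (1%:M + Cc) - E - (D + B *m E + E *m Cc) =
    Q + Z *m Cc + B *m Z + (B *m (E + Z)) *m Cc.
  have -> : (1%:M + B) *m (E + D + Q) *m (1%:M + Cc) =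
      E + Z + (B *m E + B *m Z) + (E *m Cc + Z *m Cc + B *m (E + Z) *m Cc).
    by rewrite -addrA -/Z mulmxDr mulmx1 [(1%:M + B) *m _]mulmxDl mul1mx !mulmxDl -mulmxDl -mulmxDr.
  rewrite /Z; move: (B *m E) (B *m _) (E *m Cc) (_ *m Cc) (B *m _ *m Cc) => BE BZ EC ZC W.
  by apply/matrixP => i j; rewrite !mxE; ring.
apply: mxI2D; [apply: mxI2D; [apply: mxI2D|]|]; [exact: HQ|exact: mxIM|exact: mxIM|].
by apply: mxIM => //; apply: mxIMr.
Qed.

End Matrices.
End IdealSquare.

Section Taylor.
Variables (K : comNzRingType) (N k : nat) (I : finType) (g : I -> mpoly k K).
Variables (xs u : 'I_N -> mpoly k K).
Hypothesis uI : forall i, inI g (u i).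

Definition lin1 (p : mpoly N K) := \sum_i u i * pcomp xs (mderiv i p).

Definition taylor_ok p := inI2 g (pcomp (fun i => xs i + u i) p - pcomp xs p - lin1 p).

Lemma lin1_I p : inI g (lin1 p).
Proof. by apply: inI_sum => i _; apply: inIMr. Qed.

Lemma taylorD p q : taylor_ok p -> taylor_ok q -> taylor_ok (p + q).
Proof.
move=> Hp Hq; have := inI2D Hp Hq; rewrite /taylor_ok !pcompD.
have -> : lin1 (p + q) = lin1 p + lin1 q.
  by rewrite /lin1 -big_split; apply: eq_bigr => i _; rewrite mderivD pcompD mulrDr.
have alg (V : zmodType) (a b c d e f : V) : a - b - c + (d - e - f) = a + d - (b + e) - (c + f).
  by rewrite addrACA -opprD; congr (_ - _); rewrite addrACA -opprD.
by rewrite alg.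
Qed.

Lemma taylorM p q : taylor_ok p -> taylor_ok q -> taylor_ok (p * q).
Proof.
rewrite /taylor_ok !pcompM => Hp Hq.
have -> : lin1 (p * q) = lin1 p * pcomp xs q + pcomp xs p * lin1 q.
  rewrite /lin1 mulr_suml mulr_sumr -big_split; apply: eq_bigr => i _ /=.
  have -> : mderiv i (p * q) = mderiv i p * q + p * mderiv i q by rewrite mderivM.
  rewrite pcompD !pcompM; set a := pcomp xs _; set b := pcomp xs _; set c := pcomp xs _.
  by set d := pcomp xs _; rewrite mulrDr mulrA; congr (_ + _); exact: mulrCA.
move: (lin1_I p) (lin1_I q) Hp Hq.
generalize (lin1 p), (lin1 q), (pcomp xs p), (pcomp xs q) => dp dq a b.
generalize (pcomp (fun i => xs i + u i) p), (pcomp (fun i => xs i + u i) q) => a' b'.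
move=> Ldp Ldq Hp Hq.
have -> : a' * b' - a * b - (dp * b + a * dq) =
  dp * dq + dp * (b' - b - dq) + (a' - a - dp) * b' + a * (b' - b - dq) by ring.
apply: inI2D; [apply: inI2D; [apply: inI2D|]|]; [exact: inIM|exact: inI2Ml|exact: inI2Mr|exact: inI2Ml].
Qed.

Lemma taylorC c : taylor_ok (mpolyC N c).
Proof.
rewrite /taylor_ok !pcompC subrr sub0r.
have -> : lin1 (mpolyC N c) = 0.
  by apply: big1 => i _; rewrite mderivC -mpolyC0 pcompC mpolyC0 mulr0.
by rewrite oppr0; apply: inI20.
Qed.

Lemma taylorX i : taylor_ok (mpolyX K (mnm1 i)).
Proof.
rewrite /taylor_ok !pcompXU.
have -> : lin1 (mpolyX K (mnm1 i)) = u i.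
  rewrite /lin1 (bigD1 i) //= big1 => [|j ji].
    have -> : mderiv i (mpolyX K (mnm1 i)) = mpolyC N 1.
      rewrite mderivX mnm1E eqxx scale1r mpolyC1 -mpolyX0; congr (mpolyX _ _).
      by apply/mnmP => j; rewrite mnmBE subnn mnm0E.
    by rewrite pcompC mpolyC1 mulr1 addr0.
  have -> : mderiv j (mpolyX K (mnm1 i)) = mpolyC N 0.
    by rewrite mderivX mnm1E eq_sym (negPf ji) scale0r mpolyC0.
  by rewrite pcompC mpolyC0 mulr0.
by rewrite [xs i + _]addrC addrK subrr; apply: inI20.
Qed.

(** Taylor's formula to first order, modulo the square of an ideal containing
    the increments: it passes to sums and products. *)
Lemma taylor_square p : taylor_ok p.
Proof.
have mono d : forall a, mdeg a = d -> taylor_ok (mpolyX K a).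
  elim: d => [|d IH] a ad.
    have -> : a = @mnm0 N by apply/eqP; rewrite -mdeg_eq0 ad.
    by rewrite mpolyX0 -mpolyC1; apply: taylorC.
  have [i ai] : exists i, (0 < a i)%N by apply: mdeg_gt0; rewrite ad.
  have Ea : a = mnm_add (mnm1 i) (mnm_sub a (mnm1 i)).
    by rewrite addmC submK //; apply/mnm_lepP => j; rewrite mnm1E; case: eqP => // <-.
  have ad' : mdeg (mnm_sub a (mnm1 i)) = d.
    by apply/eqP; rewrite -eqSS -add1n -{1}(mdeg1 i) -mdegD -Ea ad.
  rewrite Ea mpolyXD; apply: taylorM; first exact: taylorX.
  exact: IH.
rewrite (mpolyE p); apply: (big_ind taylor_ok).
- by rewrite -mpolyC0; apply: taylorC.
- exact: taylorD.
- move=> a _; rewrite -mul_mpolyC; apply: taylorM; first exact: taylorC.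
  exact: (mono _ _ (erefl _)).
Qed.

End Taylor.

(** * Moving a matrix along its tangent vectors *)

Lemma sub_split (V : zmodType) (x y z : V) : x = y + z + (x - y - z).
Proof. by rewrite -[x - y - z]addrA -opprD [RHS]addrC subrK. Qed.

Section QuadraticEquation.
Variables (K : fieldType) (N m n : nat) (I : finType).
Local Notation T := (I * I * 'I_m * 'I_n)%type.
Local Notation P := (mpoly N K).
Local Notation P' := (mpoly (N + #|{: T}|) K).
Local Notation MM := ('M[P]_(m, n)).
(* The [nu a] will be the monomials of degree [K], and there is one unknown
   for each pair of them and each position in the matrix. *)
Variables (nu : I -> P) (U : P) (E : MM).

Definition xvar (i : 'I_N) : P' := mpolyX K (mnm1 (lshift #|{: T}| i)).
Definition yvar (t : T) : P' := mpolyX K (mnm1 (rshift N (enum_rank t))).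
Local Notation io := (pcomp xvar).
(** The coefficients of the displacement lie in the ideal of these elements, so
    that second-order terms are divisible by a product of two of the [nu]'s. *)
Definition ygen (s : I * T) : P' := io (nu s.1) * yvar s.2.

Lemma sum4 (V : nmodType) (F : T -> V) :
  \sum_t F t = \sum_a \sum_b \sum_i \sum_j F (a, b, i, j).
Proof.
rewrite pair_bigA pair_bigA pair_bigA /=.
by apply: eq_bigr => -[[[a b] i] j] _.
Qed.

Lemma sum2 (J J' : finType) (V : nmodType) (F : J * J' -> V) :
  \sum_s F s = \sum_a \sum_t F (a, t).
Proof. by rewrite pair_bigA; apply: eq_bigr => -[a t] _. Qed.

Hypothesis tangent : forall a i j, Tp E ((U * nu a) *: delta_mx i j).

(** Moving [E] along the tangent vectors [U nu_a e_ij], with coefficients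
    [nu_b y_abij], produces every [nu_a nu_b y_abij e_ij] up to terms that are
    quadratic in the [y]'s and still divisible by the products [nu_a nu_b]. *)
Lemma move_along_tangent :
  exists (u : 'I_N -> P') (B : 'M[P']_m) (Cc : 'M[P']_n) (q : T -> T -> T -> P'),
  [/\ forall l, inI ygen (u l), mxI ygen B, mxI ygen Cc &
   forall i j,
   ((1%:M + B) *m map_mx (pcomp (fun i => xvar i + u i)) E *m (1%:M + Cc)) i j =
   io (E i j) + \sum_a \sum_b io (nu a) * io (nu b) *
     (io U * yvar (a, b, i, j) + \sum_s \sum_t yvar s * yvar t * q (a, b, i, j) s t)].
Proof.
have /choice[f Hf] : forall t : T, exists f : ('I_N -> P) * 'M[P]_m * 'M[P]_n,
    (U * nu t.1.1.1) *: delta_mx t.1.2 t.2 =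
    \sum_l f.1.1 l *: dmx l E + f.1.2 *m E + E *m f.2.
  move=> t; have [u [b [c H]]] := tangent t.1.1.1 t.1.2 t.2.
  by exists (u, b, c).
pose co (t : T) : P' := ygen (t.1.1.2, t).
pose u l := \sum_t co t * io ((f t).1.1 l).
pose B : 'M[P']_m := \sum_t co t *: map_mx io (f t).1.2.
pose Cc : 'M[P']_n := \sum_t co t *: map_mx io (f t).2.
pose D : 'M[P']_(m, n) := \sum_l u l *: map_mx io (dmx l E).
have uI l : inI ygen (u l).
  by apply: inI_sum => t _; apply: inIMr; apply: inI_gen.
have BI : mxI ygen B.
  by move=> i j; rewrite summxE; apply: inI_sum => t _; rewrite mxE; apply: inIMr; apply: inI_gen.
have CI : mxI ygen Cc.
  by move=> i j; rewrite summxE; apply: inI_sum => t _; rewrite mxE; apply: inIMr; apply: inI_gen.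
have DI : mxI ygen D.
  by move=> i j; rewrite summxE; apply: inI_sum => t _; rewrite mxE; apply: inIMr.
pose E' := map_mx (pcomp (fun i => xvar i + u i)) E.
pose Q := E' - map_mx io E - D.
have QI : mxI2 ygen Q.
  move=> i j; have := taylor_square xvar uI (E i j); rewrite /taylor_ok.
  suff -> : Q i j = pcomp (fun i => xvar i + u i) (E i j) - io (E i j) - lin1 xvar u (E i j) by [].
  by rewrite !mxE; congr (_ - _); rewrite summxE; apply: eq_bigr => l _; rewrite !mxE.
have E'E : E' = map_mx io E + D + Q by exact: sub_split.
have lin : D + B *m map_mx io E + map_mx io E *m Cc =
    \sum_t (co t * io (U * nu t.1.1.1)) *: delta_mx t.1.2 t.2.
  have -> : D = \sum_t co t *: \sum_l io ((f t).1.1 l) *: map_mx io (dmx l E).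
    rewrite /D; under eq_bigr do rewrite scaler_suml.
    rewrite exchange_big; apply: eq_bigr => t _; rewrite scaler_sumr.
    by apply: eq_bigr => l _; rewrite scalerA.
  rewrite mulmx_suml mulmx_sumr -!big_split; apply: eq_bigr => t _ /=.
  rewrite -scalemxAl -scalemxAr -!scalerDr -scalerA; congr (_ *: _).
  have -> : io (U * nu t.1.1.1) *: delta_mx t.1.2 t.2 =
      map_mx io ((U * nu t.1.1.1) *: delta_mx t.1.2 t.2).
    rewrite pmZ; congr (_ *: _); apply/matrixP => i j; rewrite !mxE.
    by case: (_ && _); rewrite -?mpolyC1 -?mpolyC0 pcompC.
  by rewrite Hf !pmD !pmM pm_sum; congr (_ + _ + _); apply: eq_bigr => l _; rewrite pmZ.
have rest := mxI2_product (map_mx io E) BI CI DI QI; rewrite -E'E lin in rest.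
have /choice[q0 Hq0] : forall ij : 'I_m * 'I_n, exists q : I * T -> I * T -> P', _ :=
  fun ij => rest ij.1 ij.2.
pose q (t s s' : T) := q0 (t.1.2, t.2) (t.1.1.1, s) (t.1.1.2, s').
exists u, B, Cc, q; split=> // i j.
set W := (_ *m _ *m _) in rest Hq0 *.
have -> : W i j = (map_mx io E) i j +
   ((\sum_t (co t * io (U * nu t.1.1.1)) *: delta_mx t.1.2 t.2 : 'M[P']_(m, n)) i j +
   \sum_s \sum_t ygen s * ygen t * q0 (i, j) s t).
  rewrite -(Hq0 (i, j)) /=; move: (\sum_t _) => S; rewrite !mxE.
  by move: (W i j) (io _) (S i j) => a b c; ring.
rewrite mxE; congr (_ + _).
have -> : (\sum_t (co t * io (U * nu t.1.1.1)) *: delta_mx t.1.2 t.2 : 'M[P']_(m, n)) i j =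
  \sum_a \sum_b io (nu a) * io (nu b) * (io U * yvar (a, b, i, j)).
  rewrite summxE sum4; apply: eq_bigr => a _; apply: eq_bigr => b _.
  rewrite (bigD1 i) //= [X in _ + X]big1 ?addr0 => [|i' ii']; last first.
    by apply: big1 => j' _; rewrite !mxE eq_sym (negPf ii') mulr0.
  rewrite (bigD1 j) //= big1 ?addr0 => [|j' jj']; last first.
    by rewrite !mxE [j == _]eq_sym (negPf jj') andbF mulr0.
  rewrite !mxE !eqxx mulr1 /co /ygen /= pcompM.
  by move: (io _) (io _) (io _) (yvar _) => x y z t; ring.
have -> : \sum_s \sum_t ygen s * ygen t * q0 (i, j) s t =
  \sum_a \sum_b io (nu a) * io (nu b) * \sum_s \sum_t yvar s * yvar t * q (a, b, i, j) s t.
  rewrite sum2; apply: eq_bigr => a _; under eq_bigr do rewrite sum2.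
  rewrite exchange_big; apply: eq_bigr => b _; rewrite mulr_sumr; apply: eq_bigr => s _.
  rewrite mulr_sumr; apply: eq_bigr => t _; rewrite /ygen /q /=.
  by move: (io _) (io _) (yvar _) (yvar _) (q0 _ _ _) => x y z v w; ring.
rewrite -big_split; apply: eq_bigr => a _; rewrite -big_split; apply: eq_bigr => b _ /=.
by rewrite mulrDr.
Qed.

End QuadraticEquation.

(** * Absorbing perturbations *)

Section AbsorbPerturbation.
Variables (R : realType) (N m n : nat) (I : finType).
Local Notation C := (Cplx R).
Local Notation P := (mpoly N C).
Local Notation T := (I * I * 'I_m * 'I_n)%type.
Local Notation ev x p := (meval (fun i => x 0 i) p).

Lemma an_lsubmx p (f : 'rV[C]_N -> C) : analytic_germ f ->
  analytic_germ (fun z : 'rV[C]_(N + p) => f (lsubmx z)).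
Proof.
move=> A; have -> : (fun z : 'rV[C]_(N + p) => f (lsubmx z)) =
    (fun z => f (\row_i z 0 (lshift p i))).
  by apply: funext => z; congr f; apply/rowP => i; rewrite !mxE.
apply: (@an_comp R (N + p) N f (fun i z => z 0 (lshift p i)) A) => [i|i]; first exact: an_coord.
by rewrite mxE.
Qed.

Lemma meval_sum2 k (x : 'I_k -> C) (J J' : finType) (f : J -> J' -> mpoly k C) :
  meval x (\sum_a \sum_b f a b) = \sum_a \sum_b meval x (f a b).
Proof. by rewrite raddf_sum; apply: eq_bigr => a _; rewrite raddf_sum. Qed.

Lemma meval_term k (x : 'I_k -> C) (a b u y q : mpoly k C) :
  meval x (a * b * (u * y + q)) =
  meval x a * meval x b * (meval x u * meval x y + meval x q).
Proof. by rewrite !(mevalM, mevalD). Qed.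

(** Moving [E] along the tangent vectors as above leads to the equation
    [U y + (quadratic terms in y) = H], i.e.
    [y = (H - (U - 1) y) - (quadratic terms)], whose first term is a combination
    of the [x_i] since [H] and [U - 1] vanish at 0. The implicit function theorem
    gives an analytic [y], which is substituted in the displacement. That each
    [nu a] has order at least 2 makes the coordinate change tangent to the
    identity. *)
Theorem absorb_perturbation (nu : I -> P) (c : I -> 'I_N -> 'I_N -> P) (U : P) (E : 'M[P]_(m, n))
    (H : T -> 'rV[C]_N -> C) (F G : 'rV[C]_N -> 'M[C]_(m, n)) :
  meval (fun=> 0) U = 1 ->
  (forall a i j, Tp E ((U * nu a) *: delta_mx i j)) ->
  (forall a, nu a = \sum_k \sum_l mpolyX C (mnm1 k) * mpolyX C (mnm1 l) * c a k l) ->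
  (forall t, analytic_germ (H t)) -> (forall t, H t 0 = 0) ->
  near0 (fun x => F x = evmx x E) ->
  near0 (fun x => forall i j, G x i j = ev x (E i j) +
    \sum_a \sum_b ev x (nu a) * ev x (nu b) * H (a, b, i, j) x) ->
  G_equivalent G F.
Proof.
move=> U0 tan nuE HA H0 FE GE.
have [u [B [Cc [q [uI BI CI eqW]]]]] := move_along_tangent tan.
have [v [vA vE]] : exists v : 'I_N -> 'rV[C]_N -> C, (forall i, analytic_germ (v i)) /\
    near0 (fun x => ev x U - 1 = \sum_i x 0 i * v i x).
  apply: hadamard; first by apply: anB; [exact: an_poly|exact: an_c].
  have -> : meval (fun i => (0 : 'rV[C]_N) 0 i) U = meval (fun=> 0) U.
    by congr meval; apply: funext => i; rewrite mxE.
  by rewrite U0 subrr.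
have /choice[h Hh] : forall t, exists h : 'I_N -> 'rV[C]_N -> C, (forall i, analytic_germ (h i)) /\
    near0 (fun x => H t x = \sum_i x 0 i * h i x).
  by move=> t; apply: hadamard.
pose p := #|{: T}|.
pose al (j : 'I_p) i (z : 'rV[C]_(N + p)) : C :=
  h (enum_val j) i (lsubmx z) - v i (lsubmx z) * z 0 (rshift N j).
pose be (j k l : 'I_p) (z : 'rV[C]_(N + p)) : C :=
  - ev z (q (enum_val j) (enum_val k) (enum_val l)).
have alA j i : analytic_germ (al j i).
  apply: anB; first by apply: an_lsubmx; have [hA _] := Hh (enum_val j); exact: hA.
  by apply: anM; [apply: an_lsubmx; exact: vA|exact: an_coord].
have beA j k l : analytic_germ (be j k l) by apply: anN; exact: an_poly.
have [y [yA y0 yE]] := implicit_function alA beA.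
pose z (x : 'rV[C]_N) : 'rV[C]_(N + p) := row_mx x (\row_k y k x).
have zl x i : z x 0 (lshift p i) = x 0 i by rewrite /z row_mxEl.
have zr x k : z x 0 (rshift N k) = y k x by rewrite /z row_mxEr mxE.
have zA i : analytic_germ (fun x => z x 0 i).
  case: (split_ordP i) => k ->; first by under eq_fun do rewrite zl; exact: an_coord.
  by under eq_fun do rewrite zr; exact: yA.
have eA f : analytic_germ (fun x => ev (z x) f).
  by apply: (@an_meval R N (N + p) f (fun i x => z x 0 i)); exact: zA.
have eio x f : ev (z x) (pcomp (xvar C m n I) f) = ev x f.
  by rewrite meval_pcomp; congr meval; apply: funext => i; rewrite /xvar mevalXU zl.
have ey x t : ev (z x) (yvar C N t) = y (enum_rank t) x by rewrite /yvar mevalXU zr.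
have eI f : inI (ygen nu) f -> exists l : I * T -> 'rV[C]_N -> C,
    (forall s, analytic_germ (l s)) /\
    forall x, ev (z x) f = \sum_s ev x (nu s.1) * y (enum_rank s.2) x * l s x.
  move=> [l ->]; exists (fun s x => ev (z x) (l s)); split; first by move=> s; exact: eA.
  move=> x; rewrite raddf_sum; apply: eq_bigr => s _ /=.
  by rewrite mevalM /ygen mevalM eio ey.
have eI0 f : inI (ygen nu) f -> ev (z 0) f = 0.
  by move=> /eI[l [_ ->]]; rewrite big1 // => s _; rewrite y0 mulr0 mul0r.
pose hh i (x : 'rV[C]_N) : C := x 0 i + ev (z x) (u i).
have hhA i : analytic_germ (hh i) by apply: anD; [exact: an_coord|exact: eA].
have hh0 i : hh i 0 = 0 by rewrite /hh mxE eI0 ?addr0.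
have /choice[lu Hlu] := fun i => eI _ (uI i).
have hhT : tangent_id hh.
  exists (fun j k l (x : 'rV[C]_N) => \sum_s ev x (c s.1 k l) * y (enum_rank s.2) x * lu j s x); split.
    move=> j k l; apply: an_sum => s _; apply: anM; last by case: (Hlu j) => lA _; exact: lA.
    by apply: anM; [exact: an_poly|exact: yA].
  apply: (near0_mono _ FE) => x _ j; rewrite /hh; congr (_ + _).
  case: (Hlu j) => _ ->; under [RHS]eq_bigr do under eq_bigr do rewrite mulr_sumr.
  under [RHS]eq_bigr do rewrite exchange_big.
  rewrite [RHS]exchange_big; apply: eq_bigr => s _ /=.
  rewrite nuE raddf_sum -mulrA mulr_suml; apply: eq_bigr => k _ /=.
  rewrite raddf_sum mulr_suml; apply: eq_bigr => l _ /=.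
  by rewrite !mevalM !mevalXU !mulrA.
pose M1 x := evmx (z x) (1%:M + B); pose M2 x := evmx (z x) (1%:M + Cc).
have ev1 x k : evmx (z x) (1%:M : 'M[mpoly (N + p) C]_k) = 1%:M.
  by apply/matrixP => i j; rewrite !mxE; case: eqP; rewrite ?meval1 ?meval0.
have M10 : M1 0 = 1%:M.
  rewrite /M1 evmxD ev1 -[RHS]addr0; congr (_ + _).
  by apply/matrixP => i j; rewrite !mxE eI0.
have M20 : M2 0 = 1%:M.
  rewrite /M2 evmxD ev1 -[RHS]addr0; congr (_ + _).
  by apply/matrixP => i j; rewrite !mxE eI0.
have evA k l (W : 'M[mpoly (N + p) C]_(k, l)) : analytic_germ_mx (fun x => evmx (z x) W).
  by move=> i j; under eq_fun do rewrite mxE; exact: eA.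
have [_ GL1] : GL_germ M1 /\ GL_germ (fun x => invmx (M1 x)).
  by apply: GL_of_det; [exact: evA|rewrite M10 det1 oner_neq0].
have [GL2 _] : GL_germ M2 /\ GL_germ (fun x => invmx (M2 x)).
  by apply: GL_of_det; [exact: evA|rewrite M20 det1 oner_neq0].
exists (fun x => \row_i hh i x), M2, (fun x => invmx (M1 x)); split.
- exact: tangent_id_diffeo.
- exact: GL2.
- exact: GL1.
have FE' : near0 (fun x => F (\row_i hh i x) = evmx (\row_i hh i x) E).
  exact: (near0_comp FE hhA hh0).
have HE := near0_all (fun t => (Hh t).2).
apply: near0_mono (near0_and (near0_and FE' GE) (near0_and (near0_and HE vE) yE)).
move=> x [[-> GEx] [[HEx vEx] yEx]]; rewrite invmxK.
have -> : evmx (\row_i hh i x) E =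
    evmx (z x) (map_mx (pcomp (fun i => xvar C m n I i + u i)) E).
  apply/matrixP => i j; rewrite !mxE meval_pcomp; congr meval; apply: funext => k.
  by rewrite mxE mevalD /xvar mevalXU zl.
rewrite -!evmxM; apply/matrixP => i j; rewrite GEx [RHS]mxE eqW.
rewrite mevalD eio; apply: f_equal2 => //; rewrite meval_sum2.
apply: eq_bigr => a _; apply: eq_bigr => b _.
set t := (a, b, i, j); symmetry.
refine (etrans (meval_term _ _ _ _ _ _) (f_equal2 *%R
  (f_equal2 *%R (eio x (nu a)) (eio x (nu b))) (etrans (f_equal2 +%R
    (f_equal2 *%R (eio x U) (ey x t)) (meval_sum2 _ _)) _))).
have -> : \sum_s \sum_s' ev (z x) (yvar C N s * yvar C N s' * q t s s') =
    - \sum_k \sum_l y k x * y l x * be (enum_rank t) k l (z x).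
  rewrite (reindex _ (onW_bij _ (@enum_val_bij T))) -sumrN; apply: eq_bigr => k _ /=.
  rewrite (reindex _ (onW_bij _ (@enum_val_bij T))) -sumrN; apply: eq_bigr => l _ /=.
  by rewrite !mevalM !ey !enum_valK /be enum_rankK mulrN opprK.
have := yEx (enum_rank t); rewrite -/(z x) /=.
have -> : \sum_i0 x 0 i0 * al (enum_rank t) i0 (z x) =
    H t x - (ev x U - 1) * y (enum_rank t) x.
  rewrite HEx vEx mulr_suml -sumrB; apply: eq_bigr => k _.
  by rewrite /al enum_rankK /z row_mxKl -/(z x) zr mulrBr mulrA.
move: (\sum_k _) (y _ _) (ev x U) (H t x) => S Y V W eqY.
have -> : S = Y - (W - (V - 1) * Y) by rewrite {1}eqY; ring.
by ring.
Qed.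

End AbsorbPerturbation.

(** * Finite determinacy *)

Section Determinacy.
Variables (R : realType) (N m n : nat).
Local Notation C := (Cplx R).
Local Notation P := (mpoly N C).
Local Notation ev x p := (meval (fun i => x 0 i) p).

Lemma monomial_two_vars (a : multinom N) : (2 <= mdeg a)%N ->
  exists c : 'I_N -> 'I_N -> P, mpolyX C a =
    \sum_k \sum_l mpolyX C (mnm1 k) * mpolyX C (mnm1 l) * c k l.
Proof.
have pick (b : multinom N) : (0 < mdeg b)%N -> exists i, b = mnm_add (mnm1 i) (mnm_sub b (mnm1 i)).
  move=> /mdeg_gt0[i bi]; exists i.
  by rewrite addmC submK //; apply/mnm_lepP => j; rewrite mnm1E; case: (i =P j) => // <-.
move=> a2; have [i Ea] : exists i, a = mnm_add (mnm1 i) (mnm_sub a (mnm1 i)) by apply: pick; lia.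
set a' := mnm_sub a (mnm1 i) in Ea.
have [j Ea'] : exists j, a' = mnm_add (mnm1 j) (mnm_sub a' (mnm1 j)).
  by apply: pick; move: a2; rewrite Ea mdegD mdeg1.
set b := mnm_sub a' (mnm1 j) in Ea'.
exists (fun k l => if (k == i) && (l == j) then mpolyX C b else 0).
rewrite (bigD1 i) //= [X in _ + X]big1 ?addr0 => [|k /negPf ki]; last first.
  by apply: big1 => l _; rewrite ki mulr0.
rewrite (bigD1 j) //= big1 ?addr0 => [|l /negPf lj]; last by rewrite lj andbF mulr0.
by rewrite !eqxx /= {1}Ea {1}Ea' !mpolyXD mulrA.
Qed.

Lemma mpartialB (a : multinom N) (f g : 'rV[C]_N -> C) : analytic_germ f -> analytic_germ g ->
  mpartial a (fun x => f x - g x) 0 = mpartial a f 0 - mpartial a g 0.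
Proof.
move=> /analyticP[q Hq] /analyticP[q' Hq'].
have -> : (fun x => f x - g x) = (fun x => f x + -1 * g x).
  by apply: funext => x; rewrite mulN1r.
have Hd := apprD Hq (apprM (appr_c N (-1 : C)) Hq').
have [c _ Hc] := mpartial_coef R a.
move: Hq Hq' Hd => [r1 [M1 A1]] [r2 [M2 A2]] [r3 [M3 A3]].
rewrite (Hc _ _ _ _ A1 _ (leqnn _)) (Hc _ _ _ _ A2 _ (leqnn _)) (Hc _ _ _ _ A3 _ (leqnn _)).
by rewrite mcoeffD mcoeffCM mulN1r mulrnBl.
Qed.

Section Regroup.
Variable K : nat.
Local Notation I := (bmultinom N K.+1).
Local Notation J := (bmultinom N (K + K).+1).

Lemma bjoin_proof (a b : I) : (mdeg (mnm_add a b) < (K + K).+1)%N.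
Proof. by rewrite mdegD ltnS leq_add // -ltnS bmdeg. Qed.

Definition bjoin (p : I * I) : J := BMultinom (bjoin_proof p.1 p.2).

(** Every monomial of degree [2K] is the product of two monomials of degree [K];
    [Q] selects one factorization of each. *)
Lemma regroup : exists Q : pred (I * I),
  (forall p, Q p -> mdeg p.1 = K /\ mdeg p.2 = K) /\
  forall f : multinom N -> C, \sum_(e : J | mdeg e == (K + K)%N) f e = \sum_(p | Q p) f (bjoin p).
Proof.
have /choice[sg Hs] : forall b : multinom N, exists a, (K <= mdeg b)%N -> lem a b /\ mdeg a = K.
  move=> b; have [kb|nkb] := leqP K (mdeg b); last by exists b.
  by have [a Ha] := exists_submon kb; exists a.
have b0K : (mdeg (@mnm0 N) < K.+1)%N by rewrite mdeg0.
pose b0 : I := BMultinom b0K.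
pose h' (e : J) : I * I := (insubd b0 (sg e), insubd b0 (mnm_sub e (sg e))).
exists [pred p | (mdeg (bjoin p) == (K + K)%N) && (h' (bjoin p) == p)]; split.
  move=> [a b] /= /andP[/eqP H _]; move: H; rewrite mdegD.
  by have := bmdeg a; have := bmdeg b; lia.
move=> f; apply: reindex_onto => e /eqP eK.
have [se sK] := Hs e (ltac:(lia)).
have sK' : mdeg (mnm_sub e (sg e)) = K.
  by apply/eqP; rewrite -(eqn_add2r (mdeg (sg e))) -mdegD submK // eK sK.
by apply: val_inj; rewrite /= !val_insubd sK sK' ltnSn addmC submK.
Qed.

End Regroup.

(** The order of determinacy is [2K] for any [K >= k] with [K >= 2]. A germ with
    the same jet differs from [E] by a combination of the monomials of degree
    [2K] with coefficients vanishing at 0, each split into two factors of degree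
    [K]: the first makes it tangent, the second is a multiplier in front of the
    displacement. *)
Theorem annihilated_determined (F : 'rV[C]_N -> 'M[C]_(m, n)) (E : 'M[P]_(m, n)) U k :
  near0 (fun x => F x = evmx x E) -> meval (fun=> 0) U = 1 ->
  (forall a i j, (k <= mdeg a)%N -> Tp E (U *: Emx C a i j)) ->
  finitely_G_determined F.
Proof.
move=> FE U0 tan; pose K := maxn k 2; exists (K + K)%N => G GA GF.
have [Q [Q1 Q2]] := regroup K.
pose f i j (x : 'rV[C]_N) : C := G x i j - ev x (E i j).
have fA i j : analytic_germ (f i j) by apply: anB; [exact: GA|exact: an_poly].
have f0 i j a : (mdeg a <= K + K)%N -> mpartial a (f i j) 0 = 0.
  move=> aK; rewrite mpartialB; [|exact: GA|exact: an_poly].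
  rewrite (GF a aK) (@mpartial_near _ _ a (fun x => F x i j) (fun x => ev x (E i j))) ?subrr //.
  by apply: near0_mono FE => x ->; rewrite mxE.
have /choice[g Hg] : forall ij : 'I_m * 'I_n, exists g : multinom N -> 'rV[C]_N -> C,
   [/\ forall a, analytic_germ (g a),
       near0 (fun x => f ij.1 ij.2 x =
         \sum_(a : bmultinom N (K + K).+1 | mdeg a == (K + K)%N) monomial a x * g a x) &
       forall a, mdeg a = (K + K)%N -> g a 0 = 0].
  move=> [i j]; have [|g [gA gE g0]] := analytic_division (k := (K + K)%N) (fA i j).
    by move=> a aK; apply: f0; apply: ltnW.
  exists g; split; [exact: gA|exact: gE|].
  by move=> a aK; apply: g0 => //; apply: f0; rewrite aK.
pose nu (a : bmultinom N K.+1) : P := if mdeg a == K then mpolyX C a else 0.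
pose H (t : bmultinom N K.+1 * bmultinom N K.+1 * 'I_m * 'I_n) : 'rV[C]_N -> C :=
  if Q t.1.1 then g (t.1.2, t.2) (bjoin t.1.1) else fun=> 0.
have /choice[c Hc] : forall a, exists c : 'I_N -> 'I_N -> P,
    nu a = \sum_k \sum_l mpolyX C (mnm1 k) * mpolyX C (mnm1 l) * c k l.
  move=> a; rewrite /nu; case: (mdeg a =P K) => [aK|_].
    by apply: monomial_two_vars; rewrite aK leq_maxr.
  exists (fun _ _ => 0); rewrite big1 // => i _; rewrite big1 // => j _.
  by rewrite mulr0.
apply: (@absorb_perturbation R N m n _ nu c U E H F G U0 _ Hc) => //.
- move=> a i j; rewrite /nu; case: (mdeg a =P K) => [aK|_].
    by rewrite -scalerA; apply: tan; rewrite aK leq_maxl.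
  by rewrite mulr0 scale0r; apply: Tp0.
- move=> t; rewrite /H; case: ifP => _; last exact: an_c.
  by have [gA _ _] := Hg (t.1.2, t.2); exact: gA.
- move=> t; rewrite /H; case: ifP => // /Q1[d1 d2].
  by have [_ _ g0] := Hg (t.1.2, t.2); apply: g0; rewrite /= mdegD d1 d2.
have HE : near0 (fun x => forall ij : 'I_m * 'I_n, f ij.1 ij.2 x =
    \sum_(a : bmultinom N (K + K).+1 | mdeg a == (K + K)%N) monomial a x * g ij a x).
  by apply: near0_all => ij; case: (Hg ij).
apply: (near0_mono _ HE) => x HEx i j.
have -> : G x i j = ev x (E i j) + f i j x by rewrite /f addrC subrK.
congr (_ + _); rewrite (HEx (i, j)) (Q2 (fun a => monomial a x * g (i, j) a x)).
rewrite big_mkcond pair_bigA; apply: eq_bigr => -[a b] _ /=.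
rewrite /H /=; case: ifP => [Qab|_]; last by rewrite mulr0.
have [/= aK bK] := Q1 _ Qab; rewrite /nu aK bK !eqxx; congr (_ * _).
by rewrite !mevalX -big_split; apply: eq_bigr => l _; rewrite mnmDE exprD.
Qed.

End Determinacy.

(** * The analytic tangent space *)

Section AnalyticTangent.
Variables (R : realType) (N m n : nat).
Local Notation C := (Cplx R).
Local Notation P := (mpoly N C).
Local Notation MM := ('M[P]_(m, n)).
Local Notation germ_mx := ('rV[C]_N -> 'M[C]_(m, n)).
Local Notation ev x p := (meval (fun i => x 0 i) p).

Lemma partial_poly (f : 'rV[C]_N -> C) p i : near0 (fun x => f x = ev x p) ->
  near0 (fun x => partial i f x = ev x (mderiv i p)).
Proof.
move=> fp; have [r [M A]] : appr (fun=> p) f.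
  by apply: appr_near (appr_poly p); apply: near0_mono fp => x.
apply: (appr_eq (q := fun=> mderiv i p)); first exact: (approx_deriv i A).
exact: appr_poly.
Qed.

(** The extended tangent space of the germ of a polynomial matrix [E], with the
    combinations of the [R_lk] and of the [C_pq] written as products with [E]. *)
Definition TA (E : MM) (H : germ_mx) :=
  exists (u : 'I_N -> 'rV[C]_N -> C) (b : 'rV[C]_N -> 'M[C]_m) (c : 'rV[C]_N -> 'M[C]_n),
  [/\ forall i, analytic_germ (u i), analytic_germ_mx b, analytic_germ_mx c &
   near0 (fun x => H x = \sum_i u i x *: evmx x (dmx i E) + b x *m evmx x E + evmx x E *m c x)].

Lemma sum_Rmx (b : 'I_m -> 'I_m -> C) (F : germ_mx) x :
  \sum_l \sum_k b l k *: Rmx l k F x = (\matrix_(l, k) b l k) *m F x.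
Proof.
apply/matrixP => i j; rewrite summxE mxE (bigD1 i) //= [X in _ + X]big1 ?addr0.
  by rewrite summxE; apply: eq_bigr => k _; rewrite !mxE eqxx.
move=> l /negPf li; rewrite summxE big1 // => k _.
by rewrite !mxE eq_sym li mulr0.
Qed.

Lemma sum_Cmx (c : 'I_n -> 'I_n -> C) (F : germ_mx) x :
  \sum_p \sum_q c p q *: Cmx p q F x = F x *m (\matrix_(q, p) c p q).
Proof.
apply/matrixP => i j; rewrite summxE mxE (bigD1 j) //= [X in _ + X]big1 ?addr0.
  by rewrite summxE; apply: eq_bigr => k _; rewrite !mxE eqxx mulrC.
move=> l /negPf li; rewrite summxE big1 // => k _.
by rewrite !mxE eq_sym li mulr0.
Qed.

Lemma TGe_TA (F : germ_mx) (E : MM) H : near0 (fun x => F x = evmx x E) ->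
  TGe F H <-> TA E H.
Proof.
move=> FE.
have dF : near0 (fun x => forall i, partial_mx i F x = evmx x (dmx i E)).
  apply: near0_all => i.
  have : near0 (fun x => forall kl : 'I_m * 'I_n,
      partial i (fun y => F y kl.1 kl.2) x = ev x (mderiv i (E kl.1 kl.2))).
    apply: near0_all => kl; apply: partial_poly; apply: near0_mono FE => x ->.
    by rewrite mxE.
  by apply: near0_mono => x Hx; apply/matrixP => k l; rewrite !mxE (Hx (k, l)).
split=> [[u [b [c [uA bA cA HE]]]]|[u [b [c [uA bA cA HE]]]]].
- exists u, (fun x => \matrix_(l, k) b l k x), (fun x => \matrix_(q, p) c p q x); split.
  + exact: uA.
  + by move=> i j; under eq_fun do rewrite mxE; exact: bA.
  + by move=> i j; under eq_fun do rewrite mxE; exact: cA.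
  apply: near0_mono (near0_and HE (near0_and dF FE)) => x [-> [dFx Fx]].
  have -> : \sum_i u i x *: partial_mx i F x = \sum_i u i x *: evmx x (dmx i E).
    by apply: eq_bigr => i _; rewrite dFx.
  by rewrite sum_Rmx sum_Cmx Fx.
- exists u, (fun l k x => b x l k), (fun p q x => c x q p); split.
  + exact: uA.
  + by move=> l k; exact: bA.
  + by move=> p q; exact: cA.
  apply: near0_mono (near0_and HE (near0_and dF FE)) => x [-> [dFx Fx]].
  have -> : \sum_i u i x *: partial_mx i F x = \sum_i u i x *: evmx x (dmx i E).
    by apply: eq_bigr => i _; rewrite dFx.
  rewrite sum_Rmx sum_Cmx Fx.
  have -> : \matrix_(l, k) b x l k = b x by apply/matrixP => i j; rewrite mxE.
  by have -> : \matrix_(q, p) c x q p = c x by apply/matrixP => i j; rewrite mxE.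
Qed.

Lemma TA_near E H H' : near0 (fun x => H x = H' x) -> TA E H -> TA E H'.
Proof.
move=> e [u [b [c [uA bA cA HE]]]]; exists u, b, c; split=> //.
by apply: near0_mono (near0_and e HE) => x [<- ->].
Qed.

Lemma TA0 E : TA E (fun=> 0).
Proof.
exists (fun _ _ => 0), (fun=> 0), (fun=> 0); split.
- by move=> i; exact: an_c.
- by move=> i j; exact: an_c.
- by move=> i j; exact: an_c.
rewrite /near0; apply: filterE => x; rewrite mul0mx mulmx0 !addr0 big1 // => i _.
by rewrite scale0r.
Qed.

Lemma TAD E H H' : TA E H -> TA E H' -> TA E (fun x => H x + H' x).
Proof.
move=> [u [b [c [uA bA cA HE]]]] [u' [b' [c' [uA' bA' cA' HE']]]].
exists (fun i x => u i x + u' i x), (fun x => b x + b' x), (fun x => c x + c' x); split.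
- by move=> i; apply: anD; [exact: uA|exact: uA'].
- by move=> i j; under eq_fun do rewrite mxE; apply: anD; [exact: bA|exact: bA'].
- by move=> i j; under eq_fun do rewrite mxE; apply: anD; [exact: cA|exact: cA'].
apply: near0_mono (near0_and HE HE') => x [-> ->].
rewrite mulmxDl mulmxDr addrACA; congr (_ + _); rewrite addrACA; congr (_ + _).
by rewrite -big_split; apply: eq_bigr => l _; rewrite scalerDl.
Qed.

Lemma TAZ E H g : analytic_germ g -> TA E H -> TA E (fun x => g x *: H x).
Proof.
move=> gA [u [b [c [uA bA cA HE]]]].
exists (fun i x => g x * u i x), (fun x => g x *: b x), (fun x => g x *: c x); split.
- by move=> i; apply: anM; [exact: gA|exact: uA].
- by move=> i j; under eq_fun do rewrite mxE; apply: anM; [exact: gA|exact: bA].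
- by move=> i j; under eq_fun do rewrite mxE; apply: anM; [exact: gA|exact: cA].
apply: near0_mono HE => x ->; rewrite !scalerDr scalemxAl scalemxAr; congr (_ + _ + _).
by rewrite scaler_sumr; apply: eq_bigr => l _; rewrite scalerA.
Qed.

Lemma TA_sum E (I : Type) (s : seq I) (Q : pred I) (H : I -> germ_mx) :
  (forall i, Q i -> TA E (H i)) -> TA E (fun x => \sum_(i <- s | Q i) H i x).
Proof.
move=> HA; elim: s => [|i s IH].
  by under eq_fun do rewrite big_nil; exact: TA0.
under eq_fun do rewrite big_cons; case: (boolP (Q i)) => Qi; last exact: IH.
by apply: TAD; [exact: HA|exact: IH].
Qed.

Lemma evmxZ x (p : P) (M : MM) : evmx x (p *: M) = ev x p *: evmx x M.
Proof. by apply/matrixP => i j; rewrite !mxE mevalM. Qed.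

Lemma evmx_sum x (I : Type) (s : seq I) (Q : pred I) (M : I -> MM) :
  evmx x (\sum_(i <- s | Q i) M i) = \sum_(i <- s | Q i) evmx x (M i).
Proof.
apply/matrixP => i j; rewrite mxE !summxE raddf_sum.
by apply: eq_bigr => k _; rewrite mxE.
Qed.

Lemma evmx_delta x i j :
  evmx x (delta_mx i j : MM) = delta_mx i j.
Proof. by apply/matrixP => k l; rewrite !mxE; case: (_ && _); rewrite ?meval1 ?meval0. Qed.

Lemma Tp_TA E M : Tp E M -> TA E (fun x => evmx x M).
Proof.
move=> [u [b [c ->]]]; exists (fun i x => ev x (u i)), (fun x => evmx x b), (fun x => evmx x c); split.
- by move=> i; exact: an_poly.
- by move=> i j; under eq_fun do rewrite mxE; exact: an_poly.
- by move=> i j; under eq_fun do rewrite mxE; exact: an_poly.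
rewrite /near0; apply: filterE => x; rewrite !evmxD !evmxM evmx_sum; congr (_ + _ + _).
by apply: eq_bigr => i _; rewrite evmxZ.
Qed.

Lemma eqm_ordmx d (A B : MM) : eqm d A B -> ordmx d (A - B).
Proof. by move=> H i j; have := H i j; rewrite !mxE. Qed.

(** Truncating the coefficients of an analytic tangent vector gives a
    polynomial one with the same jet. *)
Lemma TA_truncate E M d : TA E (fun x => evmx x M) ->
  exists2 T, Tp E T & ordmx d.+1 (M - T).
Proof.
move=> [u [b [c [uA bA cA HE]]]].
have /choice[uq Hu] := fun i => (analyticP (u i)).1 (uA i).
have [bq Hb] := analytic_apprmx bA; have [cq Hc] := analytic_apprmx cA.
exists (\sum_l uq l d *: dmx l E + bq d *m E + E *m cq d).
  by exists (fun l => uq l d), (bq d), (cq d).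
suff : eqm d.+1 M (\sum_l uq l d *: dmx l E + bq d *m E + E *m cq d).
  exact: eqm_ordmx.
pose Qd d := \sum_l uq l d *: dmx l E + bq d *m E + E *m cq d.
apply: (apprmx_unique (Q := fun=> M) (Q' := Qd) (apprmx_poly M) _ HE) => i j.
have -> : (fun d => Qd d i j) = (fun d => \sum_l uq l d * dmx l E i j +
    (bq d *m E) i j + (E *m cq d) i j).
  apply: funext => e; rewrite /Qd mxE; congr (_ + _); rewrite mxE; congr (_ + _).
  by rewrite summxE; apply: eq_bigr => l _; rewrite mxE.
have -> : (fun x => (\sum_l u l x *: evmx x (dmx l E) + b x *m evmx x E + evmx x E *m c x) i j)
  = (fun x => \sum_l u l x * evmx x (dmx l E) i j + (b x *m evmx x E) i j +
      (evmx x E *m c x) i j).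
  apply: funext => x; rewrite mxE; congr (_ + _); rewrite mxE; congr (_ + _).
  by rewrite summxE; apply: eq_bigr => l _; rewrite mxE.
apply: apprD; first apply: apprD.
- by apply: appr_sum => l _; apply: apprM; [exact: Hu|exact: (apprmx_poly (dmx l E) i j)].
- exact: (apprmxM Hb (apprmx_poly E)).
- exact: (apprmxM (apprmx_poly E) Hc).
Qed.

End AnalyticTangent.

(** * Codimension *)

Section Codimension.
Variables (R : realType) (N m n s : nat).
Local Notation C := (Cplx R).
Local Notation P := (mpoly N C).
Local Notation MM := ('M[P]_(m, n)).
Local Notation J := (bmultinom N s * 'I_m * 'I_n)%type.
Local Notation ev x p := (meval (fun i => x 0 i) p).
Implicit Types (E M : MM) (S : {set J}).

Definition Emx_at (t : J) : MM := Emx C (bmnm t.1.1) t.1.2 t.2.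

Lemma evmx_lincomb x S (z : J -> C) :
  evmx x (lincomb S z) = \sum_(t in S) z t *: evmx x (Emx_at t).
Proof.
rewrite evmx_sum; apply: eq_bigr => t _.
exact: etrans (evmxZ x (mpolyC N (z t)) (Emx_at t)) (f_equal (fun c => c *: _) (mevalC _ _)).
Qed.

Lemma enum_val_sum (V : nmodType) S (f : J -> V) :
  \sum_(t in S) f t = \sum_(i < #|S|) f (enum_val i).
Proof. exact: big_enum_val. Qed.

(** A relation between the elements of [S] modulo the analytic tangent space is
    one modulo the polynomial tangent module up to order [s], where that module
    contains everything. *)
Lemma de_ge_independent F E S : near0 (fun x => F x = evmx x E) ->
  (forall M, ordmx s M -> Tp E M) -> independent E S ->
  (#|S|%:R%:E <= de F)%E.
Proof.
move=> FE fin ind; apply: ereal_sup_ubound; exists #|S| => //.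
exists (fun i x => evmx x (Emx_at (enum_val i))); split.
  by move=> i k l; under eq_fun do rewrite mxE; exact: an_poly.
move=> z /(TGe_TA _ FE) H.
have [t0|S0] := pickP [pred t | t \in S]; last first.
  by move=> i; have := enum_valP i; have := S0 (enum_val i); rewrite /= => ->.
move=> t0S i.
pose z' (t : J) : C := z (enum_rank_in t0S t).
have z'E k : z' (enum_val k) = z k by rewrite /z' enum_valK_in.
rewrite -z'E; apply: ind; last exact: enum_valP.
have [|T T1 T2] := @TA_truncate R N m n E (lincomb S z') s.
  apply: (TA_near _ H); rewrite /near0; apply: filterE => x.
  by rewrite evmx_lincomb enum_val_sum; apply: eq_bigr => k _; rewrite z'E.
rewrite -(subrK T (lincomb S z')); apply: TpD => //; apply: fin => k l.
by apply: ordgeW (T2 k l).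
Qed.

(** A germ is a polynomial plus a combination, with analytic coefficients, of
    the monomials of degree [k]. The polynomial is spanned by [S]; the monomials
    [x^a e_ij] are in the tangent space because [U x^a e_ij] is and [U] is a
    unit of the local ring. *)
Lemma analytic_spanned E S : (forall M, spanned E S M) ->
  forall H : 'rV[C]_N -> 'M[C]_(m, n), analytic_germ_mx H ->
  exists z : J -> C, TA E (fun x => H x - evmx x (lincomb S z)).
Proof.
move=> span H HA; have [U [k [U0 tan]]] := local_annihilator span.
have [q Hq] := analytic_apprmx HA.
pose p := q k.
pose f i j (x : 'rV[C]_N) : C := H x i j - ev x (p i j).
have fA i j : analytic_germ (f i j) by apply: anB; [exact: HA|exact: an_poly].
have f0 i j a : (mdeg a < k)%N -> mpartial a (f i j) 0 = 0.
  move=> ak; rewrite mpartialB; [|exact: HA|exact: an_poly].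
  have [c _ Hc] := mpartial_coef R a; have [r1 [M1 A1]] := Hq i j.
  have [r2 [M2 A2]] := appr_poly (p i j).
  by rewrite (Hc _ _ _ _ A1 _ (ltnW ak)) (Hc _ _ _ _ A2 _ (ltnW ak)) subrr.
have /choice[g Hg] : forall ij : 'I_m * 'I_n, exists g : multinom N -> 'rV[C]_N -> C,
   (forall a, analytic_germ (g a)) /\ near0 (fun x => f ij.1 ij.2 x =
         \sum_(a : bmultinom N k.+1 | mdeg a == k) monomial a x * g a x).
  move=> [i j]; have [g [gA gE _]] := analytic_division (fA i j) (f0 i j).
  by exists g; split; [exact: gA|exact: gE].
have [z Hz] := span p; exists z.
have UA : analytic_germ (fun x : 'rV[C]_N => ev x U) by exact: an_poly.
have U0' : ev (0 : 'rV[C]_N) U != 0.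
  have -> : ev (0 : 'rV[C]_N) U = meval (fun=> 0) U.
    by congr meval; apply: funext => i; rewrite mxE.
  by rewrite U0 oner_neq0.
have rest : TA E (fun x => \sum_i \sum_j \sum_(a : bmultinom N k.+1 | mdeg a == k)
    ((ev x U)^-1 * g (i, j) a x) *: evmx x (U *: Emx C a i j)).
  apply: TA_sum => i _; apply: TA_sum => j _; apply: TA_sum => a /eqP ak.
  apply: TAZ; last by apply: Tp_TA; apply: tan; rewrite ak.
  apply: anM; first by apply: an_inv; [exact: UA|exact: U0'].
  by case: (Hg (i, j)) => gA _; exact: gA.
have HE : near0 (fun x => forall ij : 'I_m * 'I_n, f ij.1 ij.2 x =
    \sum_(a : bmultinom N k.+1 | mdeg a == k) monomial a x * g ij a x).
  by apply: near0_all => ij; case: (Hg ij).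
apply: TA_near (TAD (Tp_TA Hz) rest).
apply: near0_mono (near0_and HE (an_nz UA U0')) => x [HEx Ux].
have -> : evmx x (p - lincomb S z) = evmx x p - evmx x (lincomb S z).
  by apply/matrixP => i j; rewrite !mxE mevalB.
have -> : H x = evmx x p + \matrix_(i, j) f i j x.
  by apply/matrixP => i j; rewrite !mxE /f addrC subrK.
rewrite [RHS]addrAC; congr (_ + _); rewrite [RHS]matrix_sum_delta.
apply: eq_bigr => i _; apply: eq_bigr => j _.
rewrite mxE (HEx (i, j)) scaler_suml; apply: eq_bigr => a _.
rewrite /Emx !evmxZ evmx_delta !scalerA mevalX; congr (_ *: _).
rewrite -/(monomial a x); move: (monomial _ _) (g _ _ _) (ev x U) Ux => y e v v0.
by field.
Qed.

(** More germs than elements of [S] have a nontrivial combination whose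
    coordinates on [S] vanish. *)
Lemma de_le_spanning F E S : near0 (fun x => F x = evmx x E) ->
  (forall M, spanned E S M) -> (de F <= #|S|%:R%:E)%E.
Proof.
move=> FE span; apply: ge_ereal_sup => _ [k [v [vA ind]] <-].
rewrite lee_fin ler_nat leqNgt; apply/negP => Sk.
have /choice[z Hz] := fun i => analytic_spanned span (vA i).
pose Z : 'M[C]_(k, #|S|) := \matrix_(i, t) z i (enum_val t).
have : kermx Z != 0.
  by rewrite kermx_eq0 /row_free; apply: contraTneq (rank_leq_col Z) => ->; rewrite -ltnNge.
case/rowV0Pn => l /sub_kermxP lZ /eqP; apply; apply/rowP => i; rewrite mxE.
apply: (ind (fun i => l 0 i)); apply/(TGe_TA _ FE).
have T := @TA_sum R N m n E 'I_k (index_enum _) predT _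
  (fun i _ => TAZ (an_c _ (l 0 i)) (Hz i)).
apply: TA_near T; rewrite /near0; apply: filterE => x.
under eq_bigr do rewrite scalerBr.
rewrite sumrB [X in _ - X](_ : _ = 0) ?subr0 //.
under eq_bigr do rewrite evmx_lincomb enum_val_sum scaler_sumr.
rewrite exchange_big big1 // => t _ /=.
under eq_bigr do rewrite scalerA.
rewrite -scaler_suml.
have -> : \sum_i l 0 i * z i (enum_val t) = (l *m Z) 0 t.
  by rewrite mxE; apply: eq_bigr => j _; rewrite mxE.
by rewrite lZ mxE scale0r.
Qed.

End Codimension.

Lemma wdegree_wlt (R : realType) N (w : 'I_N -> nat) (d : nat) (p : mpoly N (Cplx R)) :
  (wdegree w p < d%:R%:E)%E -> wlt w d%:Z p.
Proof.
move=> H a ap; rewrite ltz_nat -(ltr_nat R) -lte_fin; apply: le_lt_trans H.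
rewrite /wdegree; elim: (msupp p) ap => [|b s IH]; first by [].
rewrite inE big_cons le_max => /orP[/eqP->|/IH ->]; first by rewrite lexx.
by rewrite orbT.
Qed.

Theorem proposition3p1 (R : realType) (N m n : nat)
    (hN : (1 <= N)%N) (hm : (1 <= m)%N) (hn : (1 <= n)%N)
    (w : 'I_N -> nat) (hw : forall k, (0 < w k)%N)
    (D : 'M[nat]_(m, n)) (F G : 'rV[Cplx R]_N -> 'M[Cplx R]_(m, n))
    (hF : analytic_germ_mx F)
    (hFhom : forall i j, weighted_homogeneous w (D i j) (fun x => F x i j))
    (hFdet : finitely_G_determined F)
    (hFtype : weighted_homogeneous_type w D F)
    (hG : forall i j, exists2 p : mpoly N (Cplx R),
        germ_of_poly p (fun x => G x i j) &
        (wdegree w p < (D i j)%:R%:E)%E) :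
  finitely_G_determined (fun x => F x + G x) /\
  (de (fun x => F x + G x)%R <= de F)%E.
Proof.
pose i0 : 'I_m := Ordinal hm; pose j0 : 'I_n := Ordinal hn.
have /choice[f Hf] : forall ij : 'I_m * 'I_n, exists f : mpoly N (Cplx R),
    germ_of_poly f (fun x => F x ij.1 ij.2) /\ whom w (D ij.1 ij.2)%:Z f.
  move=> [i j]; have [f f1 f2] := hFhom i j; exists f; split=> // a af.
  by rewrite (f2 a af).
have /choice[g Hg] : forall ij : 'I_m * 'I_n, exists g : mpoly N (Cplx R),
    germ_of_poly g (fun x => G x ij.1 ij.2) /\ wlt w (D ij.1 ij.2)%:Z g.
  move=> [i j]; have [g g1 g2] := hG i j; exists g; split=> //.
  exact: wdegree_wlt.
pose Fp : 'M[mpoly N (Cplx R)]_(m, n) := \matrix_(i, j) f (i, j).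
pose Gp : 'M[mpoly N (Cplx R)]_(m, n) := \matrix_(i, j) g (i, j).
have FE : near0 (fun x => F x = evmx x Fp).
  have := near0_all (fun ij => (Hf ij).1); apply: near0_mono => x Hx.
  by apply/matrixP => i j; rewrite !mxE (Hx (i, j)).
have GE : near0 (fun x => G x = evmx x Gp).
  have := near0_all (fun ij => (Hg ij).1); apply: near0_mono => x Hx.
  by apply/matrixP => i j; rewrite !mxE (Hx (i, j)).
have FGE : near0 (fun x => F x + G x = evmx x (Fp + Gp)).
  by apply: near0_mono (near0_and FE GE) => x [-> ->]; rewrite evmxD.
have Fhom i j : whom w (D i j)%:Z (Fp i j) by rewrite mxE; exact: (Hf (i, j)).2.
have Glt i j : wlt w (D i j)%:Z (Gp i j) by rewrite mxE; exact: (Hg (i, j)).2.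
have [_ Dtype] := hFtype; have [r det] := hFdet.
have fin := Tp_complete hw i0 j0 Fhom Dtype (determined_tangent FE det).
have [S [ind span]] := exists_basis fin.
have spanG := spanned_perturb i0 j0 Fhom Glt Dtype span.
have [U [k [U0 tan]]] := local_annihilator spanG.
split; first exact: (annihilated_determined FGE U0 tan).
exact: le_trans (de_le_spanning FGE spanG) (de_ge_independent FE fin ind).
Qed.
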